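(* Let $R$ be a perfectoid ring of characteristic $0$ and let $\mathfrak{q}$ be a $p^{\flat}$-adically closed prime ideal of $R^{\flat}$. Then the untilt $\mathfrak{q}^{\sharp}$ is a prime ideal of $R$.
   Context: Fix a prime number $p$. Perfectoid rings are meant in the (integral) sense of Bhatt–Morrow–Scholze: a ring $R$ is perfectoid if there is $\pi\in R$ such that $R$ is $\pi$-adically complete (and separated), $\pi^p$ divides $p$ in $R$, the Frobenius on $R/pR$ is surjective, and the kernel of the theta map $\theta_R\colon W(R^{\flat})\to R$, $\sum_{n\ge 0}[x_n]p^n\mapsto\sum_{n\ge 0}x_n^{\sharp}p^n$, is principal. For a $p$-adically complete ring $R$, the tilt is $R^{\flat}:=\varprojlim_F R/pR$ ($F$ the Frobenius), whose underlying multiplicative monoid is identified with $\varprojlim_{x\mapsto x^p}R$, so elements of $R^{\flat}$ are sequences $x=(x^{(n)})_{n\ge 0}$ in $R$ with $(x^{(n+1)})^p=x^{(n)}$; $x^{\sharp}:=x^{(0)}$. For a perfectoid ring $R$ of characteristic $0$ there is a unit $v\in R^{\times}$ such that $vp$ admits a compatible system of $p$-power roots in $R$; one fixes such a system and lets $p^{\flat}:=((vp)^{1/p^n})_n\in R^{\flat}$ be the corresponding element. An ideal of a ring $B$ is $a$-adically closed ($a\in B$) if it is a closed subset of $B$ in the $a$-adic topology. Untilt of an ideal $I\subseteq R^{\flat}$ ($R$ perfectoid): $I^{\sharp}:=\theta_R(W(I))$, where $W(I):=\{\sum_{n\ge 0}[x_n]p^n\in W(R^{\flat})\mid x_n\in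 I\text{ for all }n\}$. *)

(* Defs.v *)
From HB Require Import structures.
From mathcomp Require Import all_boot all_algebra.
From mathcomp Require Import finmap.
From mathcomp Require Import boolp classical_sets functions.
From mathcomp Require Import monalg.

Set Implicit Arguments.
Unset Strict Implicit.
Unset Printing Implicit Defensive.

Import GRing.Theory.

Local Open Scope ring_scope.
Local Open Scope classical_set_scope.

(* The library's quotients by ideals and prime ideals ([ring_quotient]) are
   restricted to proper ideals of nonzero rings.  Since R / pR and R^flat are
   not known a priori to be nonzero, everything below is done over
   [comPzRingType], the commutative rings that may be zero. *)

Section Rings.
Variable A : comPzRingType.
Implicit Types (a b x y : A) (I S : set A).

Definition divides a b := exists c, b = a * c.

Definition is_unit a := exists b, a * b = 1.

Definition prime_ideal I :=
  [/\ I 0, forall x y, I x -> I y -> I (x + y) & forall a x, I x -> I (a * x)]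
  /\ ~ I 1 /\ forall x y, I (x * y) -> I x \/ I y.

Definition adic_lim a (u : nat -> A) x := forall n, divides (a ^+ n) (x - u n).

(* complete and separated, i.e. A -> lim A / (a ^ n) is bijective *)
Definition adic_complete a :=
  (forall u : nat -> A, (forall n, divides (a ^+ n) (u n.+1 - u n)) ->
     exists x, adic_lim a u x)
  /\ forall x, (forall n, divides (a ^+ n) x) -> x = 0.

Definition adic_closed a S :=
  forall x, (forall n, exists2 y, S y & divides (a ^+ n) (x - y)) -> S x.

Definition char_zero := forall n : nat, n%:R = 0 :> A -> n = 0%N.

End Rings.

Section ModP.
Variables (p : nat) (R : comPzRingType).

Definition pR : {pred R} := fun x => `[< divides p%:R x >].

Lemma pR_zmod_closed : zmod_closed pR.
Proof.
split=> [|x y]; first by apply/asboolP; exists 0; rewrite mulr0.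
move=> /asboolP[c ->] /asboolP[d ->]; apply/asboolP.
by exists (c - d); rewrite mulrBr.
Qed.
HB.instance Definition _ := GRing.isZmodClosed.Build R pR pR_zmod_closed.

Definition modp : Type := {ideal_quot pR}.
HB.instance Definition _ := GRing.Zmodule.on modp.

Definition modp_pi (x : R) : modp := \pi_{ideal_quot pR}%qT x.

Definition modp_one : modp := modp_pi 1.
Definition modp_mul (x y : modp) : modp :=
  modp_pi (repr (x : {ideal_quot pR}) * repr (y : {ideal_quot pR})).

Lemma modp_piP x y : modp_pi x = modp_pi y <-> divides p%:R (x - y).
Proof.
by split=> [/eqmodP/asboolP|h]; last by apply/eqmodP/asboolP.
Qed.

Lemma modp_pi_surj (x : modp) : exists y, x = modp_pi y.
Proof. by exists (repr (x : {ideal_quot pR})); rewrite /modp_pi reprK. Qed.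

Lemma modp_piD x y : modp_pi (x + y) = modp_pi x + modp_pi y.
Proof. exact: (raddfD (\pi_{ideal_quot pR}%qT)). Qed.

Lemma modp_piM x y : modp_pi (x * y) = modp_mul (modp_pi x) (modp_pi y).
Proof.
rewrite /modp_mul; set x' := repr _; set y' := repr _.
have /modp_piP[c hc] : modp_pi x = modp_pi x' by rewrite /modp_pi reprK.
have /modp_piP[d hd] : modp_pi y = modp_pi y' by rewrite /modp_pi reprK.
apply/modp_piP; exists (c * y + x' * d).
have -> : x * y - x' * y' = (x - x') * y + x' * (y - y').
  by rewrite mulrBl mulrBr addrA subrK.
by rewrite hc hd mulrDr !mulrA (mulrC x').
Qed.

Lemma modp_mulA : associative modp_mul.
Proof.
move=> x y z.
have [[a ->] [b ->] [c ->]] := And3 (modp_pi_surj x) (modp_pi_surj y) (modp_pi_surj z).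
by rewrite -!modp_piM mulrA.
Qed.

Lemma modp_mulC : commutative modp_mul.
Proof. by move=> x y; rewrite /modp_mul mulrC. Qed.

Lemma modp_mul1 : left_id modp_one modp_mul.
Proof. by move=> x; have [a ->] := modp_pi_surj x; rewrite -modp_piM mul1r. Qed.

Lemma modp_mulDl : left_distributive modp_mul +%R.
Proof.
move=> x y z.
have [[a ->] [b ->] [c ->]] := And3 (modp_pi_surj x) (modp_pi_surj y) (modp_pi_surj z).
by rewrite -modp_piD -!modp_piM mulrDl modp_piD.
Qed.

HB.instance Definition _ := GRing.Zmodule_isComPzRing.Build modp
  modp_mulA modp_mulC modp_mul1 modp_mulDl.

Lemma modp_piX x n : modp_pi (x ^+ n) = modp_pi x ^+ n.
Proof.
elim: n => [|n IHn]; first by rewrite !expr0.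
by rewrite !exprS -IHn; apply: modp_piM.
Qed.

Lemma modp_charp : p%:R = 0 :> modp.
Proof.
have e n : n%:R = modp_pi n%:R.
  elim: n => [|n IHn]; first by rewrite /modp_pi (raddf0 (\pi_{ideal_quot pR}%qT)).
  by rewrite -!natr1 modp_piD -IHn.
have -> : 0 = modp_pi 0 :> modp by rewrite -(e 0).
by rewrite e; apply/modp_piP; exists 1; rewrite subr0 mulr1.
Qed.

Hypothesis p_pr : prime p.

Lemma modp_FrobeniusD (x y : modp) : (x + y) ^+ p = x ^+ p + y ^+ p.
Proof.
have p0 := prime_gt0 p_pr; have defp := prednK p0.
rewrite exprDn big_ord_recr subnn -defp big_ord_recl /= defp.
rewrite subn0 mulr1 mul1r bin0 binn big1 ?addr0 // => i _.
have : (p %| 'C(p, bump 0 i))%N.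
  by rewrite prime_dvd_bin //= /bump leq0n add1n -{2}defp ltnS ltn_ord.
by case/dvdnP=> k ->; rewrite -mulr_natl natrM modp_charp mulr0 mul0r.
Qed.

Lemma modp_FrobeniusB (x y : modp) : (x - y) ^+ p = x ^+ p - y ^+ p.
Proof. by apply/eqP; rewrite eq_sym subr_eq -modp_FrobeniusD subrK. Qed.

End ModP.

Section FrobeniusCompatible.
Variables (p : nat) (R : comPzRingType).

Definition Frobenius_compatible : {pred nat -> modp p R} :=
  fun x => `[< forall n, x n.+1 ^+ p = x n >].

Lemma Frobenius_compatible_subring :
  prime p -> subring_closed Frobenius_compatible.
Proof.
move=> p_pr.
split=> [|x y /asboolP hx /asboolP hy|x y /asboolP hx /asboolP hy];
  apply/asboolP => n.
- exact: expr1n.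
- by rewrite [LHS](modp_FrobeniusB p_pr) hx hy.
- by rewrite [LHS]exprMn hx hy.
Qed.

(* R^flat; its ring structure needs p to be prime *)
Record tilt (p_pr : prime p) := Tilt {
  tilt_seq :> nat -> modp p R;
  tilt_seqP : tilt_seq \in Frobenius_compatible
}.

End FrobeniusCompatible.

Arguments tilt {p} R p_pr.
Arguments Tilt {p R p_pr} tilt_seq tilt_seqP.

Section Tilt.
Variables (p : nat) (p_pr : prime p) (R : comPzRingType).
Local Notation Rflat := (tilt R p_pr).

HB.instance Definition _ := [isSub of Rflat for @tilt_seq p R p_pr].
HB.instance Definition _ := [Choice of Rflat by <:].
HB.instance Definition _ := GRing.SubChoice_isSubComPzRing.Build _ _ Rflat
  (Frobenius_compatible_subring R p_pr).

Definition pcompatible (u : nat -> R) := forall n, u n.+1 ^+ p = u n.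

Lemma tilt_of_subproof (u : nat -> R) : pcompatible u ->
  (fun n => modp_pi p (u n)) \in @Frobenius_compatible p R.
Proof. by move=> hu; apply/asboolP=> n; rewrite -modp_piX hu. Qed.

Definition tilt_of (u : nat -> R) (hu : pcompatible u) : Rflat :=
  Tilt _ (tilt_of_subproof hu).

(* x |-> (x^(n))_n, the inverse of the map [tilt_of], which is bijective for
   R p-adically complete *)
Definition tilt_lift (x : Rflat) : nat -> R :=
  xget (fun=> 0) [set u | pcompatible u /\ forall n, modp_pi p (u n) = x n].

Definition sharp (x : Rflat) : R := tilt_lift x 0%N.

Lemma tilt_root_subproof n (x : Rflat) :
  (fun k => x (n + k)%N) \in @Frobenius_compatible p R.
Proof.
by apply/asboolP=> k; have /asboolP h := tilt_seqP x; rewrite addnS h.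
Qed.

Definition tilt_root n (x : Rflat) : Rflat := Tilt _ (tilt_root_subproof n x).

Lemma tilt_rootK n (x : Rflat) : tilt_root n x ^+ (p ^ n) = x.
Proof.
have valX (y : Rflat) m k : (y ^+ m) k = y k ^+ m.
  by elim: m => [|m IHm]; rewrite ?expr0 // !exprS -IHm.
apply/val_inj/funext => k /=; rewrite valX /=.
elim: n => [|n IHn] //; rewrite expnS exprM addSn.
by have /asboolP -> := tilt_seqP x.
Qed.

End Tilt.

Section WittVectors.
Variable p : nat.

Definition ghost (B : comPzRingType) (x : nat -> B) n : B :=
  \sum_(i < n.+1) (p ^ i)%:R * x i ^+ (p ^ (n - i)).

(* Z[X_0, X_1, ...; Y_0, Y_1, ...], with X_i = inl i and Y_i = inr i *)
Definition XYmonom := {cmonom (nat + nat)%type}.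
Definition ZXY := {malg int[XYmonom]}.
Definition ZX (i : nat) : ZXY := << ucm (inl i) : XYmonom >>.
Definition ZY (i : nat) : ZXY := << ucm (inr i) : XYmonom >>.

(* the unique integral polynomials (Witt's theorem) with this property *)
Definition witt_mul_poly : nat -> ZXY :=
  xget (fun=> 0)
    [set M : nat -> ZXY | forall n, ghost M n = ghost ZX n * ghost ZY n].

(* evaluation at X_i = x i, Y_i = y i; [mmap] would require A to be nonzero *)
Definition XYmonom_eval (A : comPzRingType) (x y : nat -> A) (m : XYmonom) : A :=
  \prod_(i <- finsupp (cmonom_val m))
    (match i with inl k => x k | inr k => y k end) ^+ m i.

Definition XYeval (A : comPzRingType) (x y : nat -> A) (P : ZXY) : A :=
  \sum_(m <- msupp P) XYmonom_eval x y m *~ P@_m.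

(* W(A), in Witt coordinates. Only its product is needed: it expresses that an
   ideal of W(A) is principal. *)
Definition witt (A : comPzRingType) := nat -> A.

Definition witt_mul (A : comPzRingType) (x y : witt A) : witt A :=
  fun n => XYeval x y (witt_mul_poly n).

End WittVectors.

Section Perfectoid.
Variables (p : nat) (R : comPzRingType) (p_pr : prime p).
Local Notation Rflat := (tilt R p_pr).

(* Over the perfect ring R^flat, the Witt vector with coordinates (w_n) is
   sum_n [x_n] p^n with x_n the p^n-th root of w_n. *)
Definition teichmuller_digit (w : witt Rflat) n : Rflat := tilt_root n (w n).

Definition theta (w : witt Rflat) : R :=
  xget 0 (adic_lim p%:R
    (fun n => \sum_(k < n) sharp (teichmuller_digit w k) * p%:R ^+ k)).

Definition perfectoid :=
  exists pi : R, [/\ adic_complete pi,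
    divides (pi ^+ p) p%:R,
    forall x : modp p R, exists y, y ^+ p = x
  & exists xi : witt Rflat, forall w : witt Rflat,
      theta w = 0 <-> exists w', w = witt_mul p xi w'].

Definition witt_ideal (I : set Rflat) : set (witt Rflat) :=
  [set w | forall n, I (teichmuller_digit w n)].

Definition untilt (I : set Rflat) : set R := theta @` witt_ideal I.

End Perfectoid.

Arguments perfectoid {p} R p_pr.

(* Main.v *)
(* Put D = R^flat and t = p^flat.  The map theta : W(D) -> R is a surjective ring
   morphism with kernel generated by xi = p - [t] w, with w a unit of W(D) such
   that theta(w) = v^-1.  Let L be the fraction field of D / q and E the image of
   D in L; then q^sharp is prime if and only if xi is prime in W(E).  This is
   clear if t = 0 in E, where xi = p.  Otherwise E is t-adically complete as D is,
   and t-adically separated as q is closed.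

   Let xi divide F G in W(E).  In W(L) the element xi is invertible; let D' be the
   perfect ring generated by E and by the coordinates of kappa0 = - F / xi.  The
   generic quotient kappa = ([X] - F) / xi over L[X] satisfies
   kappa_i^p = c + t (terms of lower weight), so that E[kappa] is free over E, and
   D'[kappa] free over D', on the monomials in the kappa_i with exponents less
   than p.  As xi (kappa - kappa0) = [X], the element X becomes divisible by all
   powers of t in the perfection of D'[kappa], so that kappa0_i and kappa_i agree
   modulo each t^n; comparing constant coefficients yields D' = E + t^n D'.
   Hence, E being complete, either D' = E, and xi divides F in W(E), or some
   nonzero x in E lies in t^n D' for all n.  In the second case xi divides [x] G,
   as G, by xi | F G, bounds the denominators of D' modulo xi.  The same argument
   for G and [x] shows that xi divides G or [y x] for some nonzero y, and the
   latter is impossible as E is separated. *)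
From HB Require Import structures.
Require Import Defs.
From mathcomp Require Import all_boot all_algebra.
From mathcomp Require Import finmap.
From mathcomp Require Import boolp classical_sets.
From mathcomp Require Import monalg.
From mathcomp Require Import zify ring.

Set Implicit Arguments.
Unset Strict Implicit.
Unset Printing Implicit Defensive.

Import GRing.Theory Num.Theory.

Local Open Scope ring_scope.

(** * Evaluation of integral polynomials *)

(** In general [E] is not a valuation ring and [E / t] is not a domain, so that primality cannot be
    read off modulo [t]; over [L], where division is free, [xi] becomes a unit and congruences
    modulo it are lost. The variable [X] is introduced because comparing coefficients needs
    independent monomials: those in [kappa] stay independent over every subring of [L], so that
    expansions over [E] and over [D'] can be compared, and [X = 0] gives back [- F / xi]. That [G]
    bounds denominators has the following sense. A fraction [b / t ^ n] is bounded if every power of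
    [[b / t ^ n]] sends [G] into [W(E)] modulo [xi]. As [W(E) / (xi)] is closed under [p]-th roots,
    the bounded fractions form a ring closed under roots; if [xi] divides [F G], it contains the
    coordinates of [- F / xi], hence [D']. An [x] in all [t ^ n D'] then has [[x] G] in [([t] ^ n,
    xi)] for all [n], and these ideals intersect in [(xi)]. The case [G = 0] places [D'] inside
    [E[1/t]], so that an element of [D'] and its limit in [E] can be compared. *)

Section MonomialEvaluation.
Variables (I : choiceType) (A : comPzRingType) (v : I -> A).
Local Notation ZI := {malg int[{cmonom I}]}.
Implicit Types (m : {cmonom I}) (P Q : ZI).

Definition cmeval m : A := \prod_(i <- finsupp (cmonom_val m)) v i ^+ m i.

Definition polyeval P : A := \sum_(m <- msupp P) cmeval m *~ P@_m.

Lemma cmevalEw m (d : {fset I}) : (finsupp (cmonom_val m) `<=` d)%fset ->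
  cmeval m = \prod_(i <- d) v i ^+ m i.
Proof.
move=> led; rewrite /cmeval -(big_fset_incl _ led) // => i _.
by rewrite -cmE_eq0 => /eqP->.
Qed.

Lemma cmeval1 : cmeval (@mone _) = 1.
Proof. by rewrite /cmeval mdom1 big_seq_fset0. Qed.

Lemma cmevalM m1 m2 : cmeval (mmul m1 m2) = cmeval m1 * cmeval m2.
Proof.
rewrite {1}/cmeval mdomD (cmevalEw (fsubsetUl _ (finsupp (cmonom_val m2)))).
rewrite (cmevalEw (fsubsetUr (finsupp (cmonom_val m1)) _)) -big_split /=.
by apply: eq_bigr => i _; rewrite cmM exprD.
Qed.

Lemma polyevalEw P (d : {fset {cmonom I}}) : (msupp P `<=` d)%fset ->
  polyeval P = \sum_(m <- d) cmeval m *~ P@_m.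
Proof.
move=> led; rewrite /polyeval -(big_fset_incl _ led) // => m _.
by rewrite -mcoeff_eq0 => /eqP->; rewrite mulr0z.
Qed.

Lemma polyevalD : {morph polyeval : P Q / P + Q}.
Proof.
move=> P Q; rewrite (polyevalEw (msuppD_le P Q)).
rewrite (polyevalEw (fsubsetUl (msupp P) (msupp Q))).
rewrite (polyevalEw (fsubsetUr (msupp P) (msupp Q))) -big_split /=.
by apply: eq_bigr => m _; rewrite mcoeffD mulrzDr.
Qed.

Lemma polyevalN : {morph polyeval : P / - P}.
Proof.
move=> P; rewrite /polyeval msuppN -sumrN.
by apply: eq_bigr => m _; rewrite mcoeffN mulrNz.
Qed.

Lemma polyeval0 : polyeval 0 = 0.
Proof. by rewrite /polyeval msupp0 big_seq_fset0. Qed.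

Lemma polyevalU c m : polyeval << c *g m >> = cmeval m *~ c.
Proof.
rewrite (polyevalEw (@msuppU_le _ _ m c)) big_seq_fset1.
by rewrite mcoeffUU.
Qed.

Lemma polyeval1 : polyeval 1 = 1.
Proof. by rewrite polyevalU cmeval1. Qed.

Lemma polyeval_sum (T : Type) (r : seq T) (F : T -> ZI) :
  polyeval (\sum_(i <- r) F i) = \sum_(i <- r) polyeval (F i).
Proof. exact: (big_morph _ polyevalD polyeval0). Qed.

Lemma polyevalM : {morph polyeval : P Q / P * Q}.
Proof.
move=> P Q; rewrite malgME polyeval_sum big_distrl; apply: eq_bigr => m1 _ /=.
rewrite polyeval_sum big_distrr; apply: eq_bigr => m2 _ /=.
by rewrite polyevalU cmevalM mulrzAl mulrzAr mulrzA mulrzAC.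
Qed.

Lemma polyevalX i : polyeval << ucm i >> = v i.
Proof.
rewrite polyevalU mulr1z /cmeval mdomU big_seq_fset1.
by rewrite cmUU expr1.
Qed.

End MonomialEvaluation.

(** * Relations compatible with the ring operations *)

Section RingRelations.
Variables A B : comPzRingType.

(** One notion covers the graph of a morphism, a subring, a congruence and the Frobenius up to [p]:
    whatever is compatible with the ring operations passes through integral polynomials, and so
    through the Witt vector operations, coordinate by coordinate. *)
Definition ring_rel (r : A -> B -> Prop) :=
  [/\ r 1 1,
      forall x x' y y', r x x' -> r y y' -> r (x + y) (x' + y'),
      forall x x', r x x' -> r (- x) (- x')
    & forall x x' y y', r x x' -> r y y' -> r (x * y) (x' * y')].

Variables (r : A -> B -> Prop) (rr : ring_rel r).

Lemma ring_rel0 : r 0 0.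
Proof.
have [r1 rD rN _] := rr.
by rewrite -(subrr (1 : A)) -(subrr (1 : B)); apply: rD => //; apply: rN.
Qed.

Lemma ring_relX x x' n : r x x' -> r (x ^+ n) (x' ^+ n).
Proof.
have [r1 _ _ rM] := rr.
by move=> rx; elim: n => [|n IHn]; rewrite ?expr0 // !exprS; apply: rM.
Qed.

Lemma ring_relMz x x' (n : int) : r x x' -> r (x *~ n) (x' *~ n).
Proof.
have [r1 rD rN _] := rr; move=> rx.
have rMn k : r (x *+ k) (x' *+ k).
  by elim: k => [|k IHk]; rewrite ?mulr0n ?mulrS; [apply: ring_rel0 | apply: rD].
by case: n => n; [apply: rMn | apply/rN/rMn].
Qed.

Lemma ring_rel_polyeval (I : choiceType) (v : I -> A) (v' : I -> B) P :
  (forall i, r (v i) (v' i)) -> r (polyeval v P) (polyeval v' P).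
Proof.
have [r1 rD rN rM] := rr; move=> rv.
apply: (big_ind2 r) => [|x x' y y'|m _]; [exact: ring_rel0 | exact: rD |].
apply: ring_relMz; apply: (big_ind2 r) => [|x x' y y'|i _] //; first exact: rM.
exact: ring_relX.
Qed.

Lemma ring_rel_XYeval x y x' y' P :
  (forall n, r (x n) (x' n)) -> (forall n, r (y n) (y' n)) ->
  r (XYeval x y P) (XYeval x' y' P).
Proof. by move=> rx ry; apply: ring_rel_polyeval; case. Qed.

End RingRelations.

Lemma ring_rel_morph (A B : comPzRingType) (f : {rmorphism A -> B}) :
  ring_rel (fun u v => v = f u).
Proof.
by split=> [|x _ y _ -> ->|x _ ->|x _ y _ -> ->];
  rewrite ?rmorph1 ?rmorphD ?rmorphN ?rmorphM.
Qed.

Section XYeval.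
Variables (A : comPzRingType) (x y : nat -> A).
Local Notation v := (fun i : nat + nat => match i with inl k => x k | inr k => y k end).

Lemma XYevalD : {morph XYeval x y : P Q / P + Q}. Proof. exact: polyevalD. Qed.
Lemma XYevalN : {morph XYeval x y : P / - P}. Proof. exact: polyevalN. Qed.
Lemma XYevalM : {morph XYeval x y : P Q / P * Q}. Proof. exact: polyevalM. Qed.
Lemma XYeval1 : XYeval x y 1 = 1. Proof. exact: polyeval1. Qed.
Lemma XYevalX n : XYeval x y (ZX n) = x n. Proof. exact: (polyevalX v (inl n)). Qed.
Lemma XYevalY n : XYeval x y (ZY n) = y n. Proof. exact: (polyevalX v (inr n)). Qed.

Lemma XYeval_zmod : zmod_morphism (XYeval x y).
Proof. by move=> P Q; rewrite XYevalD XYevalN. Qed.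
Lemma XYeval_monoid : monoid_morphism (XYeval x y).
Proof. by split; [exact: XYeval1 | exact: XYevalM]. Qed.
HB.instance Definition _ := GRing.isZmodMorphism.Build _ _ (XYeval x y) XYeval_zmod.
HB.instance Definition _ := GRing.isMonoidMorphism.Build _ _ (XYeval x y) XYeval_monoid.
End XYeval.

Section FreeCover.
Variable A : comPzRingType.

(** The integral polynomial ring with one variable for each element of [A]; it exhibits every ring
    as the image of one without additive torsion. *)
Definition free_cover : comPzRingType := {malg int[{cmonom A}]}.
Definition free_cover_eval : free_cover -> A := polyeval id.
Definition free_cover_lift (a : A) : free_cover := << ucm a >>.

Lemma free_cover_liftK : cancel free_cover_lift free_cover_eval.
Proof. by move=> a; exact: (polyevalX id a). Qed.

Lemma free_cover_zmod : zmod_morphism free_cover_eval.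
Proof. by move=> P Q; rewrite /free_cover_eval polyevalD polyevalN. Qed.
Lemma free_cover_monoid : monoid_morphism free_cover_eval.
Proof. by split; [exact: polyeval1 | exact: polyevalM]. Qed.
HB.instance Definition _ := GRing.isZmodMorphism.Build free_cover A free_cover_eval free_cover_zmod.
HB.instance Definition _ := GRing.isMonoidMorphism.Build free_cover A free_cover_eval free_cover_monoid.
End FreeCover.

Lemma malg_torsion_free (K : choiceType) (P : {malg int[K]}) n :
  (0 < n)%N -> P *+ n = 0 -> P = 0.
Proof.
move=> n0 Pn; apply/malgP => k; have := congr1 (fun Q => Q@_k) Pn.
by rewrite mcoeffMn mcoeff0 => /eqP; rewrite mulrn_eq0 eqn0Ngt n0 /= => /eqP.
Qed.

Lemma ring_rel_sum (A B : comPzRingType) (r : A -> B -> Prop) (I : Type)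
    (s : seq I) (P : pred I) (F : I -> A) (G : I -> B) :
  ring_rel r -> (forall i, P i -> r (F i) (G i)) ->
  r (\sum_(i <- s | P i) F i) (\sum_(i <- s | P i) G i).
Proof.
move=> rr rFG; have [_ rD _ _] := rr.
by apply: (big_ind2 r); [exact: ring_rel0 | move=> *; apply: rD | exact: rFG].
Qed.

(** * Congruences and ghost components *)

Section Congruence.
Variables (A : comPzRingType) (S : set A).

(** Encoded as the diagonal of [S], so that the lemmas on [ring_rel] apply to subrings. *)
Definition is_subring := ring_rel (fun x y : A => x = y /\ S x).

(** The quotient must lie in [S] too, which makes this the congruence of the ring [S] rather than of
    [A]; it is applied to [W(E)] inside [W(L)]. *)
Definition congr_mod (m : nat) (x y : A) :=
  [/\ S x, S y & exists2 z, S z & x - y = z *+ m].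

Hypothesis Sr : is_subring.

Lemma is_subring1 : S 1.
Proof. by case: Sr => -[_ ?]. Qed.

Lemma is_subringD x y : S x -> S y -> S (x + y).
Proof. by case: Sr => _ SD _ _ Sx Sy; case: (SD x x y y). Qed.

Lemma is_subringN x : S x -> S (- x).
Proof. by case: Sr => _ _ SN _ Sx; case: (SN x x). Qed.

Lemma is_subringB x y : S x -> S y -> S (x - y).
Proof. by move=> Sx /is_subringN; apply: is_subringD. Qed.

Lemma is_subringM x y : S x -> S y -> S (x * y).
Proof. by case: Sr => _ _ _ SM Sx Sy; case: (SM x x y y). Qed.

Lemma is_subring0 : S 0.
Proof. by rewrite -(subrr 1); apply: is_subringB; apply: is_subring1. Qed.

Lemma is_subringX x n : S x -> S (x ^+ n).
Proof. by move=> Sx; case: (ring_relX Sr n (conj (erefl x) Sx)). Qed.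

Lemma is_subringMn x n : S x -> S (x *+ n).
Proof.
move=> Sx; elim: n => [|n IHn]; first by rewrite mulr0n; apply: is_subring0.
by rewrite mulrS; apply: is_subringD.
Qed.

Lemma is_subring_nat n : S n%:R.
Proof. exact/is_subringMn/is_subring1. Qed.

Lemma is_subring_sum (I : Type) (s : seq I) (P : pred I) (F : I -> A) :
  (forall i, P i -> S (F i)) -> S (\sum_(i <- s | P i) F i).
Proof.
by move=> SF; case: (ring_rel_sum s Sr (fun i Pi => conj (erefl (F i)) (SF i Pi))).
Qed.

Lemma congr_mod_ring_rel m : ring_rel (congr_mod m).
Proof.
split=> [|x x' y y' [Sx Sx' [u Su ex]] [Sy Sy' [v Sv ey]]
         |x x' [Sx Sx' [u Su ex]]
         |x x' y y' [Sx Sx' [u Su ex]] [Sy Sy' [v Sv ey]]].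
- split; [exact: is_subring1.. | exists 0; [exact: is_subring0 |]].
  by rewrite subrr mul0rn.
- split; [exact: is_subringD.. | exists (u + v); [exact: is_subringD |]].
  by rewrite mulrnDl -ex -ey opprD addrACA.
- split; [exact: is_subringN.. | exists (- u); [exact: is_subringN |]].
  by rewrite mulNrn -ex opprB opprK addrC.
split; [exact: is_subringM.. | exists (u * y + x' * v)].
  by apply: is_subringD; apply: is_subringM.
rewrite mulrnDl -mulrnAl -mulrnAr -ex -ey mulrBl mulrBr.
by rewrite addrA subrK.
Qed.

Lemma congr_mod_refl m x : S x -> congr_mod m x x.
Proof.
by move=> Sx; split=> //; exists 0; rewrite ?subrr ?mul0rn //; apply: is_subring0.
Qed.

Lemma congr_modMn m k x y : congr_mod m x y -> congr_mod (k * m) (x *+ k) (y *+ k).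
Proof.
case=> Sx Sy [z Sz e]; split; [exact: is_subringMn.. | exists z => //].
by rewrite -mulrnBl e mulrnA mulrnAC.
Qed.

Lemma congr_modW m k x y : congr_mod (k * m) x y -> congr_mod m x y.
Proof.
case=> Sx Sy [z Sz e]; split=> //; exists (z *+ k); first exact: is_subringMn.
by rewrite e mulrnA.
Qed.

Lemma congr_mod_sym m x y : congr_mod m x y -> congr_mod m y x.
Proof.
case=> Sx Sy [z Sz e]; split=> //; exists (- z); first exact: is_subringN.
by rewrite mulNrn -e opprB.
Qed.

Lemma congr_mod_trans m x y z :
  congr_mod m x y -> congr_mod m y z -> congr_mod m x z.
Proof.
case=> Sx Sy [u Su eu] [_ Sz [v Sv ev]]; split=> //; exists (u + v).
  exact: is_subringD.
by rewrite mulrnDl -eu -ev addrA subrK.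
Qed.

(** In the factorization of [x ^ p - y ^ p] by [x - y], the cofactor is congruent to
    [p * y ^ (p - 1)] modulo [p], and so contributes one more factor [p]. *)
Lemma congr_mod_exp1 p k x y :
  congr_mod (p ^ k.+1) x y -> congr_mod (p ^ k.+2) (x ^+ p) (y ^+ p).
Proof.
move=> h; have [Sx Sy [z Sz e]] := h.
have h1 : congr_mod p x y by apply: (congr_modW (k := p ^ k)); rewrite -expnSr.
split; [exact: is_subringX.. |].
have [_ _ [u Su eu]] : congr_mod p (\sum_(i < p) x ^+ (p.-1 - i) * y ^+ i)
    (\sum_(i < p) y ^+ (p.-1 - i) * y ^+ i).
  have rr := congr_mod_ring_rel p; have [_ _ _ rM] := rr.
  apply: (ring_rel_sum _ rr) => i _.
  apply: rM; last exact/congr_mod_refl/is_subringX.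
  exact: (ring_relX rr).
exists (z * (u + y ^+ p.-1)).
  by apply: is_subringM => //; apply: is_subringD => //; apply: is_subringX.
have eS : \sum_(i < p) y ^+ (p.-1 - i) * y ^+ i = y ^+ p.-1 *+ p.
  rewrite (eq_bigr (fun=> y ^+ p.-1)) ?sumr_const ?card_ord // => i _.
  by rewrite -exprD subnK //; case: (p) i => [[]|q i] //=; rewrite -ltnS.
rewrite subrXX e -[X in _ * X](subrK (y ^+ p.-1 *+ p)) -{1}eS eu -mulrnDl.
by rewrite mulrnAr mulrnAl -mulrnA -expnSr.
Qed.

Lemma congr_mod_exp p n x y :
  congr_mod p x y -> congr_mod (p ^ n.+1) (x ^+ (p ^ n)) (y ^+ (p ^ n)).
Proof.
move=> h; elim: n => [|n IHn]; first by rewrite expn1 expn0 !expr1.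
by rewrite [in x ^+ _]expnSr [in y ^+ _]expnSr !exprM; apply: congr_mod_exp1.
Qed.

End Congruence.

Lemma is_subring_setT (A : comPzRingType) : is_subring [set: A].
Proof. by split=> //= [x x' y y' [-> _] [-> _]|x x' [-> _]|x x' y y' [-> _] [-> _]]. Qed.

Section Ghost.
Variable p : nat.

Definition p_torsion_free (B : comPzRingType) := forall x : B, x *+ p = 0 -> x = 0.

Lemma p_torsion_freeX (B : comPzRingType) n (x : B) :
  p_torsion_free B -> x *+ p ^ n = 0 -> x = 0.
Proof.
move=> tf; elim: n => [|n IHn]; first by rewrite expn0.
by rewrite expnS mulrnA mulrnAC => /tf /IHn.
Qed.

Lemma ghost_rmorph (A B : comPzRingType) (f : {rmorphism A -> B}) (x : nat -> A) n :
  f (ghost p x n) = ghost p (fun i => f (x i)) n.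
Proof.
by rewrite rmorph_sum; apply: eq_bigr => i _; rewrite rmorphM rmorphXn rmorph_nat.
Qed.

Section GhostRing.
Variable B : comPzRingType.
Implicit Types x y : nat -> B.

Lemma ghostE x n : ghost p x n = \sum_(i < n.+1) x i ^+ (p ^ (n - i)) *+ p ^ i.
Proof. by apply: eq_bigr => i _; rewrite mulr_natl. Qed.

Lemma ghost0 x : ghost p x 0 = x 0%N.
Proof. by rewrite ghostE big_ord1 subnn expn0 expr1. Qed.

Lemma ghost_recr x n :
  ghost p x n.+1 = ghost p (fun i => x i ^+ p) n + x n.+1 *+ p ^ n.+1.
Proof.
rewrite !ghostE big_ord_recr /= subnn expn0 expr1; congr (_ + _).
by apply: eq_bigr => i _; rewrite -exprM -expnS subSn // -ltnS.
Qed.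

Lemma ghost_recl x n :
  ghost p x n.+1 = x 0%N ^+ (p ^ n.+1) + ghost p (fun i => x i.+1) n *+ p.
Proof.
rewrite !ghostE big_ord_recl /= subn0 expn0 mulr1n; congr (_ + _).
rewrite -sumrMnl; apply: eq_bigr => i _ /=.
by rewrite /bump leq0n add1n subSS expnSr mulrnA.
Qed.

Lemma eq_ghost x y n : (forall i, (i <= n)%N -> x i = y i) -> ghost p x n = ghost p y n.
Proof. by move=> exy; apply: eq_bigr => i _; rewrite exy // -ltnS. Qed.

(** The term of index [i] has [i] factors [p] in its coefficient and gains [n - i + 1] from the
    power [p ^ (n - i)]. *)
Lemma ghost_congr (S : set B) x y n : is_subring S ->
  (forall i, (i <= n)%N -> congr_mod S p (x i) (y i)) ->
  congr_mod S (p ^ n.+1) (ghost p x n) (ghost p y n).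
Proof.
move=> Sr h; rewrite !ghostE; apply: (ring_rel_sum _ (congr_mod_ring_rel Sr _)).
move=> i _; have lein : (i <= n)%N by rewrite -ltnS.
rewrite -[in (p ^ n.+1)%N](subnKC lein) -addnS expnD.
by apply: congr_modMn => //; apply: congr_mod_exp => //; apply: h.
Qed.

Hypothesis tf : p_torsion_free B.

(** By induction the terms before the last agree modulo [p ^ n.+2]; so [p ^ n.+1] times the
    difference of the last coordinates is divisible by [p ^ n.+2], and torsion-freeness leaves a
    factor [p]. *)
Lemma ghost_inj_congr x y :
  (forall n, congr_mod setT (p ^ n.+1) (ghost p x n) (ghost p y n)) ->
  forall n, congr_mod setT p (x n) (y n).
Proof.
have Sr := is_subring_setT B.
move=> h n; elim/ltn_ind: n => -[|n] IHn; first by have := h 0%N; rewrite !ghost0 expn1.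
have := h n.+1; rewrite !ghost_recr.
have [_ _ [u _ eu]] : congr_mod setT (p ^ n.+2) (ghost p (fun i => x i ^+ p) n)
   (ghost p (fun i => y i ^+ p) n).
  rewrite !ghostE; apply: (ring_rel_sum _ (congr_mod_ring_rel Sr _)) => i _.
  have lein : (i <= n)%N by rewrite -ltnS.
  rewrite -[in (p ^ n.+2)%N](subnKC lein) -!addnS expnD.
  apply: congr_modMn => //; rewrite -!exprM -!expnS.
  by apply: congr_mod_exp => //; apply: IHn.
case=> _ _ [w _ ew]; split=> //; exists (w - u) => //.
have e : (x n.+1 - y n.+1) *+ p ^ n.+1 = (w - u) *+ p ^ n.+2.
  by rewrite [RHS]mulrnBl -ew -eu opprD addrACA [RHS]addrC addKr mulrnBl.
apply/eqP; rewrite -subr_eq0; apply/eqP/(p_torsion_freeX (n := n.+1) tf).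
by rewrite mulrnBl e -mulrnA -expnS subrr.
Qed.

Lemma ghost_inj x y : (forall n, ghost p x n = ghost p y n) -> forall n, x n = y n.
Proof.
move=> h n; elim/ltn_ind: n => -[|n] IHn; first by have := h 0%N; rewrite !ghost0.
have := h n.+1; rewrite !ghost_recr.
rewrite (@eq_ghost _ (fun i => y i ^+ p)) => [|i lein]; last by rewrite IHn.
move/addrI/eqP; rewrite -subr_eq0 -mulrnBl => /eqP/(p_torsion_freeX tf)/eqP.
by rewrite subr_eq0 => /eqP.
Qed.

(* Dwork's lemma *)
Lemma ghost_surj (phi : {rmorphism B -> B}) (g : nat -> B) :
  (forall b, congr_mod setT p (phi b) (b ^+ p)) ->
  (forall n, congr_mod setT (p ^ n.+1) (phi (g n)) (g n.+1)) ->
  exists x, forall n, ghost p x n = g n.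
Proof.
move=> hphi hg; have Sr := is_subring_setT B.
pose good n (x : nat -> B) := forall i, (i <= n)%N -> ghost p x i = g i.
(* The next coordinate is provided for every sequence, with the default [0] if an earlier ghost
   component is wrong, so that choice makes it a function of [n] and [x]. *)
have step n x : exists b, good n x -> ghost p (fun i => if (i <= n)%N then x i else b) n.+1 = g n.+1.
  have [gx|] := pselect (good n x); last by exists 0.
  have [_ _ [u _ eu]] : congr_mod setT (p ^ n.+1) (g n.+1) (ghost p (fun i => x i ^+ p) n).
    apply: (congr_mod_trans Sr (congr_mod_sym Sr (hg n))).
    by rewrite -gx // ghost_rmorph; apply: ghost_congr.
  exists u => _; rewrite ghost_recr ltnn -eu.
  rewrite (@eq_ghost _ (fun i => x i ^+ p)) ?subrKC //.
  by move=> i ->.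
have [f hf] := choice (fun nx : nat * (nat -> B) => step nx.1 nx.2).
(* [F n] solves the equations up to index [n]; as later stages leave earlier coordinates unchanged,
   the diagonal solves them all. *)
pose F := fix F n := if n is m.+1 then
   (fun i => if (i <= m)%N then F m i else f (m, F m)) else (fun=> g 0%N).
have FG n : good n (F n).
  elim: n => [|n IHn] i; first by rewrite leqn0 => /eqP->; rewrite ghost0.
  rewrite leq_eqVlt => /orP[/eqP->|]; first exact: (hf (n, F n)).
  rewrite ltnS => lein; rewrite -IHn //; apply: eq_ghost => j leji /=.
  by rewrite (leq_trans leji lein).
have Fst m n i : (i <= n <= m)%N -> F m i = F n i.
  elim: m => [|m IHm]; first by rewrite andbC leqn0 => /andP[/eqP->].
  rewrite andbC leq_eqVlt => /andP[/orP[/eqP->//|]]; rewrite ltnS => lenm lein.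
  by rewrite /= (leq_trans lein lenm) IHm // lein.
exists (fun n => F n n) => n; rewrite -(FG n n) //; apply: eq_ghost => i lein.
by rewrite -(Fst n i i) // leqnn.
Qed.
End GhostRing.

End Ghost.

(** Reduces the Frobenius congruence for all integral polynomials to the case of the variables. *)
Lemma polyevalX_id (I : choiceType) (P : {malg int[{cmonom I}]}) :
  polyeval (fun i => << ucm i >> : {malg int[{cmonom I}]}) P = P.
Proof.
have UM (m1 m2 : {cmonom I}) :
    << mmul m1 m2 >> = << m1 >> * << m2 >> :> {malg int[{cmonom I}]}.
  by rewrite [RHS]malgM_def fgmulUU mulr1.
pose pw i n : {cmonom I} := iter n (mmul (ucm i)) (@mone _).
have pwS i n : pw i n.+1 = mmul (ucm i) (pw i n) by [].
have UX i n : << ucm i >> ^+ n = << pw i n >> :> {malg int[{cmonom I}]}.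
  elim: n => [|n IHn]; first by rewrite expr0.
  by rewrite pwS UM exprS IHn.
have pwE i n j : pw i n j = (n * (i == j))%N.
  by elim: n => [|n IHn]; rewrite ?cm1 // cmM IHn cmU mulSn.
rewrite [RHS]monalgE; apply: eq_bigr => m _.
suff -> : cmeval (fun i => << ucm i >>) m = << m >> :> {malg int[{cmonom I}]}.
  by move: (P@_m) => c; rewrite -{2}[c]intz raddfMz.
have E s : \prod_(i <- s) << ucm i >> ^+ m i =
    << \big[mmul/@mone _]_(i <- s) pw i (m i) >> :> {malg int[{cmonom I}]}.
  elim: s => [|i s IHs]; first by rewrite !big_nil.
  by rewrite !big_cons UM IHs UX.
rewrite /cmeval E; congr << _ >>; apply/eqP/cmP => j.
have -> (s : seq I) : (\big[mmul/@mone _]_(i <- s) pw i (m i)) j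
    = (\sum_(i <- s) m i * (i == j))%N.
  by elim: s => [|i s IHs]; rewrite ?big_nil ?cm1 // !big_cons cmM IHs pwE.
case: (mdomP m j) => [jm|jm].
  rewrite (big_fsetD1 j jm) /= eqxx muln1 big_seq big1 ?addn0 // => i.
  by rewrite in_fsetD1 => /andP[/negPf-> _]; rewrite muln0.
rewrite big_seq big1 // => i im; case: eqP => [eij|_]; last by rewrite muln0.
by move: im; rewrite eij (negPf jm).
Qed.

(** * The ring of Witt vectors *)

Section WittPolynomials.
Variables (p : nat) (p_pr : prime p).

Lemma congr_FrobeniusD (A : comPzRingType) (x y : A) :
  congr_mod setT p ((x + y) ^+ p) (x ^+ p + y ^+ p).
Proof.
have p0 := prime_gt0 p_pr; have defp := prednK p0; split=> //.
exists (\sum_(i < p.-1) x ^+ (p - bump 0 i) * y ^+ bump 0 i *+ ('C(p, bump 0 i) %/ p)) => //.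
rewrite exprDn big_ord_recr subnn -defp big_ord_recl /= defp.
rewrite subn0 mulr1 mul1r bin0 binn !mulr1n (addrC (x ^+ p)) -(addrA _ (x ^+ p)) addrK -sumrMnl.
apply: eq_bigr => i _; rewrite -mulrnA divnK // prime_dvd_bin //=.
by rewrite /bump leq0n add1n -{2}defp ltnS ltn_ord.
Qed.

Lemma congr_FrobeniusN (A : comPzRingType) (x : A) :
  congr_mod setT p (- x ^+ p) ((- x) ^+ p).
Proof.
have Sr := is_subring_setT A; have [_ cD _ _] := congr_mod_ring_rel Sr p.
have := congr_FrobeniusD x (- x).
rewrite subrr expr0n eqn0Ngt prime_gt0 //= => h.
have := cD _ _ _ _ (congr_mod_refl Sr p (x := - x ^+ p) I) h.
by rewrite addr0 addKr.
Qed.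

Lemma ring_rel_Frobenius (A : comPzRingType) :
  ring_rel (fun u v : A => congr_mod setT p v (u ^+ p)).
Proof.
have Sr := is_subring_setT A; have [_ cD cN cM] := congr_mod_ring_rel Sr p.
split=> [|x x' y y' rx ry|x x' rx|x x' y y' rx ry].
- by rewrite expr1n; apply: congr_mod_refl.
- apply: (congr_mod_trans Sr (cD _ _ _ _ rx ry)).
  exact: (congr_mod_sym Sr (congr_FrobeniusD x y)).
- by apply: (congr_mod_trans Sr (cN _ _ rx)); apply: congr_FrobeniusN.
- by rewrite exprMn; apply: cM.
Qed.

(** The lift of Frobenius that Dwork's lemma asks for. *)
Definition ZXY_Frobenius : {rmorphism ZXY -> ZXY} :=
  XYeval (fun i => ZX i ^+ p) (fun i => ZY i ^+ p).

Lemma ZXY_FrobeniusE P : congr_mod setT p (ZXY_Frobenius P) (P ^+ p).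
Proof.
rewrite -{2}[P]polyevalX_id; apply: (ring_rel_polyeval (@ring_rel_Frobenius _)).
by case=> i; apply: (congr_mod_refl (is_subring_setT _)).
Qed.

Lemma free_cover_torsion_free A : p_torsion_free p (free_cover A).
Proof. by move=> P; apply: malg_torsion_free; rewrite prime_gt0. Qed.

End WittPolynomials.

Section WittOperations.
Variables (p : nat) (p_pr : prime p).

(** Of the same form as [witt_mul_poly], which is by conversion the case where [g] is the product of
    the two ghost components. *)
Definition witt_poly (g : nat -> ZXY) : nat -> ZXY :=
  xget (fun=> 0) [set M : nat -> ZXY | forall n, ghost p M n = g n].

(** Dwork's condition. Being a congruence between a morphism and a shift, it is stable under the
    ring operations, which gives all Witt polynomials at once. *)
Definition is_ghost (g : nat -> ZXY) :=
  forall n, congr_mod setT (p ^ n.+1) (ZXY_Frobenius p (g n)) (g n.+1).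

Lemma witt_polyE g : is_ghost g -> forall n, ghost p (witt_poly g) n = g n.
Proof.
move=> hg; rewrite /witt_poly; case: xgetP => [M _ hM|noM]; first exact: hM.
have [M hM] := ghost_surj (ZXY_FrobeniusE p_pr) hg.
by case: (noM M hM).
Qed.

Lemma is_ghost_var (v : nat -> ZXY) : (forall i, ZXY_Frobenius p (v i) = v i ^+ p) ->
  is_ghost (ghost p v).
Proof.
move=> hv n; apply: (congr_mod_sym (is_subring_setT _)).
split=> //; exists (v n.+1) => //; rewrite ghost_recr ghost_rmorph.
rewrite (@eq_ghost _ _ (fun i => v i ^+ p) (fun i => ZXY_Frobenius p (v i))).
  by rewrite addrC addKr.
by move=> i _; rewrite hv.
Qed.

Lemma is_ghost_ZX : is_ghost (ghost p ZX).
Proof. exact: (is_ghost_var (fun i => XYevalX _ _ i)). Qed.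

Lemma is_ghost_ZY : is_ghost (ghost p ZY).
Proof. exact: (is_ghost_var (fun i => XYevalY _ _ i)). Qed.

Lemma is_ghostD g h : is_ghost g -> is_ghost h -> is_ghost (fun n => g n + h n).
Proof.
move=> hg hh n; rewrite rmorphD.
by have [_ cD _ _] := congr_mod_ring_rel (is_subring_setT ZXY) (p ^ n.+1); apply: cD.
Qed.

Lemma is_ghostM g h : is_ghost g -> is_ghost h -> is_ghost (fun n => g n * h n).
Proof.
move=> hg hh n; rewrite rmorphM.
by have [_ _ _ cM] := congr_mod_ring_rel (is_subring_setT ZXY) (p ^ n.+1); apply: cM.
Qed.

Lemma is_ghostN g : is_ghost g -> is_ghost (fun n => - g n).
Proof.
move=> hg n; rewrite rmorphN.
by have [_ _ cN _] := congr_mod_ring_rel (is_subring_setT ZXY) (p ^ n.+1); apply: cN.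
Qed.

Definition witt_add_poly := witt_poly (fun n => ghost p ZX n + ghost p ZY n).
Definition witt_opp_poly := witt_poly (fun n => - ghost p ZX n).

Variable A : comPzRingType.
Implicit Types x y : nat -> A.

Definition witt_add x y : nat -> A := fun n => XYeval x y (witt_add_poly n).
Definition witt_opp x : nat -> A := fun n => XYeval x x (witt_opp_poly n).
Definition witt_one : nat -> A := fun n => (n == 0%N)%:R.

Lemma ghost_XYeval x y (v : nat -> ZXY) n :
  XYeval x y (ghost p v n) = ghost p (fun i => XYeval x y (v i)) n.
Proof. exact: ghost_rmorph. Qed.

Lemma ghost_ZX x y n : XYeval x y (ghost p ZX n) = ghost p x n.
Proof. by rewrite ghost_XYeval; apply: eq_ghost => i _; rewrite XYevalX. Qed.

Lemma ghost_ZY x y n : XYeval x y (ghost p ZY n) = ghost p y n.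
Proof. by rewrite ghost_XYeval; apply: eq_ghost => i _; rewrite XYevalY. Qed.

Lemma ghost_witt_add x y n : ghost p (witt_add x y) n = ghost p x n + ghost p y n.
Proof.
rewrite -ghost_XYeval (witt_polyE (is_ghostD is_ghost_ZX is_ghost_ZY)).
by rewrite XYevalD; congr (_ + _); [exact: ghost_ZX | exact: ghost_ZY].
Qed.

Lemma ghost_witt_mul x y n : ghost p (witt_mul p x y) n = ghost p x n * ghost p y n.
Proof.
rewrite -ghost_XYeval [X in XYeval x y X](witt_polyE (is_ghostM is_ghost_ZX is_ghost_ZY)).
by rewrite XYevalM; congr (_ * _); [exact: ghost_ZX | exact: ghost_ZY].
Qed.

Lemma ghost_witt_opp x n : ghost p (witt_opp x) n = - ghost p x n.
Proof.
rewrite -ghost_XYeval (witt_polyE (is_ghostN is_ghost_ZX)).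
by rewrite XYevalN ghost_ZX.
Qed.

Lemma ghost_witt_zero n : ghost p (fun=> 0 : A) n = 0.
Proof.
by rewrite ghostE big1 // => i _; rewrite expr0n expn_eq0 eqn0Ngt prime_gt0 //= mul0rn.
Qed.

Lemma ghost_witt_one n : ghost p witt_one n = 1.
Proof.
case: n => [|n]; first by rewrite ghost0.
by rewrite ghost_recl /witt_one /= expr1n ghost_witt_zero mul0rn addr0.
Qed.
End WittOperations.

(** A separate name keeps the Witt ring structure apart from the pointwise one on functions; [p_pr]
    is a parameter since the ring laws depend on it. *)
Definition wittring (p : nat) (p_pr : prime p) (A : comPzRingType) : Type := nat -> A.

Section WittRing.
Variables (p : nat) (p_pr : prime p).
Local Notation W := (wittring p_pr).

HB.instance Definition _ A := gen_eqMixin (W A).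
HB.instance Definition _ A := gen_choiceMixin (W A).

Section TorsionFree.
Variables (B : comPzRingType) (tf : p_torsion_free p B).
Implicit Types x y z : nat -> B.

Lemma ghost_ext x y : (forall n, ghost p x n = ghost p y n) -> x = y.
Proof. by move/(ghost_inj tf)/funext. Qed.

Let gD := ghost_witt_add p_pr.
Let gM := ghost_witt_mul p_pr.

Lemma tf_witt_addA x y z :
  witt_add p x (witt_add p y z) = witt_add p (witt_add p x y) z.
Proof. by apply: ghost_ext => n; rewrite !gD addrA. Qed.

Lemma tf_witt_addC x y : witt_add p x y = witt_add p y x.
Proof. by apply: ghost_ext => n; rewrite !gD addrC. Qed.

Lemma tf_witt_add0 x : witt_add p (fun=> 0) x = x.
Proof. by apply: ghost_ext => n; rewrite gD (ghost_witt_zero p_pr) add0r. Qed.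

Lemma tf_witt_addN x : witt_add p (witt_opp p x) x = fun=> 0.
Proof.
by apply: ghost_ext => n; rewrite gD (ghost_witt_opp p_pr) (ghost_witt_zero p_pr) addNr.
Qed.

Lemma tf_witt_mulA x y z :
  witt_mul p x (witt_mul p y z) = witt_mul p (witt_mul p x y) z.
Proof. by apply: ghost_ext => n; rewrite !gM mulrA. Qed.

Lemma tf_witt_mulC x y : witt_mul p x y = witt_mul p y x.
Proof. by apply: ghost_ext => n; rewrite !gM mulrC. Qed.

Lemma tf_witt_mul1 x : witt_mul p (@witt_one B) x = x.
Proof. by apply: ghost_ext => n; rewrite gM (ghost_witt_one p_pr) mul1r. Qed.

Lemma tf_witt_mulDl x y z :
  witt_mul p (witt_add p x y) z = witt_add p (witt_mul p x z) (witt_mul p y z).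
Proof. by apply: ghost_ext => n; rewrite gM !gD !gM mulrDl. Qed.

End TorsionFree.

(* Identities between Witt vectors hold over every ring, as they hold over the
   torsion-free ring [free_cover A], where ghost components determine a vector *)
Lemma witt_add_map (A : comPzRingType) (x y : nat -> free_cover A) :
  (fun n => free_cover_eval (witt_add p x y n)) =
  witt_add p (fun n => free_cover_eval (x n)) (fun n => free_cover_eval (y n)).
Proof.
apply/funext => n; apply/esym.
exact: (@ring_rel_XYeval _ _ _ (ring_rel_morph (@free_cover_eval A)) x y).
Qed.

Lemma witt_mul_map (A : comPzRingType) (x y : nat -> free_cover A) :
  (fun n => free_cover_eval (witt_mul p x y n)) =
  witt_mul p (fun n => free_cover_eval (x n)) (fun n => free_cover_eval (y n)).
Proof.
apply/funext => n; apply/esym.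
exact: (@ring_rel_XYeval _ _ _ (ring_rel_morph (@free_cover_eval A)) x y).
Qed.

Lemma witt_opp_map (A : comPzRingType) (x : nat -> free_cover A) :
  (fun n => free_cover_eval (witt_opp p x n)) =
  witt_opp p (fun n => free_cover_eval (x n)).
Proof.
apply/funext => n; apply/esym.
exact: (@ring_rel_XYeval _ _ _ (ring_rel_morph (@free_cover_eval A)) x x).
Qed.

Lemma witt_one_map (A : comPzRingType) :
  (fun n => free_cover_eval (@witt_one (free_cover A) n)) = @witt_one A.
Proof. by apply/funext => n; rewrite /witt_one rmorph_nat. Qed.

Lemma witt_zero_map (A : comPzRingType) :
  (fun n : nat => free_cover_eval (0 : free_cover A)) = fun=> 0.
Proof. by apply/funext => n; rewrite rmorph0. Qed.

Lemma free_cover_fun (A : comPzRingType) (x : nat -> A) :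
  exists x' : nat -> free_cover A, x = fun n => free_cover_eval (x' n).
Proof.
exists (fun n => free_cover_lift (x n)).
by apply/funext => n; rewrite free_cover_liftK.
Qed.

Section RingLaws.
Variable A : comPzRingType.

Lemma witt_addA : associative (@witt_add p A).
Proof.
move=> x y z; have [[x' ->] [y' ->] [z' ->]] := And3 (free_cover_fun x) (free_cover_fun y) (free_cover_fun z).
rewrite -(witt_add_map y' z') -(witt_add_map x' y') -(witt_add_map x' (witt_add p y' z')) -(witt_add_map (witt_add p x' y') z').
by rewrite (tf_witt_addA (free_cover_torsion_free p_pr (A := A)) x' y' z').
Qed.

Lemma witt_addC : commutative (@witt_add p A).
Proof.
move=> x y; have [[x' ->] [y' ->]] := conj (free_cover_fun x) (free_cover_fun y).
rewrite -(witt_add_map x' y') -(witt_add_map y' x').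
by rewrite (tf_witt_addC (free_cover_torsion_free p_pr (A := A)) x' y').
Qed.

Lemma witt_add0 : left_id (fun=> 0) (@witt_add p A).
Proof.
move=> x; have [x' ->] := free_cover_fun x.
rewrite -(witt_zero_map A) -(witt_add_map (fun=> 0) x').
by rewrite (tf_witt_add0 (free_cover_torsion_free p_pr (A := A)) x').
Qed.

Lemma witt_addN : left_inverse (fun=> 0) (@witt_opp p A) (@witt_add p A).
Proof.
move=> x; have [x' ->] := free_cover_fun x.
rewrite -(witt_opp_map x') -(witt_add_map (witt_opp p x') x') -(witt_zero_map A).
by rewrite (tf_witt_addN (free_cover_torsion_free p_pr (A := A)) x').
Qed.

Lemma witt_mulA : associative (@witt_mul p A).
Proof.
move=> x y z; have [[x' ->] [y' ->] [z' ->]] := And3 (free_cover_fun x) (free_cover_fun y) (free_cover_fun z).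
rewrite -(witt_mul_map y' z') -(witt_mul_map x' y') -(witt_mul_map x' (witt_mul p y' z')) -(witt_mul_map (witt_mul p x' y') z').
by rewrite (tf_witt_mulA (free_cover_torsion_free p_pr (A := A)) x' y' z').
Qed.

Lemma witt_mulC : commutative (@witt_mul p A).
Proof.
move=> x y; have [[x' ->] [y' ->]] := conj (free_cover_fun x) (free_cover_fun y).
rewrite -(witt_mul_map x' y') -(witt_mul_map y' x').
by rewrite (tf_witt_mulC (free_cover_torsion_free p_pr (A := A)) x' y').
Qed.

Lemma witt_mul1 : left_id (@witt_one A) (@witt_mul p A).
Proof.
move=> x; have [x' ->] := free_cover_fun x.
rewrite -(witt_one_map A) -(witt_mul_map (@witt_one _) x').
by rewrite (tf_witt_mul1 (free_cover_torsion_free p_pr (A := A)) x').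
Qed.

Lemma witt_mulDl : left_distributive (@witt_mul p A) (@witt_add p A).
Proof.
move=> x y z; have [[x' ->] [y' ->] [z' ->]] := And3 (free_cover_fun x) (free_cover_fun y) (free_cover_fun z).
rewrite -(witt_add_map x' y') -(witt_mul_map x' z') -(witt_mul_map y' z') -(witt_mul_map (witt_add p x' y') z') -(witt_add_map (witt_mul p x' z') (witt_mul p y' z')).
by rewrite (tf_witt_mulDl (free_cover_torsion_free p_pr (A := A)) x' y' z').
Qed.

(* The operations are locked, as comparing Witt polynomials by conversion is
   hopeless *)
Fact witt_key : unit. Proof. by []. Qed.
Definition wadd : W A -> W A -> W A := locked_with witt_key (@witt_add p A).
Definition wopp : W A -> W A := locked_with witt_key (@witt_opp p A).
Definition wmul : W A -> W A -> W A := locked_with witt_key (@witt_mul p A).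

Lemma waddE : wadd = @witt_add p A. Proof. exact: locked_withE. Qed.
Lemma woppE : wopp = @witt_opp p A. Proof. exact: locked_withE. Qed.
Lemma wmulE : wmul = @witt_mul p A. Proof. exact: locked_withE. Qed.

Fact waddA : associative wadd. Proof. by rewrite waddE; apply: witt_addA. Qed.
Fact waddC : commutative wadd. Proof. by rewrite waddE; apply: witt_addC. Qed.
Fact wadd0 : left_id (fun=> 0 : A) wadd. Proof. by rewrite waddE; apply: witt_add0. Qed.
Fact waddN : left_inverse (fun=> 0 : A) wopp wadd.
Proof. by rewrite waddE woppE; apply: witt_addN. Qed.
Fact wmulA : associative wmul. Proof. by rewrite wmulE; apply: witt_mulA. Qed.
Fact wmulC : commutative wmul. Proof. by rewrite wmulE; apply: witt_mulC. Qed.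
Fact wmul1 : left_id (@witt_one A) wmul. Proof. by rewrite wmulE; apply: witt_mul1. Qed.
Fact wmulDl : left_distributive wmul wadd.
Proof. by rewrite waddE wmulE; apply: witt_mulDl. Qed.

HB.instance Definition _ := GRing.isZmodule.Build (W A) waddA waddC wadd0 waddN.
HB.instance Definition _ := GRing.Zmodule_isComPzRing.Build (W A) wmulA wmulC wmul1 wmulDl.

Lemma wittring_addE (x y : W A) : x + y = witt_add p x y.
Proof. exact: (congr1 (fun f => f x y) waddE). Qed.
Lemma wittring_oppE (x : W A) : - x = witt_opp p x.
Proof. exact: (congr1 (fun f => f x) woppE). Qed.
Lemma wittring_mulE (x y : W A) : x * y = witt_mul p x y.
Proof. exact: (congr1 (fun f => f x y) wmulE). Qed.
End RingLaws.

End WittRing.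

(** * Functoriality, Teichmueller representatives, Verschiebung and Frobenius *)

Section WittRelations.
Variables (p : nat) (p_pr : prime p).
Local Notation W := (wittring p_pr).

Lemma witt_ring_rel (A B : comPzRingType) (r : A -> B -> Prop) : ring_rel r ->
  ring_rel (fun (x : W A) (y : W B) => forall n, r (x n) (y n)).
Proof.
move=> rr; have [r1 _ _ _] := rr; split=> [[|n]|x x' y y' rx ry n|x x' rx n|x x' y y' rx ry n].
- exact: r1.
- exact: ring_rel0.
- by rewrite !wittring_addE; apply: (ring_rel_XYeval rr).
- by rewrite !wittring_oppE; apply: (ring_rel_XYeval rr).
- by rewrite !wittring_mulE; apply: (ring_rel_XYeval rr).
Qed.

Definition witt_over (A : comPzRingType) (S : set A) : set (W A) :=
  [set x | forall n, S (x n)].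

Lemma witt_over_subring (A : comPzRingType) (S : set A) :
  is_subring S -> is_subring (witt_over S).
Proof.
move=> Sr; have [w1 wD wN wM] := witt_ring_rel Sr.
have E (x y : W A) : (forall n, x n = y n /\ S (x n)) <-> x = y /\ witt_over S x.
  split=> [h|[-> Sy] n]; last by [].
  by split=> [|n]; [apply/funext => n |]; case: (h n).
split=> [|x x' y y' /E hx /E hy|x x' /E hx|x x' y y' /E hx /E hy].
- by apply/E.
- by apply/E; apply: wD.
- by apply/E; apply: wN.
- by apply/E; apply: wM.
Qed.

Definition witt_map (A B : comPzRingType) (f : A -> B) (x : W A) : W B := fun n => f (x n).

Section Map.
Variables (A B : comPzRingType) (f : {rmorphism A -> B}).
Let rr := witt_ring_rel (ring_rel_morph f).

Lemma witt_map_zmod : zmod_morphism (witt_map f).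
Proof.
move=> x y; apply/funext => n; apply/esym; move: n; have [_ rD rN _] := rr.
by apply: rD => //; apply: rN.
Qed.

Lemma witt_map_monoid : monoid_morphism (witt_map f).
Proof.
have [r1 _ _ rM] := rr; split=> [|x y]; apply/funext => n; apply/esym; move: n.
  exact: r1.
exact: rM.
Qed.

HB.instance Definition _ := GRing.isZmodMorphism.Build _ _ (witt_map f) witt_map_zmod.
HB.instance Definition _ := GRing.isMonoidMorphism.Build _ _ (witt_map f) witt_map_monoid.

Lemma witt_mapD x y : witt_map f (x + y) = witt_map f x + witt_map f y.
Proof. exact: rmorphD. Qed.

Lemma witt_mapM x y : witt_map f (x * y) = witt_map f x * witt_map f y.
Proof. exact: rmorphM. Qed.

Lemma witt_map1 : witt_map f 1 = 1.
Proof. exact: rmorph1. Qed.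

Lemma witt_mapN x : witt_map f (- x) = - witt_map f x.
Proof. exact: rmorphN. Qed.

Lemma witt_mapB x y : witt_map f (x - y) = witt_map f x - witt_map f y.
Proof. exact: rmorphB. Qed.

Lemma witt_map_nat n : witt_map f n%:R = n%:R.
Proof. exact: rmorph_nat. Qed.

Lemma witt_mapMn x n : witt_map f (x *+ n) = witt_map f x *+ n.
Proof. exact: rmorphMn. Qed.
End Map.

Section Components.
Variable A : comPzRingType.
Implicit Types (a : A) (x y : W A).

Definition teichmuller a : W A := fun n => if n is 0 then a else 0.
Definition verschiebung x : W A := fun n => if n is m.+1 then x m else 0.
Definition wshift x : W A := fun n => x n.+1.
Definition wfrob x : W A := fun n => x n ^+ p.

Lemma ghostD x y n : ghost p (x + y) n = ghost p x n + ghost p y n.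
Proof. by rewrite wittring_addE; apply: ghost_witt_add. Qed.

Lemma ghostM x y n : ghost p (x * y) n = ghost p x n * ghost p y n.
Proof. by rewrite wittring_mulE; apply: ghost_witt_mul. Qed.

Lemma ghost_one n : ghost p (1 : W A) n = 1.
Proof. exact: ghost_witt_one. Qed.

Lemma ghost_zero n : ghost p (0 : W A) n = 0.
Proof. exact: ghost_witt_zero. Qed.

Lemma ghostMn x k n : ghost p (x *+ k) n = ghost p x n *+ k.
Proof.
by elim: k => [|k IHk]; rewrite ?mulr0n ?ghost_zero // !mulrS ghostD IHk.
Qed.

Lemma ghost_teichmuller a n : ghost p (teichmuller a) n = a ^+ (p ^ n).
Proof.
case: n => [|n]; first by rewrite ghost0 expn0 expr1.
by rewrite ghost_recl (ghost_zero n) mul0rn addr0.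
Qed.

Lemma ghost_verschiebung x n : ghost p (verschiebung x) n.+1 = ghost p x n *+ p.
Proof. by rewrite ghost_recl /= expr0n expn_eq0 eqn0Ngt prime_gt0 //= add0r. Qed.
End Components.

Section TorsionFree.
Variables (B : comPzRingType) (tf : p_torsion_free p B).
Implicit Types (a : B) (x y : W B).

Lemma tf_teichmullerM a x : teichmuller a * x = (fun n => a ^+ (p ^ n) * x n) :> W B.
Proof.
apply: (ghost_ext tf) => n; rewrite ghostM ghost_teichmuller !ghostE mulr_sumr.
apply: eq_bigr => i _; have lein : (i <= n)%N by rewrite -ltnS.
by rewrite exprMn -exprM -expnD subnKC // mulrnAr.
Qed.

Lemma tf_teichmuller_shift x : teichmuller (x 0%N) + verschiebung (wshift x) = x.
Proof.
apply: (ghost_ext tf) => n; rewrite ghostD ghost_teichmuller.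
case: n => [|n]; first by rewrite !ghost0 addr0 expn0 expr1.
by rewrite ghost_verschiebung [RHS]ghost_recl.
Qed.

Lemma tf_verschiebungD x y : verschiebung (x + y) = verschiebung x + verschiebung y.
Proof.
apply: (ghost_ext tf) => -[|n]; rewrite ghostD; first by rewrite !ghost0 addr0.
by rewrite !ghost_verschiebung ghostD mulrnDl.
Qed.

Variables (A : comPzRingType) (chA : p%:R = 0 :> A) (f : {rmorphism B -> A}).

(** Ghost components modulo [p ^ n.+1] determine the coordinates modulo [p], which is all that
    survives in characteristic [p]. *)
Lemma congr_ghost_map x y :
  (forall n, congr_mod setT (p ^ n.+1) (ghost p x n) (ghost p y n)) ->
  witt_map f x = witt_map f y.
Proof.
move=> /(ghost_inj_congr tf) h; apply/funext => n.
have [_ _ [z _ e]] := h n; apply/eqP; rewrite -subr_eq0 /witt_map -rmorphB e.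
by rewrite -mulr_natl rmorphM rmorph_nat chA mul0r.
Qed.

Lemma congr_ghost_wfrob x n :
  congr_mod setT (p ^ n.+1) (ghost p x n.+1) (ghost p (wfrob x) n).
Proof.
split=> //; exists (x n.+1) => //.
by rewrite ghost_recr addrC addKr.
Qed.

Lemma tf_witt_mulp x : witt_map f (x *+ p) = witt_map f (verschiebung (wfrob x)).
Proof.
apply: congr_ghost_map => -[|n].
  split=> //; exists (x 0%N) => //.
  by rewrite ghostMn !ghost0 subr0 expn1.
rewrite ghostMn ghost_verschiebung expnS.
by apply: congr_modMn; [exact: is_subring_setT | exact: congr_ghost_wfrob].
Qed.

Lemma tf_witt_mulV x y :
  witt_map f (x * verschiebung y) = witt_map f (verschiebung (wfrob x * y)).
Proof.
have Sr := is_subring_setT B.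
apply: congr_ghost_map => -[|n].
  by rewrite ghostM !ghost0 mulr0; apply: congr_mod_refl.
rewrite ghostM !ghost_verschiebung ghostM expnS mulrnAr.
apply: congr_modMn => //.
have [_ _ _ cM] := congr_mod_ring_rel Sr (p ^ n.+1).
by apply: cM; [exact: congr_ghost_wfrob | exact: congr_mod_refl].
Qed.
End TorsionFree.

Section Identities.
Variable A : comPzRingType.
Implicit Types (a b : A) (x y : W A).

Lemma witt_map_cover x : exists x' : W (free_cover A), x = witt_map (@free_cover_eval A) x'.
Proof. exact: free_cover_fun. Qed.

Lemma witt_map_teichmuller (B : comPzRingType) (f : {rmorphism B -> A}) (c : B) :
  witt_map f (teichmuller c) = teichmuller (f c).
Proof. by apply/funext => -[|n] //; exact: rmorph0. Qed.

Lemma witt_map_verschiebung (B : comPzRingType) (f : {rmorphism B -> A}) (x : W B) :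
  witt_map f (verschiebung x) = verschiebung (witt_map f x).
Proof. by apply/funext => -[|n] //; exact: rmorph0. Qed.

Let tf := free_cover_torsion_free p_pr (A := A).

Lemma teichmullerM a x : teichmuller a * x = (fun n => a ^+ (p ^ n) * x n) :> W A.
Proof.
have [x' ->] := witt_map_cover x; rewrite -[a]free_cover_liftK.
rewrite -(witt_map_teichmuller (@free_cover_eval A)) -witt_mapM (tf_teichmullerM tf).
by apply/funext => n; rewrite /witt_map -rmorphXn -rmorphM.
Qed.

Lemma teichmuller_shift x : teichmuller (x 0%N) + verschiebung (wshift x) = x.
Proof.
have [x' ->] := witt_map_cover x.
rewrite -[in RHS](tf_teichmuller_shift tf x') witt_mapD.
by rewrite (witt_map_teichmuller (@free_cover_eval A)) (witt_map_verschiebung (@free_cover_eval A)).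
Qed.

Lemma verschiebungD x y : verschiebung (x + y) = verschiebung x + verschiebung y.
Proof.
have [[x' ->] [y' ->]] := conj (witt_map_cover x) (witt_map_cover y).
rewrite -witt_mapD -!(witt_map_verschiebung (@free_cover_eval A)) (tf_verschiebungD tf).
by rewrite witt_mapD.
Qed.

Hypothesis chA : p%:R = 0 :> A.

Lemma witt_map_wfrob (B : comPzRingType) (f : {rmorphism B -> A}) (x : W B) :
  witt_map f (wfrob x) = wfrob (witt_map f x).
Proof. by apply/funext => n; exact: rmorphXn. Qed.

Lemma witt_mulp x : x *+ p = verschiebung (wfrob x).
Proof.
have [x' ->] := witt_map_cover x.
rewrite -(witt_map_wfrob (@free_cover_eval A)) -(witt_map_verschiebung (@free_cover_eval A)).
by rewrite -(tf_witt_mulp tf chA) witt_mapMn.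
Qed.

Lemma witt_mulV x y : x * verschiebung y = verschiebung (wfrob x * y).
Proof.
have [[x' ->] [y' ->]] := conj (witt_map_cover x) (witt_map_cover y).
rewrite -(witt_map_wfrob (@free_cover_eval A)) -(witt_map_verschiebung (@free_cover_eval A)).
by rewrite -witt_mapM (tf_witt_mulV tf chA) (witt_map_verschiebung (@free_cover_eval A)) witt_mapM.
Qed.

End Identities.
End WittRelations.

(** * Coordinates of Witt vectors, especially in characteristic [p] *)

Section WittTheory.
Variables (p : nat) (p_pr : prime p).
Local Notation W := (wittring p_pr).

Section General.
Variable A : comPzRingType.
Implicit Types (a b : A) (x y z : W A).
Local Notation teich := (@teichmuller p p_pr A).

Lemma wcoord0D x y : (x + y) 0%N = x 0%N + y 0%N.
Proof. by have := ghostD x y 0; rewrite !ghost0. Qed.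

Lemma wcoord0M x y : (x * y) 0%N = x 0%N * y 0%N.
Proof. by have := ghostM x y 0; rewrite !ghost0. Qed.

Lemma wcoord0N x : (- x) 0%N = - x 0%N.
Proof. by apply/eqP; rewrite -addr_eq0 -wcoord0D addNr. Qed.

Lemma wcoord0B x y : (x - y) 0%N = x 0%N - y 0%N.
Proof. by rewrite wcoord0D wcoord0N. Qed.

Lemma wcoord0X x n : (x ^+ n) 0%N = x 0%N ^+ n.
Proof. by elim: n => [|n IHn] //; rewrite !exprS wcoord0M IHn. Qed.

Lemma teich0 : teich 0 = 0.
Proof. by apply/funext => -[]. Qed.

Lemma teich1 : teich 1 = 1.
Proof. by apply/funext => -[]. Qed.

Lemma teichM a b : teich (a * b) = teich a * teich b.
Proof.
rewrite teichmullerM; apply/funext => -[|n] /=; first by rewrite expn0 expr1.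
by rewrite mulr0.
Qed.

Lemma teichX a n : teich (a ^+ n) = teich a ^+ n.
Proof. by elim: n => [|n IHn]; rewrite ?teich1 // !exprS teichM IHn. Qed.

Lemma verschiebung0 : verschiebung (0 : W A) = 0.
Proof. by apply/funext => -[]. Qed.

Lemma verschiebungN x : verschiebung (- x) = - verschiebung x.
Proof. by apply/eqP; rewrite -addr_eq0 -verschiebungD addNr verschiebung0. Qed.

Lemma verschiebungB x y : verschiebung (x - y) = verschiebung x - verschiebung y.
Proof. by rewrite verschiebungD verschiebungN. Qed.

Lemma teich_verschiebungE a x :
  teich a + verschiebung x = (fun n => if n is m.+1 then x m else a) :> W A.
Proof. exact: (teichmuller_shift (fun n => if n is m.+1 then x m else a)). Qed.

Lemma wcoord_eq0 x : x 0%N = 0 -> x = verschiebung (wshift x).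
Proof. by move=> x0; rewrite -[LHS]teichmuller_shift x0 teich0 add0r. Qed.

Lemma wcoordD_iter x y n i :
  (i < n)%N -> (x + iter n (@verschiebung p p_pr A) y) i = x i.
Proof.
elim: n i x y => [//|n IHn] i x y lein.
rewrite /= -[x in LHS]teichmuller_shift -addrA -verschiebungD teich_verschiebungE.
by case: i lein => [//|i] lein; rewrite IHn.
Qed.

Lemma witt_iter_eq0 x :
  (forall n, exists y, x = iter n (@verschiebung p p_pr A) y) -> x = 0.
Proof.
move=> h; apply/funext => i; have [y ->] := h i.+1.
by rewrite -[iter _ _ _]add0r wcoordD_iter.
Qed.

End General.

Section CharP.
Variables (A : comPzRingType) (chA : p%:R = 0 :> A).
Implicit Types (a b : A) (x y z : W A).
Local Notation teich := (@teichmuller p p_pr A).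

Lemma char_ring_rel : ring_rel (fun u v : A => v = u ^+ p).
Proof.
have E (u v : A) : congr_mod setT p v (u ^+ p) <-> v = u ^+ p.
  split=> [[_ _ [z _]]|->]; last exact: (congr_mod_refl (is_subring_setT A)).
  by rewrite -mulr_natl chA mul0r => /eqP; rewrite subr_eq0 => /eqP.
have [r1 rD rN rM] := ring_rel_Frobenius p_pr A.
split=> [|x x' y y' /E hx /E hy|x x' /E hx|x x' y y' /E hx /E hy].
- exact/E.
- exact/E/rD.
- exact/E/rN.
- exact/E/rM.
Qed.

Lemma char_exprD a b : (a + b) ^+ p = a ^+ p + b ^+ p.
Proof. by have [_ rD _ _] := char_ring_rel; rewrite (rD a (a ^+ p) b (b ^+ p)). Qed.

Lemma char_exprN a : (- a) ^+ p = - a ^+ p.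
Proof. by have [_ _ rN _] := char_ring_rel; rewrite (rN a (a ^+ p)). Qed.

Lemma char_expnD n a b : (a + b) ^+ (p ^ n) = a ^+ (p ^ n) + b ^+ (p ^ n).
Proof.
by elim: n => [|n IHn]; rewrite ?expn0 ?expr1 // expnSr !exprM IHn char_exprD.
Qed.

Lemma char_expnN n a : (- a) ^+ (p ^ n) = - a ^+ (p ^ n).
Proof.
by elim: n => [|n IHn]; rewrite ?expn0 ?expr1 // expnSr !exprM IHn char_exprN.
Qed.

Lemma char_expnB n a b : (a - b) ^+ (p ^ n) = a ^+ (p ^ n) - b ^+ (p ^ n).
Proof. by rewrite char_expnD char_expnN. Qed.

Let frel := witt_ring_rel p_pr char_ring_rel.

Lemma wfrobE x y : y = wfrob x <-> forall n, y n = x n ^+ p.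
Proof. by split=> [-> //|h]; apply/funext. Qed.

Lemma wfrob1 : wfrob (1 : W A) = 1.
Proof. by have [r1 _ _ _] := frel; apply/esym/wfrobE. Qed.

Lemma wfrobD x y : wfrob (x + y) = wfrob x + wfrob y.
Proof. by have [_ rD _ _] := frel; apply/esym/wfrobE; apply: rD. Qed.

Lemma wfrobN x : wfrob (- x) = - wfrob x.
Proof. by have [_ _ rN _] := frel; apply/esym/wfrobE; apply: rN. Qed.

Lemma wfrobM x y : wfrob (x * y) = wfrob x * wfrob y.
Proof. by have [_ _ _ rM] := frel; apply/esym/wfrobE; apply: rM. Qed.

Lemma wfrobB x y : wfrob (x - y) = wfrob x - wfrob y.
Proof. by rewrite wfrobD wfrobN. Qed.

Lemma wfrob_teich a : wfrob (teich a) = teich (a ^+ p).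
Proof. by apply/funext => -[|n] //=; rewrite /wfrob expr0n eqn0Ngt prime_gt0. Qed.

Lemma wfrobV x : wfrob (verschiebung x) = verschiebung (wfrob x).
Proof. by apply/funext => -[|n] //=; rewrite /wfrob expr0n eqn0Ngt prime_gt0. Qed.

Lemma wfrobMn x n : wfrob (x *+ n) = wfrob x *+ n.
Proof.
elim: n => [|n IHn]; last by rewrite !mulrS wfrobD IHn.
by rewrite !mulr0n; apply: (addrI (wfrob 0)); rewrite -wfrobD !addr0.
Qed.

Lemma witt_mulp_coord x n : (x *+ p) n.+1 = x n ^+ p.
Proof. by rewrite witt_mulp. Qed.

Lemma witt_mulp_coord0 x : (x *+ p) 0%N = 0.
Proof. by rewrite witt_mulp. Qed.

Lemma witt_mulpX x n : exists y, x *+ p ^ n = iter n (@verschiebung p p_pr A) y.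
Proof.
elim: n => [|n [y e]]; first by exists x; rewrite expn0.
exists (wfrob y); rewrite expnSr mulrnA e.
elim: n y {e} => [|n IHn] y; first by rewrite witt_mulp.
by rewrite witt_mulp //= wfrobV -witt_mulp // IHn.
Qed.

Lemma wcoordD_mulp x y n i : (i < n)%N -> (x + y *+ p ^ n) i = x i.
Proof. by have [z ->] := witt_mulpX y n; apply: wcoordD_iter. Qed.

(* The coordinates of the solution are found one by one: if [k = [c] + V k'],
   the equation [x * k = y] becomes [F x * k' = V^-1 (y - x * [c])]. *)
Lemma witt_div x y a : x 0%N * a = 1 -> exists z, x * z = y.
Proof.
move=> xa.
(* Here [s] is the pair of divisor and dividend, and [b] inverts the first coordinate of the
   divisor; both [b] and the divisor undergo Frobenius at each step. *)
pose sol := fix sol (n : nat) (b : A) (s : W A * W A) : A :=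
  let c := b * s.2 0%N in
  if n is m.+1 then sol m (b ^+ p) (wfrob s.1, wshift (s.2 - s.1 * teich c)) else c.
have H n : forall b (u v : W A), u 0%N * b = 1 ->
    exists d, v - u * (fun i => sol i b (u, v) : A) = iter n (@verschiebung p p_pr A) d.
  elim: n => [|n IHn] b u v ub; first by eexists.
  set c := b * v 0%N.
  have ub' : wfrob u 0%N * b ^+ p = 1 by rewrite /wfrob /= -exprMn ub expr1n.
  have [d hd] := IHn (b ^+ p) (wfrob u) (wshift (v - u * teich c)) ub'.
  exists d; rewrite /= -hd verschiebungB -witt_mulV // -wcoord_eq0; last first.
    by rewrite wcoord0B wcoord0M /= /c mulrA ub mul1r subrr.
  rewrite -addrA -opprD -mulrDr teich_verschiebungE; congr (_ - _ * _).
  by apply/funext => -[].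
exists (fun i => sol i a (x, y)); apply/eqP; rewrite eq_sym -subr_eq0; apply/eqP.
by apply: witt_iter_eq0 => n; apply: H.
Qed.

End CharP.

Section Domain.
Variables (A : idomainType) (chA : p%:R = 0 :> A).
Implicit Types (a b : A) (x y z : W A).
Local Notation teich := (@teichmuller p p_pr A).

Lemma witt_mulpI x y : x *+ p = y *+ p -> x = y.
Proof.
move=> e; apply/eqP; rewrite -subr_eq0; apply/eqP/funext => n.
have : ((x - y) *+ p) n.+1 = 0 by rewrite mulrnBl e subrr.
by rewrite witt_mulp_coord // => /eqP; rewrite expf_eq0 => /andP[_ /eqP].
Qed.

Lemma teich_mulI a x y : a != 0 -> teich a * x = teich a * y -> x = y.
Proof.
rewrite !teichmullerM => a0 e; apply/funext => n.
have := congr1 (fun z : W A => z n) e.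
by apply: mulfI; rewrite expf_neq0.
Qed.

Lemma char_expI n a b : a ^+ (p ^ n) = b ^+ (p ^ n) -> a = b.
Proof.
move=> e; apply/eqP; rewrite -subr_eq0; have /eqP := char_expnB chA n a b.
by rewrite e subrr expf_eq0 => /andP[].
Qed.

Lemma char_expI1 a b : a ^+ p = b ^+ p -> a = b.
Proof. by have := @char_expI 1 a b; rewrite expn1. Qed.

End Domain.

End WittTheory.

Lemma congr_ring_rel (A : comPzRingType) (S : set A) (t : A) : is_subring S ->
  ring_rel (fun u v : A => [/\ S u, S v & exists2 e, S e & u - v = t * e]).
Proof.
move=> Sr; have [S1 SD SN SM] := And4 (is_subring1 Sr) (is_subringD Sr) (is_subringN Sr) (is_subringM Sr).
split=> [|x x' y y' [Sx Sx' [u Su ex]] [Sy Sy' [v Sv ey]]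
         |x x' [Sx Sx' [u Su ex]]
         |x x' y y' [Sx Sx' [u Su ex]] [Sy Sy' [v Sv ey]]].
- by split=> //; exists 0; rewrite ?subrr ?mulr0 //; apply: is_subring0 Sr.
- split; [exact: SD.. | exists (u + v); first exact: SD].
  by rewrite mulrDr -ex -ey opprD addrACA.
- split; [exact: SN.. | exists (- u); first exact: SN].
  by rewrite mulrN -ex opprB opprK addrC.
split; [exact: SM.. | exists (u * y + x' * v); first by apply: SD; apply: SM].
by rewrite mulrDr mulrA -ex mulrCA -ey; ring.
Qed.

(** * The perfect ring generated by a quotient by xi *)

Section TopCoefficient.
Variable L : fieldType.

(* Bivariate polynomials [P] of degree at most [d] in the inner variable for
   each power [d] of the outer one, and their homogeneous parts [Q] *)
Definition top_rel (P : {poly {poly L}}) (Q : {poly L}) :=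
  forall d, (size (P`_d)%R <= d.+1)%N /\ (P`_d)`_d = Q`_d.

Lemma coefM_top (P Q : {poly L}) i j : (size P <= i.+1)%N -> (size Q <= j.+1)%N ->
  (size (P * Q)%R <= (i + j).+1)%N /\ (P * Q)`_(i + j) = P`_i * Q`_j.
Proof.
move=> sP sQ; split.
  apply: (leq_trans (size_polyMleq _ _)).
  by rewrite -[X in (_ <= X)%N]/((i + j).+2.-1) -addSn -addnS -!subn1 leq_sub2r // leq_add.
have ij : (i < (i + j).+1)%N by rewrite ltnS leq_addr.
rewrite coefM (bigD1 (Ordinal ij)) //= addKn big1 ?addr0 // => k /eqP ki.
have [ltki|leik] := ltnP k i.
  rewrite [Q`_ _]nth_default ?mulr0 //; apply: (leq_trans sQ).
  by lia.
rewrite [P`_ _]nth_default ?mul0r //; apply: (leq_trans sP).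
by rewrite ltn_neqAle leik andbT; apply/eqP => e; apply/ki/val_inj.
Qed.

Lemma top_rel_ring : ring_rel top_rel.
Proof.
split=> [d|P P' Q Q' hP hQ d|P P' hP d|P P' Q Q' hP hQ d].
- rewrite !coef1; case: d => [|d] /=; last by rewrite size_poly0 coef0.
  by rewrite size_poly1 coef1.
- have [[sP cP] [sQ cQ]] := conj (hP d) (hQ d); rewrite !coefD cP cQ; split=> //.
  by apply: (leq_trans (size_polyD _ _)); rewrite geq_max sP.
- by have [sP cP] := hP d; rewrite !coefN cP size_polyN.
rewrite !coefM; split.
  apply: (leq_trans (size_sum _ _ _)); apply/bigmax_leqP => i _.
  have led : (i <= d)%N by rewrite -ltnS.
  have [[sP _] [sQ _]] := conj (hP i) (hQ (d - i)%N).
  by have := proj1 (coefM_top sP sQ); rewrite subnKC.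
rewrite coef_sum; apply: eq_bigr => i _.
have led : (i <= d)%N by rewrite -ltnS.
have [[sP cP] [sQ cQ]] := conj (hP i) (hQ (d - i)%N).
by have := proj2 (coefM_top sP sQ); rewrite subnKC // -cP -cQ.
Qed.

End TopCoefficient.

(** Inside a perfect field such a subring is itself perfect: the roots exist in the field and lie in
    [S]. *)
Definition perfect_subring (p : nat) (A : comPzRingType) (S : set A) :=
  is_subring S /\ forall x, S (x ^+ p) -> S x.

(** * Congruences modulo [xi] and powers of [[t]] *)

Section Untilting.
Variables (p : nat) (p_pr : prime p) (L : fieldType).
Hypotheses (chL : p%:R = 0 :> L) (perfL : forall x : L, exists y, y ^+ p = x).
Variables (E : set L) (t : L) (w : wittring p_pr L).
Hypotheses (Ep : perfect_subring p E) (Et : E t) (t0 : t != 0).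
Variable xi : wittring p_pr L.
Hypothesis xi_def : xi = p%:R - teichmuller p_pr t * w.
Variable w' : wittring p_pr L.
Hypotheses (Ew : witt_over E w) (Ew' : witt_over E w') (ww' : w * w' = 1).

Local Notation W := (wittring p_pr L).
Local Notation teich := (@teichmuller p p_pr L).
Local Notation WE := (@witt_over p p_pr L E).

Let Er : is_subring E := proj1 Ep.
Let Eroot : forall x, E (x ^+ p) -> E x := proj2 Ep.
Let WEr : is_subring WE := witt_over_subring p_pr Er.
Let p0 : (0 < p)%N := prime_gt0 p_pr.

Lemma w00 : w 0%N * w' 0%N = 1.
Proof. by rewrite -wcoord0M ww'. Qed.

Let w0 : w 0%N != 0.
Proof. by apply: contra_eq_neq w00 => ->; rewrite mul0r eq_sym oner_eq0. Qed.

Lemma perfect_root n (x : L) : exists y, y ^+ (p ^ n) = x.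
Proof.
elim: n x => [|n IHn] x; first by exists x; rewrite expn0 expr1.
have [y <-] := perfL x; have [z <-] := IHn y.
by exists z; rewrite expnSr exprM.
Qed.

Lemma perfect_subring_root n (x : L) : E (x ^+ (p ^ n)) -> E x.
Proof.
elim: n x => [|n IHn] x; first by rewrite expn0 expr1.
by rewrite expnSr exprM => /Eroot /IHn.
Qed.

Lemma witt_over_mulp (S : set L) (x : W) : perfect_subring p S ->
  witt_over S (x *+ p) -> witt_over S x.
Proof. by case=> _ Sroot h n; apply: Sroot; have := h n.+1; rewrite witt_mulp_coord. Qed.

Lemma witt_over_teich (S : set L) a : is_subring S -> S a -> witt_over S (teich a).
Proof. by move=> Sr Sa [|n] //; apply: is_subring0 Sr. Qed.

Lemma perfect_mulp (x : W) : x 0%N = 0 -> exists y, x = y *+ p.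
Proof.
move=> x0; have [y hy] := choice (fun n => perfL (x n.+1)).
exists y; rewrite witt_mulp //; apply/funext => -[|n] //.
by rewrite /= /wfrob hy.
Qed.

Lemma witt_digit (S : set L) (x : W) : perfect_subring p S -> witt_over S x ->
  exists2 y, witt_over S y & x = teich (x 0%N) + y *+ p.
Proof.
move=> Sp Sx; have Sr := proj1 Sp.
have [|y e] := @perfect_mulp (x - teich (x 0%N)).
  by rewrite wcoord0B subrr.
exists y; last by rewrite -e subrKC.
apply: witt_over_mulp => //; rewrite -e.
by apply: (is_subringB (witt_over_subring p_pr Sr)) => //; apply: witt_over_teich.
Qed.

Let WED := is_subringD WEr.
Let WEB := is_subringB WEr.
Let WEM := is_subringM WEr.
Let WEX := is_subringX WEr.
Let WE0 := is_subring0 WEr.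
Let WEt a : E a -> WE (teich a) := witt_over_teich Er.
Let WEp x : WE (x *+ p) -> WE x := witt_over_mulp Ep.

Lemma xiE (x : W) : xi * x = x *+ p - teich t * (w * x).
Proof. by rewrite xi_def mulrBl mulr_natl mulrA. Qed.

Lemma WE_xi : WE xi.
Proof.
rewrite xi_def.
apply: WEB => //; first exact: (is_subring_nat WEr).
by apply: WEM => //; apply: WEt.
Qed.

(** The ideal [(a, xi)] of [W(E)]. The witnesses are kept in [W(E)], since in [W(L)] the element
    [xi] is a unit and the condition would be empty. *)
Definition in_ideal (a x : W) := exists y z, [/\ WE y, WE z & x = a * y + xi * z].

Definition xi_dvd (x : W) := exists2 z, WE z & x = xi * z.

(** The equation becomes [[s] * (x + [s'] * w * y) = p * y]. As [s] is nonzero, the bracket has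
    first coordinate [0], hence is [p * z], and then [y = [s] * z]. *)
Lemma teich_cancel s s' (x y : W) : E s -> E s' -> t = s * s' -> WE x -> WE y ->
  teich s * x = xi * y -> xi_dvd x.
Proof.
move=> Es Es' ts Ex Ey e.
have s0 : s != 0 by apply: contraNneq t0 => s0; rewrite ts s0 mul0r.
have e1 : teich s * (x + teich s' * (w * y)) = y *+ p.
  rewrite mulrDr e xiE ts teichM; ring.
have [|z ez] := @perfect_mulp (x + teich s' * (w * y)).
  have := congr1 (fun z : W => z 0%N) e1.
  by rewrite wcoord0M witt_mulp_coord0 // => /eqP; rewrite mulf_eq0 (negPf s0) => /eqP.
have Ez : WE z.
  apply: WEp => //; rewrite -ez.
  by apply: WED => //; apply: WEM; [exact: WEt | exact: WEM].
have ey : y = teich s * z.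
  by apply: (witt_mulpI chL); rewrite -e1 ez mulrnAr.
exists z => //; rewrite xiE -ez ey ts teichM; ring.
Qed.

Lemma teichX_cancel n s s' (x : W) : E s -> E s' -> t = s * s' -> WE x ->
  xi_dvd (teich s ^+ n * x) -> xi_dvd x.
Proof.
move=> Es Es' ts Ex; elim: n => [|n IHn]; first by rewrite mul1r.
rewrite exprS -mulrA => -[z Ez e]; apply: IHn.
apply: (teich_cancel Es Es' ts _ Ez e).
by apply: WEM => //; apply: WEX => //; apply: WEt.
Qed.

(** The first coordinate of [xi * y] is [- t * w_0 * y_0]; if it vanishes, so does [y_0], and [y] is
    divisible by [p]. *)
Lemma p_cancel (x : W) : WE x -> xi_dvd (x *+ p) -> xi_dvd x.
Proof.
move=> Ex [y Ey e]; have [|z ez] := @perfect_mulp y.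
  have := congr1 (fun z : W => z 0%N) e.
  rewrite xiE wcoord0B !witt_mulp_coord0 // !wcoord0M sub0r => /esym /eqP.
  by rewrite oppr_eq0 !mulf_eq0 (negPf t0) (negPf w0) => /eqP.
exists z; first by apply: WEp; rewrite -?ez.
by apply: (witt_mulpI chL); rewrite e ez mulrnAr.
Qed.

Lemma xi_dvdD x y : xi_dvd x -> xi_dvd y -> xi_dvd (x + y).
Proof.
move=> [u Eu ->] [v Ev ->]; exists (u + v); last by rewrite mulrDr.
exact: WED.
Qed.

Lemma xi_dvdMr x y : WE y -> xi_dvd x -> xi_dvd (x * y).
Proof.
move=> Ey [u Eu ->]; exists (u * y); last by rewrite mulrA.
exact: WEM.
Qed.

Lemma in_ideal_over a x : WE a -> in_ideal a x -> WE x.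
Proof.
move=> Ea [y [z [Ey Ez ->]]].
by apply: WED => //; apply: WEM => //; apply: WE_xi.
Qed.

Lemma in_idealD a x y : in_ideal a x -> in_ideal a y -> in_ideal a (x + y).
Proof.
move=> [u [v [Eu Ev ->]]] [u' [v' [Eu' Ev' ->]]].
exists (u + u'), (v + v'); split; [exact: WED.. |]; ring.
Qed.

Lemma in_idealMr a x y : WE y -> in_ideal a x -> in_ideal a (x * y).
Proof.
move=> Ey [u [v [Eu Ev ->]]].
exists (u * y), (v * y); split; [exact: WEM.. |]; ring.
Qed.

Lemma in_ideal0 a : in_ideal a 0.
Proof. by exists 0, 0; split; [exact: WE0.. | rewrite !mulr0 addr0]. Qed.

Lemma in_idealMn a x n : in_ideal a x -> in_ideal a (x *+ n).
Proof.
by move=> ax; elim: n => [|n IHn]; [exact: in_ideal0 | rewrite mulrS; apply: in_idealD].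
Qed.

Lemma in_idealM a b x y : WE a -> WE b -> in_ideal a x -> in_ideal b y ->
  in_ideal (a * b) (x * y).
Proof.
move=> Ea Eb [u [v [Eu Ev ->]]] [u' [v' [Eu' Ev' ->]]].
exists (u * u'), (a * u * v' + b * u' * v + xi * v * v').
split; [exact: WEM | | by ring].
have Exi := WE_xi.
by apply: (WED (WED _ _)); apply: WEM => //; apply: WEM.
Qed.

Lemma in_ideal_self a x : WE x -> in_ideal a (a * x).
Proof.
move=> Ex; exists x, 0; split=> //; by rewrite mulr0 addr0.
Qed.

Lemma in_ideal_xi a x : xi_dvd x -> in_ideal a x.
Proof.
move=> [z Ez ->]; exists 0, z; split=> //; by rewrite mulr0 add0r.
Qed.

(** Modulo [xi] the element [p] equals [[t] * w], so that a factor [p] counts as a factor [[t]]. *)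
Lemma in_ideal_p n x : in_ideal (teich t ^+ n) x -> in_ideal (teich t ^+ n.+1) (x *+ p).
Proof.
move=> tx; have Ett := WEt Et.
have Ex : WE x by apply: in_ideal_over tx; apply: WEX.
case: tx => u [v [Eu Ev e]].
exists (w * u), (teich t * (w * v) + x); split.
- exact: WEM.
- by apply: WED => //; do !apply: WEM => //.
have -> : x *+ p = teich t * (w * x) + xi * x by rewrite xiE subrKC.
by rewrite {1}e exprS; ring.
Qed.

Lemma in_ideal_le m n x : (m <= n)%N -> in_ideal (teich t ^+ n) x -> in_ideal (teich t ^+ m) x.
Proof.
move=> /subnKC <- [u [v [Eu Ev ->]]].
exists (teich t ^+ (n - m) * u), v; split=> //; last by rewrite exprD; ring.
by apply: WEM => //; apply: WEX => //; apply: WEt.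
Qed.

Lemma in_ideal_pX n x : WE x -> in_ideal (teich t ^+ n) (x *+ p ^ n).
Proof.
move=> Ex; elim: n => [|n IHn]; last by rewrite expnSr mulrnA; apply: in_ideal_p.
by rewrite expn0 mulr1n -[X in in_ideal _ X]mul1r; apply: in_ideal_self.
Qed.

Lemma in_ideal_cancel m n x : WE x ->
  in_ideal (teich t ^+ (m + n)) (teich t ^+ m * x) -> in_ideal (teich t ^+ n) x.
Proof.
move=> Ex [u [v [Eu Ev e]]].
have Etn : WE (teich t ^+ n) by apply: WEX => //; apply: WEt.
have [z Ez ez] : xi_dvd (x - teich t ^+ n * u).
  apply: (@teichX_cancel m t 1 _ Et (is_subring1 Er)); first by rewrite mulr1.
    by apply: WEB => //; apply: WEM.
  exists v => //; rewrite mulrBr e exprD; ring.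
by exists u, z; split=> //; rewrite -ez subrKC.
Qed.

(* [W(E) / (xi)] is closed under p-th roots: its reduction modulo p is
   [E / t], where [u ^ p] divisible by [s ^ p] forces [u] divisible by [s] *)
Lemma in_ideal_root1 s s' n x : E s -> E s' -> t = s ^+ p * s' -> WE x ->
  in_ideal (teich (s ^+ p) ^+ n) (x ^+ p) -> in_ideal (teich s ^+ n) x.
Proof.
move=> Es Es' ts Ex; elim: n x Ex => [|n IHn] x Ex xp.
  by rewrite expr0 -[x]mul1r; apply: in_ideal_self.
have s0 : s != 0.
  by apply: contraNneq t0 => s0; rewrite ts s0 expr0n eqn0Ngt p0 mul0r.
have [u [v [Eu Ev e]]] := xp.
(* The quotient of [x_0 ^ p] by [s ^ p], read off from the first coordinate of [e]. Its [p]-th root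
   in [L] is [x_0 / s], which therefore lies in [E]. *)
pose a := s ^+ (p * n) * u 0%N - s' * w 0%N * v 0%N.
have ex0 : x 0%N ^+ p = s ^+ p * a.
  rewrite -wcoord0X e wcoord0D wcoord0M wcoord0X xiE wcoord0B !wcoord0M.
  by rewrite witt_mulp_coord0 // /= ts /a -exprM mulnS exprD; ring.
have EM := is_subringM Er; have EX n' := is_subringX Er n' Es.
have Ea : E a := is_subringB Er (EM _ _ (EX _) (Eu 0%N)) (EM _ _ (EM _ _ Es' (Ew 0%N)) (Ev 0%N)).
have [Eb ex] : E (x 0%N / s) /\ x 0%N = s * (x 0%N / s).
  split; last by rewrite mulrC divfK.
  by apply: Eroot; rewrite expr_div_n ex0 mulrAC mulfV ?mul1r // expf_neq0.
have [y Ey ey] := witt_digit Ep Ex.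
have p1 := prednK p0.
(* With [p * y = [t] * w * y + xi * y] and [t = s * (s ^ (p - 1) * s')], the digit expansion of [x]
   becomes [[s] * x1] modulo [xi]. *)
pose x1 := teich (x 0%N / s) + teich (s ^+ p.-1 * s') * (w * y).
have exx : x = teich s * x1 + xi * y.
  have e2 : s * (s ^+ p.-1 * s') = t by rewrite mulrA -exprS p1.
  rewrite {1}ey xiE /x1 mulrDr -teichM -ex mulrA -teichM e2; ring.
have Ets := WEt Es.
have Ex1 : WE x1.
  apply: WED => //; first exact: WEt.
  apply: WEM => //; last exact: WEM.
  by apply: WEt => //; apply: (is_subringM Er) => //; apply: (is_subringX Er).
suff [u1 [v1 [Eu1 Ev1 ex1]]] : in_ideal (teich s ^+ n) x1.
  exists u1, (teich s * v1 + y); split=> //; last by rewrite exx ex1 exprS; ring.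
  by apply: WED => //; apply: WEM.
apply: IHn => //.
have [z Ez ez] : exists2 z, WE z & x ^+ p = (teich s * x1) ^+ p + xi * z.
  exists (y * \sum_(i < p) x ^+ (p.-1 - i) * (teich s * x1) ^+ i).
    apply: WEM => //; apply: (is_subring_sum WEr) => i _.
    by apply: WEM; do ?apply: WEX => //; apply: WEM.
  by rewrite mulrA [xi * y](_ : _ = x - teich s * x1) -?subrXX ?subrKC // {1}exx addrC addKr.
have Esp : E (s ^+ p) by apply: (is_subringX Er).
have Etsn m : WE (teich (s ^+ p) ^+ m).
  by apply: WEX => //; apply: WEt.
(* Cancelling [[s ^ p]] modulo [xi] lowers the exponent from [n.+1] to [n]. *)
have [z1 Ez1 ez1] : xi_dvd (x1 ^+ p - teich (s ^+ p) ^+ n * u).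
  apply: (@teich_cancel (s ^+ p) s' _ (v - z)) => //.
  - by apply: WEB => //; [apply: WEX | apply: WEM].
  - exact: WEB.
  move: e; rewrite ez exprMn -(teichX _ s p) exprS => e.
  rewrite mulrBr -[teich (s ^+ p) * x1 ^+ p](addrK (xi * z)) e; ring.
by exists u, z1; split=> //; rewrite -ez1 subrKC.
Qed.

Lemma in_ideal_root k s m x : E s -> s ^+ (p ^ k) = t -> WE x ->
  in_ideal (teich t ^+ m) (x ^+ (p ^ k)) -> in_ideal (teich s ^+ m) x.
Proof.
elim: k s x => [|k IHk] s x Es.
  by rewrite expn0 !expr1 => ->.
rewrite expnS !exprM => st Ex xk.
have Esp : E (s ^+ p) by exact: (is_subringX Er).
have xp := IHk _ _ Esp st (WEX _ Ex) xk.
have [q eq] : exists q, (p ^ k = q.+1)%N.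
  by exists (p ^ k).-1; rewrite prednK // expn_gt0 p0.
apply: (in_ideal_root1 Es _ _ Ex xp (s' := (s ^+ p) ^+ q)).
  exact: (is_subringX Er).
by rewrite -exprS -eq.
Qed.

Lemma in_ideal_rootX k n x : WE x ->
  in_ideal (teich t ^+ (n * p ^ k)) (x ^+ (p ^ k)) -> in_ideal (teich t ^+ n) x.
Proof.
move=> Ex xk; have [s es] := perfect_root k t.
have Es : E s by apply: (@perfect_subring_root k); rewrite es.
have := in_ideal_root Es es Ex xk.
by rewrite mulnC exprM -teichX es.
Qed.

Lemma in_idealMl a b x : WE b -> in_ideal a x -> in_ideal (b * a) (b * x).
Proof.
move=> Eb [u [v [Eu Ev ->]]]; exists u, (b * v); split=> //; first exact: WEM.
ring.
Qed.

(** As [w] is a unit, [[t]] and [p] are associated modulo [xi]; this trades powers of [[t]] for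
    powers of [p], which control Witt coordinates. *)
Lemma teich_p_ideal n u : WE u ->
  exists y z, [/\ WE y, WE z & teich t ^+ n * u = y *+ p ^ n + xi * z].
Proof.
elim: n u => [|n IHn] u Eu.
  by exists u, 0; split=> //; rewrite mulr0 addr0 mul1r expn0.
have [y [z [Ey Ez e]]] := IHn _ (WEM Ew' Eu).
exists y, (z *+ p - teich t ^+ n * (w' * u)).
have e1 : teich t * u = (w' * u) *+ p - xi * (w' * u).
  by rewrite xiE [w * (w' * u)]mulrA ww' mul1r opprB addrC subrK.
split=> //.
  apply: WEB; first exact: (is_subringMn WEr).
  by apply: WEM; [apply/WEX/WEt | apply: WEM].
rewrite exprSr -mulrA e1 mulrBr mulrnAr e mulrnDl -mulrnA -expnSr.
by rewrite -addrA mulrBr mulrnAr; congr (_ + (_ - _)); rewrite -e mulrCA.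
Qed.

(** The first coordinate of [xi] is [- t * w_0], nonzero in the field [L]. *)
Lemma xi_solve x : exists z, xi * z = x.
Proof.
apply: (@witt_div _ p_pr _ chL xi x (xi 0%N)^-1); rewrite mulfV // xi_def wcoord0B wcoord0M.
rewrite -[p%:R]/(1 *+ p) witt_mulp_coord0 // sub0r oppr_eq0.
by rewrite mulf_neq0.
Qed.

Lemma xi_mulI x y : xi * x = xi * y -> x = y.
Proof.
have [z ez] := xi_solve 1 => e.
by rewrite -[x]mul1r -[y]mul1r -ez mulrAC e mulrAC.
Qed.

(** Coordinate [i] of the quotient [x / xi], formed in [W(L)], does not change under multiples of
    [p ^ i.+1], and modulo these the quotient lies in [W(E)]. *)
Lemma in_ideal_closed x :
  (forall n, in_ideal (teich t ^+ n) x) -> xi_dvd x.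
Proof.
move=> h; have [z ez] := xi_solve x; have [a ea] := xi_solve 1.
exists z => [i|//]; have [u [v [Eu Ev e]]] := h i.+1.
have [y [v' [Ey Ev' e']]] := teich_p_ideal i.+1 Eu.
have -> : z = (v' + v) + (a * y) *+ p ^ i.+1.
  apply: xi_mulI; rewrite ez e e' mulrDr mulrnAr mulrA ea mul1r; ring.
by rewrite wcoordD_mulp //; apply: WED.
Qed.

(** * Fractions with denominators bounded by [G] *)

Section Bounded.
Variables (G : W) (EG : WE G).

(* In [W(E)[1/t] / (xi)], every power of [[b / t ^ n]] maps [G] to an integral
   element *)
Definition gbound (b : L) n :=
  E b /\ forall m, in_ideal (teich t ^+ (n * m)) (teich (b ^+ m) * G).

Definition gbounded (d : L) := exists n, gbound (t ^+ n * d) n.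

Lemma gboundS b n : gbound b n -> gbound (t * b) n.+1.
Proof.
move=> [Eb hb]; split=> [|m]; first exact: (is_subringM Er).
rewrite exprMn teichM teichX -mulrA mulSn exprD; apply: in_idealMl => //.
by apply: WEX; apply: WEt.
Qed.

Lemma gboundSE b n : E b -> gbound (t * b) n.+1 -> gbound b n.
Proof.
move=> Eb [_ hb]; split=> // m; apply: (@in_ideal_cancel m).
  by apply: WEM => //; apply/WEt/(is_subringX Er).
by have := hb m; rewrite exprMn teichM teichX -mulrA mulSn.
Qed.

Lemma gbound_iter k b n : gbound b n -> gbound (t ^+ k * b) (k + n).
Proof.
by move=> hb; elim: k => [|k IHk]; rewrite ?mul1r // exprS -mulrA; apply: gboundS.
Qed.

Lemma gbound_iterE k b n : E b -> gbound (t ^+ k * b) (k + n) -> gbound b n.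
Proof.
move=> Eb; elim: k => [|k IHk]; rewrite ?mul1r // exprS -mulrA => h.
apply/IHk/gboundSE => //.
by apply: (is_subringM Er) => //; apply: (is_subringX Er).
Qed.

(** Since [[t]] cancels modulo [xi], boundedness depends on the fraction only and not on how it is
    written. *)
Lemma gbounded_rep d n : gbounded d -> E (t ^+ n * d) -> gbound (t ^+ n * d) n.
Proof.
move=> [k /(gbound_iter n) h] En; apply: (gbound_iterE (k := k)) => //.
by rewrite mulrCA addnC.
Qed.

(** The [p]-th power of [[(b * c) ^ k] * G] contains [G ^ p], hence a factor [G] for each of [b] and
    [c]; a [p]-th root is then taken modulo [xi]. *)
Lemma gboundM b c m n : gbound b m -> gbound c n -> gbound (b * c) (m + n).
Proof.
move=> [Eb hb] [Ec hc]; split=> [|k]; first exact: (is_subringM Er).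
have Etc x j : E x -> WE (teich (x ^+ j)) by move=> Ex; apply/WEt/(is_subringX Er).
have Ett j : WE (teich t ^+ j) by apply/WEX/WEt.
apply: (@in_ideal_rootX 1).
  by apply: WEM => //; apply/Etc/(is_subringM Er).
have [q eq] : exists q, (p = q.+2)%N by exists p.-2; case: (p) p_pr => [|[]].
rewrite expn1 exprMn -(teichX _ ((b * c) ^+ k) p) -exprM exprMn teichM.
have GX n' : n' = q.+2 -> G ^+ n' = G * G * G ^+ q by move=> ->; rewrite !exprS mulrA.
rewrite (GX _ eq).
have -> : ((m + n) * k * p = m * (k * p) + n * (k * p))%N by ring.
rewrite exprD [X in in_ideal _ X](_ : _ = (teich (b ^+ (k * p)) * G) * (teich (c ^+ (k * p)) * G) * G ^+ q).
  by apply: in_idealMr; [exact: (WEX _ EG) | apply: in_idealM].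
ring.
Qed.

Lemma gbound_root b n : E b -> gbound (b ^+ p) (n * p) -> gbound b n.
Proof.
move=> Eb [_ hb]; split=> // m.
have Etc x j : E x -> WE (teich (x ^+ j)) by move=> Ex; apply/WEt/(is_subringX Er).
apply: (@in_ideal_rootX 1); first by apply: WEM => //; apply: Etc.
have [q eq] : exists q, (p = q.+1)%N by exists p.-1; case: (p) p_pr.
rewrite expn1 exprMn -(teichX _ (b ^+ m) p) -exprM.
have GX n' : n' = q.+1 -> G ^+ n' = G * G ^+ q by move=> ->; rewrite exprS.
rewrite (GX _ eq) mulrA (mulnC m p) mulnAC; have := hb m; rewrite -exprM => hbm.
by apply: in_idealMr => //; apply: (WEX _ EG).
Qed.

Lemma gbound0 b : E b -> gbound b 0.
Proof.
move=> Eb; split=> // m; rewrite mul0n expr0 -[X in in_ideal _ X]mul1r.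
by apply: in_ideal_self; apply: WEM => //; apply/WEt/(is_subringX Er).
Qed.

(** Teichmueller representatives are not additive, but [[b + c]] is congruent modulo [p ^ k.+1] to
    the [p ^ k]-th power of [[b1] + [c1]], where [b1] and [c1] are [p ^ k]-th roots. Each term of
    the binomial expansion is bounded as a product, through its [p ^ k]-th power. *)
Lemma gboundD b c n : gbound b n -> gbound c n -> gbound (b + c) n.
Proof.
move=> hb hc; have [[Eb hb'] [Ec hc']] := conj hb hc.
split=> [|m]; first exact: (is_subringD Er).
have Ett j : WE (teich t ^+ j) by apply/WEX/WEt.
(* Large enough for the error [p ^ k.+1] to be absorbed by [[t] ^ (n * m)], and positive so that
   [G ^ (p ^ k)] has two factors [G]. *)
pose k := (n * m).+1.
have [b1 eb] := perfect_root k b; have [c1 ec] := perfect_root k c.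
have Eb1 : E b1 by apply: (@perfect_subring_root k); rewrite eb.
have Ec1 : E c1 by apply: (@perfect_subring_root k); rewrite ec.
pose u := teich b1 + teich c1.
have Eu : WE u by apply: WED; apply: WEt.
have Ebc : WE (teich (b1 + c1)) by apply/WEt/(is_subringD Er).
have cu : congr_mod WE p (teich (b1 + c1)) u.
  split=> //; have [y Ey ey] := witt_digit Ep Eu.
  exists (- y); first by apply: (is_subringN WEr).
  have eu0 : u 0%N = b1 + c1 by rewrite /u wcoord0D.
  by rewrite mulNrn {1}ey eu0 opprD addrA subrr add0r.
have [_ _ [z Ez ez]] := ring_relX (congr_mod_ring_rel WEr _) m (congr_mod_exp WEr k cu).
have -> : teich ((b + c) ^+ m) = u ^+ (p ^ k) ^+ m + z *+ p ^ k.+1.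
  by rewrite -ez subrKC -!teichX char_expnD // eb ec.
rewrite mulrDl; apply: in_idealD; last first.
  apply: (@in_ideal_le _ k.+1); first by rewrite /k -addn2 leq_addr.
  by apply: in_idealMr => //; apply: in_ideal_pX.
rewrite -exprM exprDn mulr_suml.
apply: (big_ind (in_ideal _)) => [|x y|i _]; [exact: in_ideal0 | exact: in_idealD |].
rewrite mulrnAl; apply: in_idealMn.
have Eti x j : E x -> WE (teich x ^+ j) by move=> Ex; apply/WEX/WEt.
apply: (@in_ideal_rootX k); first by apply: WEM => //; apply: WEM; apply: Eti.
set j := (_ - _)%N; have ej : (p ^ k * m = j + i)%N by rewrite subnK // -ltnS.
have [q eq] : exists q, (p ^ k = q.+2)%N.
  exists (p ^ k).-2; have : (1 < p ^ k)%N by rewrite -{1}(exp1n k) ltn_exp2r // prime_gt1.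
  by case: (p ^ k)%N => [|[]].
rewrite !exprMn [teich b1 ^+ _ ^+ _]exprAC [teich c1 ^+ _ ^+ _]exprAC.
rewrite -(teichX _ b1) -(teichX _ c1) eb ec -(teichX _ b) -(teichX _ c).
have GX n' : n' = q.+2 -> G ^+ n' = G * G * G ^+ q by move=> ->; rewrite !exprS mulrA.
rewrite (GX _ eq).
have -> : (n * m * p ^ k = n * j + n * i)%N by rewrite -mulnDr -ej; ring.
rewrite exprD [X in in_ideal _ X](_ : _ = (teich (b ^+ j) * G) * (teich (c ^+ i) * G) * G ^+ q).
  by apply: in_idealMr; [exact: (WEX _ EG) | apply: in_idealM].
ring.
Qed.

Lemma gbounded_subset x : E x -> gbounded x.
Proof. by move=> Ex; exists 0%N; rewrite mul1r; apply: gbound0. Qed.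

(** A perfect ring is thus bounded by [G] as soon as its generators are, although the exponents of
    the denominators need not be uniform. *)
Lemma gbounded_perfect_subring : perfect_subring p gbounded.
Proof.
have EM x y : gbounded x -> gbounded y -> gbounded (x * y).
  move=> [m hx] [n hy]; exists (m + n)%N; rewrite exprD mulrACA; exact: gboundM.
have E1 : gbounded 1 by apply: gbounded_subset; apply: (is_subring1 Er).
have EN1 : gbounded (-1).
  by apply: gbounded_subset; apply: (is_subringN Er); apply: (is_subring1 Er).
split.
  split=> [//|x x' y y' [-> hx] [-> hy]|x x' [-> hx]|x x' y y' [-> hx] [-> hy]].
  - split=> //; case: hx => m hx; case: hy => n hy; exists (m + n)%N.
    rewrite mulrDr; apply: gboundD; last by rewrite exprD -mulrA; apply: gbound_iter.
    by rewrite addnC exprD -mulrA; apply: gbound_iter.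
  - by split=> //; rewrite -mulN1r; apply: EM.
  - by split=> //; apply: EM.
move=> x [n hx]; exists n.
have hx' : gbound ((t ^+ n * x) ^+ p) (n * p).
  rewrite exprMn -exprM; have := gbound_iter (n * p - n) hx.
  by rewrite mulrA -exprD subnK // leq_pmulr.
apply: gbound_root => //; apply: Eroot; exact: (proj1 hx').
Qed.

(** As the numerator of [d] over [t ^ n], the element [x] satisfies a bound of order [n], and this
    for every [n]. *)
Lemma gbounded_dvd x : (forall n, exists2 d, gbounded d & x = t ^+ n * d) -> E x ->
  xi_dvd (teich x * G).
Proof.
move=> h Ex; apply: in_ideal_closed => n; have [d gd ex] := h n.
have := gbounded_rep (n := n) gd; rewrite -ex => /(_ Ex)[_ /(_ 1%N)].
by rewrite muln1 expr1.
Qed.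

Let Gp := gbounded_perfect_subring.
Let Gr := proj1 Gp.

(** Passes from Teichmueller elements to Witt vectors: each further digit of [X] brings a factor
    [p], that is [[t]] modulo [xi], so that [k] digits suffice. *)
Lemma gbound_expand c k n X : E c ->
  (forall y, gbound y n -> in_ideal (teich t ^+ k) (teich (c * y) * G)) ->
  witt_over gbounded X -> WE (teich t ^+ n * X) ->
  in_ideal (teich t ^+ k) (teich c * (teich t ^+ n * X) * G).
Proof.
move=> Ec h.
suff H m : forall X : W, (m <= k)%N -> witt_over gbounded X -> WE (teich t ^+ n * X) ->
    in_ideal (teich t ^+ m) (teich c * (teich t ^+ n * X) * G) by exact: H.
elim: m => [|m IHm] {}X lemk GX EX.
  rewrite expr0 -[X in in_ideal _ X]mul1r; apply: in_ideal_self.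
  by apply: WEM => //; apply: WEM => //; apply: WEt.
have [Y GY eX] := witt_digit Gp GX.
have e0 : (teich t ^+ n * X) 0%N = t ^+ n * X 0%N by rewrite wcoord0M wcoord0X.
have E0 : E (t ^+ n * X 0%N) by rewrite -e0; apply: EX.
have e1 : teich t ^+ n * X = teich (t ^+ n * X 0%N) + (teich t ^+ n * Y) *+ p.
  by rewrite {1}eX mulrDr teichM teichX mulrnAr.
have EY : WE (teich t ^+ n * Y).
  apply: WEp; have := WEB EX (WEt E0).
  by rewrite {1}e1 [X in X - _]addrC addrK.
rewrite e1 mulrDr mulrDl mulrnAr mulrnAl -teichM; apply: in_idealD.
  by apply: in_ideal_le lemk _; apply: h; apply: gbounded_rep.
by apply: in_ideal_p; apply: IHm => //; apply: ltnW.
Qed.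

(* [X / xi] is computed digit by digit; the first digit of [X] is divisible by
   [p] modulo [xi] after multiplication by [G], hence by [t] *)
Lemma gbounded_quotient n X eta : xi * eta = X -> witt_over gbounded X ->
  (exists2 m, WE (teich t ^+ m * X) & xi_dvd (teich t ^+ m * X * G)) ->
  gbounded (eta n).
Proof.
have tdiv X' m : witt_over gbounded X' -> WE (teich t ^+ m * X') ->
    xi_dvd (teich t ^+ m * X' * G) -> gbounded (X' 0%N / t).
  move=> GX EX dX; have [Y GY eX] := witt_digit Gp GX.
  set b := t ^+ m * X' 0%N.
  have Eb : E b.
    have e0 : (teich t ^+ m * X') 0%N = b by rewrite wcoord0M wcoord0X.
    by rewrite -e0; apply: EX.
  have e1 : teich t ^+ m * X' = teich b + (teich t ^+ m * Y) *+ p.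
    by rewrite {1}eX mulrDr teichM teichX mulrnAr.
  have EY : WE (teich t ^+ m * Y).
    by apply: WEp; have := WEB EX (WEt Eb); rewrite {1}e1 [X in X - _]addrC addrK.
  have Ebl l : E (b ^+ l) by apply: (is_subringX Er).
  (* Each factor [b] gains the exponent [m.+1]: [[b]] is [[t] ^ m * X'], whose product with [G]
     vanishes modulo [xi], minus [p * [t] ^ m * Y], where [p] accounts for one and the bounded
     digits of [Y] for the other [m]. *)
  have H l : forall c n', gbound c n' ->
      in_ideal (teich t ^+ (m.+1 * l + n')) (teich (b ^+ l * c) * G).
    elim: l => [|l IHl] c n' gc.
      have := proj2 gc 1%N; by rewrite muln0 add0n muln1 expr1 mul1r.
    have Ec : E (b ^+ l * c) by apply: (is_subringM Er) => //; case: gc.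
    have -> : teich (b ^+ l.+1 * c) * G = teich (b ^+ l * c) * (teich t ^+ m * X' * G)
        - (teich (b ^+ l * c) * (teich t ^+ m * Y) * G) *+ p.
      have -> : teich (b ^+ l.+1 * c) = teich (b ^+ l * c) * teich b.
        by rewrite -teichM exprSr mulrAC.
      by rewrite e1; ring.
    rewrite -mulNrn; apply: in_idealD.
      apply: in_ideal_xi; rewrite mulrC; apply: xi_dvdMr => //.
      exact: WEt.
    have -> : (m.+1 * l.+1 + n' = (m.+1 * l + (n' + m)).+1)%N by ring.
    apply: in_ideal_p; rewrite -mulrN1; apply: in_idealMr.
      by apply: (is_subringN WEr); apply: (is_subring1 WEr).
    apply: gbound_expand => // y gy.
    by rewrite -mulrA; apply: IHl; apply: gboundM.
  exists m.+1; have -> : t ^+ m.+1 * (X' 0%N / t) = b.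
    by rewrite exprSr -mulrA [t * _]mulrC divfK.
  split=> // l; have := H l 1 0%N (gbound0 (is_subring1 Er)).
  by rewrite addn0 mulr1.
have quo0 X' eta' m : xi * eta' = X' -> witt_over gbounded X' ->
    WE (teich t ^+ m * X') -> xi_dvd (teich t ^+ m * X' * G) -> gbounded (eta' 0%N).
  move=> eX GX EX dX.
  have -> : eta' 0%N = - (w' 0%N * (X' 0%N / t)).
    rewrite -eX xiE wcoord0B witt_mulp_coord0 // sub0r !wcoord0M /=.
    by rewrite mulNr mulrN opprK mulrAC mulfV // mul1r mulrA [_ * w 0%N]mulrC w00 mul1r.
  apply: (is_subringN Gr); apply: (is_subringM Gr); last exact: tdiv EX dX.
  exact: gbounded_subset.
elim: n X eta => [|n IHn] X eta eX GX [m EX dX]; first exact: quo0 eX GX EX dX.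
have g0 := quo0 _ _ _ eX GX EX dX.
have [y ey] : exists y, eta - teich (eta 0%N) = y *+ p.
  by apply: perfect_mulp; rewrite wcoord0B subrr.
have eeta : eta = teich (eta 0%N) + y *+ p by rewrite -ey subrKC.
have -> : eta n.+1 = y n ^+ p.
  by rewrite eeta witt_mulp // teich_verschiebungE.
apply: (is_subringX Gr); have [k [Ek _]] := g0.
(* Removing the first digit of the quotient and dividing by [p] leaves the same problem for
   [xi * y], with the denominators [k] of that digit and [m] of [X] combined. *)
have e1 : (xi * y) *+ p = X - xi * teich (eta 0%N).
  by rewrite -eX -mulrBr ey mulrnAr.
have Ett j : WE (teich t ^+ j) by apply/WEX/WEt.
have e2 : (teich t ^+ (k + m) * (xi * y)) *+ p = teich t ^+ k * (teich t ^+ m * X)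
    - xi * (teich t ^+ m * teich (t ^+ k * eta 0%N)).
  by rewrite -mulrnAr e1 exprD teichM teichX; ring.
have Exy : WE (teich t ^+ (k + m) * (xi * y)).
  apply: WEp; rewrite e2; apply: WEB; first exact: WEM.
  by apply: WEM; [exact: WE_xi | apply: WEM => //; apply: WEt].
apply: (IHn (xi * y)) => //.
  apply: (witt_over_mulp Gp); rewrite e1; have WGr := witt_over_subring p_pr Gr.
  apply: (is_subringB WGr) => //; apply: (is_subringM WGr).
    by move=> i; apply: gbounded_subset; apply: WE_xi.
  exact: (witt_over_teich Gr).
exists (k + m)%N => //; apply: p_cancel; first exact: WEM.
rewrite -mulrnAl e2 mulrBl; apply: xi_dvdD.
  by rewrite -mulrA mulrC; apply: xi_dvdMr.
rewrite -mulNr -mulrN -mulrA; exists (- (teich t ^+ m * teich (t ^+ k * eta 0%N)) * G) => //.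
apply: WEM => //; apply: (is_subringN WEr); apply: WEM => //; exact: WEt.
Qed.

End Bounded.

(** * The generic quotient by [xi] *)

Section Envelope.
Variables (F : W) (EF : WE F).
Hypothesis Eunit : forall e, E e -> exists2 e', E e' & (1 + t * e) * e' = 1.

Definition Eloc (x : L) := exists n, E (t ^+ n * x).

(** So [E[1/t]] inherits its ring structure and its stability under division by [xi] from the
    bounded fractions. *)
Lemma gbounded0 x : gbounded 0 x <-> Eloc x.
Proof.
split=> [[n [En _]]|[n En]]; exists n => //; split=> // m.
by rewrite mulr0; apply: in_ideal0.
Qed.

Lemma Eloc_subring : is_subring Eloc.
Proof.
have -> : Eloc = gbounded 0 by apply/funext => x; apply/propext; rewrite gbounded0.
exact: proj1 (gbounded_perfect_subring WE0).
Qed.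

Lemma subset_Eloc x : E x -> Eloc x.
Proof. by move=> Ex; exists 0%N; rewrite mul1r. Qed.

Lemma Eloc_bound n (c : nat -> L) : (forall i, Eloc (c i)) ->
  exists m, forall i, (i < n)%N -> E (t ^+ m * c i).
Proof.
move=> hc; elim: n => [|n [m hm]]; first by exists 0%N.
have [k hk] := hc n; exists (m + k)%N => i.
rewrite ltnS leq_eqVlt => /orP[/eqP->|/hm hi].
  rewrite exprD -mulrA; apply: (is_subringM Er) => //; exact: (is_subringX Er).
rewrite addnC exprD -mulrA; apply: (is_subringM Er) => //; exact: (is_subringX Er).
Qed.

Definition zeta : W := projT1 (cid (xi_solve 1)).

Lemma xi_zeta : xi * zeta = 1.
Proof. by rewrite /zeta; case: cid. Qed.

Lemma zeta_loc n : Eloc (zeta n).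
Proof.
apply/gbounded0; apply: (gbounded_quotient WE0 n xi_zeta).
  move=> i; apply: (gbounded_subset WE0).
  by case: i => [|i]; [apply: (is_subring1 Er) | apply: (is_subring0 Er)].
exists 0%N; first by rewrite mul1r; apply: (is_subring1 WEr).
by exists 0 => //; rewrite !mulr0.
Qed.

(** Iterates [[t] * zeta = - w' + p * w' * zeta], a form of [xi * zeta = 1]. It isolates coordinate
    [i], which modulo [t] comes from the first term alone. *)
Lemma zeta_expand i : exists2 y, WE y &
  teich t ^+ i.+1 * zeta = (- w' ^+ i.+1) *+ p ^ i + teich t * y + (w' ^+ i.+1 * zeta) *+ p ^ i.+1.
Proof.
have e1 : teich t * zeta = - w' + (w' * zeta) *+ p.
  have := xiE zeta; rewrite xi_zeta => e.
  rewrite -[teich t * zeta]mul1r -ww' (_ : w * w' * _ = w' * (teich t * (w * zeta))); last by ring.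
  have -> : teich t * (w * zeta) = zeta *+ p - 1 by rewrite e opprB addrC subrK.
  by ring.
elim: i => [|i [y Ey e]].
  by exists 0 => //; rewrite expr1 e1 mulr0 addr0 expn0 mulr1n expr1 expn1.
exists ((- w' ^+ i.+1) *+ p ^ i + teich t * y).
  apply: WED; last by apply: WEM => //; apply: WEt.
  by apply: (is_subringMn WEr); apply: (is_subringN WEr); apply: WEX.
have e3 : teich t * ((w' ^+ i.+1 * zeta) *+ p ^ i.+1) =
    (- w' ^+ i.+2) *+ p ^ i.+1 + (w' ^+ i.+2 * zeta) *+ p ^ i.+2.
  rewrite mulrnAr mulrCA e1 mulrDr mulrnDl mulrN -exprSr mulrnAr mulrA -exprSr.
  by rewrite -mulrnA -expnS.
by rewrite exprS -mulrA e mulrDr e3 addrCA addrA.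
Qed.

Lemma Eunit_mul a b e : E a -> E b -> a * b = 1 -> E e ->
  exists2 c, E c & (a + t * e) * c = 1.
Proof.
move=> Ea Eb ab Ee; have [c Ec ec] := Eunit (is_subringM Er Ee Eb).
exists (b * c); first exact: (is_subringM Er).
by rewrite -ec -[in RHS]ab; ring.
Qed.

Lemma witt_mulpn_coord (x : W) n : (x *+ p ^ n) n = x 0%N ^+ (p ^ n).
Proof.
elim: n x => [|n IHn] x; first by rewrite expn0 expr1.
by rewrite expnSr mulrnA witt_mulp_coord // IHn -exprM.
Qed.

(** Up to a power of [t], the coordinate [zeta i] is congruent modulo [t] to a power of the first
    coordinate of [- w' ^ i.+1], a unit of [E]; by [Eunit] it is then a unit as well. It will be the
    top coefficient of [kappa i]. *)
Lemma zeta_inv i : exists2 c, Eloc c & zeta i * c = 1.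
Proof.
have [y Ey e] := zeta_expand i.
have e1 : t ^+ (i.+1 * p ^ i) * zeta i = ((- w' ^+ i.+1) *+ p ^ i + teich t * y) i.
  have <- : (teich t ^+ i.+1 * zeta) i = t ^+ (i.+1 * p ^ i) * zeta i.
    by rewrite -teichX teichmullerM -exprM.
  by rewrite e wcoordD_mulp.
have rr := witt_ring_rel p_pr (congr_ring_rel t Er).
have [_ rD _ rM] := rr.
pose r (x z : W) := forall n, [/\ E (x n), E (z n) & exists2 e, E e & x n - z n = t * e].
have r_refl x : WE x -> r x x.
  move=> Ex n; split; [exact: Ex | exact: Ex | exists 0; [exact: (is_subring0 Er) |]].
  by rewrite mulr0 subrr.
have rt : r (teich t) 0.
  move=> [|n]; split; try exact: (is_subring0 Er); try exact: Et.
    by exists 1; [exact: (is_subring1 Er) | rewrite subr0 mulr1].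
  by exists 0; [exact: (is_subring0 Er) | rewrite subrr mulr0].
have Epw : WE ((- w' ^+ i.+1) *+ p ^ i).
  by apply: (is_subringMn WEr); apply: (is_subringN WEr); apply: WEX.
have /(_ i) := rD _ _ _ _ (r_refl _ Epw) (rM _ _ _ _ rt (r_refl _ Ey)).
rewrite mul0r addr0 -e1 witt_mulpn_coord wcoord0N wcoord0X => -[_ Ea [e2 Ee2 ee]].
set a := (- w' 0%N ^+ i.+1) ^+ (p ^ i) in Ea ee.
set b := (- w 0%N ^+ i.+1) ^+ (p ^ i).
have Eb : E b.
  by apply: (is_subringX Er); apply: (is_subringN Er); apply: (is_subringX Er); apply: Ew.
have ab : a * b = 1 by rewrite /a -exprMn mulrNN -exprMn mulrC w00 !expr1n.
have [c Ec ec] := Eunit_mul Ea Eb ab Ee2.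
exists (t ^+ (i.+1 * p ^ i) * c).
  apply: subset_Eloc; apply: (is_subringM Er) => //; exact: (is_subringX Er).
by rewrite mulrCA mulrA -ec -ee subrKC.
Qed.

Local Notation PL := {poly L}.
Local Notation WP := (wittring p_pr PL).
Local Notation constW := (@witt_map p p_pr _ _ (@polyC L)).
Local Notation teichP := (@teichmuller p p_pr PL).

Lemma chP : p%:R = 0 :> PL.
Proof. by rewrite -(rmorph_nat (@polyC L)) chL rmorph0. Qed.

(** Placing the variable in a Teichmueller representative makes coordinate [i] a polynomial of
    degree [p ^ i]. *)
Definition kappa : WP := constW zeta * (teichP 'X - constW F).

Lemma xi_kappa : constW xi * kappa = teichP 'X - constW F.
Proof. by rewrite /kappa mulrA -witt_mapM xi_zeta witt_map1 mul1r. Qed.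

Lemma constW_xiE (x : WP) :
  constW xi * x = x *+ p - teichP t%:P * (constW w * x).
Proof.
by rewrite xi_def witt_mapB witt_mapM witt_map_nat witt_map_teichmuller mulrBl mulr_natl mulrA.
Qed.

Lemma kappaX : 'X = (F 0%N)%:P - (t * w 0%N) *: kappa 0%N.
Proof.
have := congr1 (fun x : WP => x 0%N) xi_kappa.
rewrite constW_xiE !wcoord0B witt_mulp_coord0 ?chP // sub0r !wcoord0M /=.
rewrite mulrA -polyCM mul_polyC /witt_map => ->; by rewrite addrC subrK.
Qed.

Definition kappa0 : W := @witt_map p p_pr _ _ (horner_eval 0) kappa.

Lemma kappa0E n : kappa0 n = (kappa n).[0].
Proof. by []. Qed.

Lemma witt_map_const0 (x : W) : @witt_map p p_pr _ _ (horner_eval 0) (constW x) = x.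
Proof. by apply/funext => n; rewrite /witt_map /horner_eval hornerC. Qed.

Lemma xi_kappa0 : xi * kappa0 = - F.
Proof.
have := congr1 (@witt_map p p_pr _ _ (horner_eval 0)) xi_kappa.
rewrite witt_mapM witt_mapB !witt_map_const0 => ->.
have -> : @witt_map p p_pr _ _ (horner_eval 0) (teichP 'X) = 0 :> W.
  by apply/funext => -[|n]; rewrite /witt_map /horner_eval /= ?hornerX ?horner0.
by rewrite sub0r.
Qed.

(** Homogenization: multiplication by [[s]] puts [s ^ (p ^ n)] in front of coordinate [n], so that
    [top_rel] reads off the top coefficients. It relates [[s] * [X]] to [[X]], and [[s] * F] to [0],
    since the coordinates of [F] are constant in [X] but get positive weight. *)
Lemma kappa_top n : (size (kappa n) <= (p ^ n).+1)%N /\ (kappa n)`_(p ^ n) = zeta n.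
Proof.
pose PPL := {poly PL}; pose cP := @witt_map p p_pr _ _ (@polyC PL).
pose s : wittring p_pr PPL := teichmuller p_pr 'X.
have rr := witt_ring_rel p_pr (top_rel_ring L).
have [_ rD rN rM] := rr.
pose r (x : wittring p_pr PPL) (y : WP) := forall n, top_rel (x n) (y n).
have rz : r (cP (constW zeta)) (constW zeta).
  move=> i d; rewrite /cP /witt_map !coefC; case: d => [|d] /=.
    by rewrite size_polyC coefC; case: (_ != 0).
  by rewrite size_poly0 coef0.
have rX : r (s * cP (teichP 'X)) (teichP 'X).
  rewrite /cP witt_map_teichmuller /s -teichM => -[|i] d /=; last by rewrite !coef0 size_poly0.
  rewrite coefMC coefX; case: d => [|[|d]] /=; rewrite ?mul0r ?mul1r ?size_poly0 ?coefX ?coef0 //.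
  by rewrite size_polyX.
have rF : r (s * cP (constW F)) 0.
  move=> i d; rewrite /s teichmullerM /= /cP /witt_map coefMC coefXn coef0.
  have p0n : (0 < p ^ i)%N by rewrite expn_gt0 p0.
  case: eqP => [->|_]; last by rewrite mul0r size_poly0 coef0.
  by rewrite mul1r coefC gtn_eqF // size_polyC; case: (_ != 0).
have rk : r (s * cP kappa) (constW zeta * teichP 'X).
  have -> : s * cP kappa = cP (constW zeta) * (s * cP (teichP 'X) - s * cP (constW F)).
    by rewrite /kappa /cP witt_mapM witt_mapB; ring.
  rewrite -[X in constW zeta * X]addr0; apply: rM => //; apply: rD => //.
  by rewrite -oppr0; apply: rN.
have := rk n (p ^ n)%N.
rewrite [constW zeta * _]mulrC /s !teichmullerM /cP /witt_map !coefMC !coefXn eqxx.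
by rewrite !mul1r.
Qed.

(** * Polynomials in the coordinates of [kappa], filtered by weight *)

Definition poly_over (S : set L) : set PL := [set P | forall i, S P`_i].

Lemma poly_over_subring S : is_subring S -> is_subring (poly_over S).
Proof.
move=> Sr; have [S1 SD SN SM] := And4 (is_subring1 Sr) (is_subringD Sr) (is_subringN Sr) (is_subringM Sr).
have S0 := is_subring0 Sr.
split=> [|P P' Q Q' [-> hP] [-> hQ]|P P' [-> hP]|P P' Q Q' [-> hP] [-> hQ]];
  split=> // i.
- by rewrite coef1; case: (i == 0%N).
- by rewrite coefD; apply: SD.
- by rewrite coefN; apply: SN.
- by rewrite coefM; apply: (is_subring_sum Sr) => j _; apply: SM.
Qed.

Lemma poly_overC (S : set L) c : S 0 -> S c -> poly_over S c%:P.
Proof. by move=> S0 Sc i; rewrite coefC; case: (i == 0%N). Qed.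

Lemma kappa_loc n : poly_over Eloc (kappa n).
Proof.
have Pr := poly_over_subring Eloc_subring; have WPr := witt_over_subring p_pr Pr.
have E0 := is_subring0 Eloc_subring.
suff : @witt_over p p_pr PL (poly_over Eloc) kappa by [].
apply: (is_subringM WPr) => [i|].
  by apply: poly_overC => //; apply: zeta_loc.
apply: (is_subringB WPr) => [[|i]|i].
- by move=> i; rewrite /= coefX; case: (i == 1%N) => //; apply: (is_subring1 Eloc_subring).
- by move=> j; rewrite coef0.
by apply: poly_overC => //; apply/subset_Eloc/EF.
Qed.

(* The [E]-span of the monomials in [kappa] of weight at most [d], where
   [kappa i] has weight [p ^ i] *)
Inductive filt : nat -> PL -> Prop :=
| filtC d c : E c -> filt d c%:P
| filtD d P Q : filt d P -> filt d Q -> filt d (P + Q)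
| filtM_kappa d d' i P : (d + p ^ i <= d')%N -> filt d P -> filt d' (kappa i * P).

Lemma filt_le d d' P : (d <= d')%N -> filt d P -> filt d' P.
Proof.
move=> led h; elim: h d' led => {d P} [d c Ec|d P Q _ IHP _ IHQ|d e i P le1 hP _] d' led.
- exact: filtC.
- by apply: filtD; [apply: IHP | apply: IHQ].
- exact: (filtM_kappa (leq_trans le1 led)).
Qed.

Lemma filtMC d c P : E c -> filt d P -> filt d (c%:P * P).
Proof.
move=> Ec; elim => {d P} [d b Eb|d P Q _ IHP _ IHQ|d d' i P le1 _ IH].
- by rewrite -polyCM; apply/filtC/(is_subringM Er).
- by rewrite mulrDr; apply: filtD.
- by rewrite mulrCA; apply: filtM_kappa le1 IH.
Qed.

Lemma filtM a b P Q : filt a P -> filt b Q -> filt (a + b) (P * Q).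
Proof.
move=> hP hQ; elim: hP => {a P} [a c Ec|a P P' _ IHP _ IHP'|a a' i P le1 _ IH].
- by apply: filtMC => //; apply: filt_le hQ; rewrite leq_addl.
- by rewrite mulrDl; apply: filtD.
- by rewrite -mulrA; apply: filtM_kappa IH; rewrite addnAC leq_add2r.
Qed.

Lemma filtN d P : filt d P -> filt d (- P).
Proof.
move=> h; rewrite -mulN1r -(rmorphN1 (@polyC L)).
by apply: filtMC => //; apply: (is_subringN Er); apply: (is_subring1 Er).
Qed.

Lemma filtB d P Q : filt d P -> filt d Q -> filt d (P - Q).
Proof. by move=> hP /filtN; apply: filtD. Qed.

Lemma filt0 d : filt d 0.
Proof. by rewrite -polyC0; apply/filtC/(is_subring0 Er). Qed.

Lemma filt_sum d (I : Type) (s : seq I) (C : pred I) (P : I -> PL) :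
  (forall i, C i -> filt d (P i)) -> filt d (\sum_(i <- s | C i) P i).
Proof.
by move=> h; apply: (big_ind (filt d)); [exact: filt0 | exact: filtD | exact: h].
Qed.

Lemma filt_kappa i : filt (p ^ i) (kappa i).
Proof.
rewrite -[kappa i]mulr1 -polyC1; apply: (@filtM_kappa 0) => //.
exact/filtC/(is_subring1 Er).
Qed.

(** Recording the weight by an outer variable turns the filtration into a ring, over which Witt
    vectors can be formed. *)
Definition rees : set {poly PL} := [set P | forall d, filt d P`_d].

Lemma rees_subring : is_subring rees.
Proof.
split=> [|P P' Q Q' [-> hP] [-> hQ]|P P' [-> hP]|P P' Q Q' [-> hP] [-> hQ]];
  split=> // d.
- rewrite coef1; case: d => [|d]; last exact: filt0.
  by rewrite -polyC1; apply/filtC/(is_subring1 Er).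
- by rewrite coefD; apply: filtD.
- by rewrite coefN; apply: filtN.
- rewrite coefM; apply: filt_sum => j _.
  have lejd : (j <= d)%N by rewrite -ltnS.
  by have := filtM (hP j) (hQ (d - j)%N); rewrite subnKC.
Qed.

(* The coordinates of [p * kappa = [X] - F + [t] * w * kappa], computed modulo
   [t] in the Rees algebra *)
Lemma kappaXp i : exists c R, [/\ E c, filt (p ^ i.+1) R & kappa i ^+ p = c%:P + t%:P * R].
Proof.
pose PPL := {poly PL}; pose cP := @witt_map p p_pr _ _ (@polyC PL).
pose WPP := wittring p_pr PPL.
pose s : WPP := teichmuller p_pr 'X.
have chPP : p%:R = 0 :> PPL by rewrite -(rmorph_nat (@polyC PL)) chP rmorph0.
have Rr := rees_subring.
have RC c : E c -> rees c%:P%:P.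
  move=> Ec [|d]; rewrite coefC /=; [exact: filtC | exact: filt0].
have RXn d P : filt d P -> rees ('X^d * P%:P).
  move=> hP e; rewrite coefMC coefXn.
  by case: eqP => [->|_]; rewrite ?mul1r // mul0r; apply: filt0.
have R0 := is_subring0 Rr.
have tr := congr_ring_rel t%:P%:P Rr.
have [_ rD rN rM] := witt_ring_rel p_pr tr.
pose r (x y : WPP) := forall n, [/\ rees (x n), rees (y n) & exists2 e, rees e & x n - y n = t%:P%:P * e].
have r_refl x : witt_over rees x -> r x x.
  by move=> Rx n; split=> //; exists 0 => //; rewrite subrr mulr0.
have e1 : (s * cP kappa) *+ p = s * teichmuller p_pr 'X%:P - s * cP (constW F)
    + teichmuller p_pr t%:P%:P * (cP (constW w) * (s * cP kappa)).
  have -> : teichmuller p_pr 'X%:P = cP (teichP 'X) by rewrite /cP witt_map_teichmuller.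
  have -> : teichmuller p_pr t%:P%:P = cP (teichP t%:P) by rewrite /cP witt_map_teichmuller.
  rewrite /cP -mulrBr -witt_mapB -xi_kappa constW_xiE witt_mapB witt_mapMn.
  by rewrite [witt_map _ (teichP _ * _)]witt_mapM [witt_map _ (constW w * _)]witt_mapM; ring.
have rsk : witt_over rees (s * cP kappa).
  by move=> j; rewrite /s teichmullerM; apply: RXn; apply: filt_kappa.
have rsF : witt_over rees (s * cP (constW F)).
  by move=> j; rewrite /s teichmullerM; apply: RXn; apply/filtC/EF.
have rw : witt_over rees (cP (constW w)) by move=> j; apply/RC/Ew.
have rt : r (teichmuller p_pr t%:P%:P) 0.
  move=> [|j]; last by split=> //; exists 0 => //; rewrite mulr0 subrr.
  split=> //; first exact: RC.
  by exists 1; [exact: (is_subring1 Rr) | rewrite subr0 mulr1].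
(* By [kappaX] the variable is congruent to [F 0] modulo [t], with a quotient of weight one. *)
have rX : r (s * teichmuller p_pr 'X%:P) (s * teichmuller p_pr (F 0%N)%:P%:P).
  rewrite /s -!teichM => -[|j] /=; last by split=> //; exists 0 => //; rewrite mulr0 subrr.
  have fX : filt 1 'X.
    rewrite kappaX; apply: filtB; first exact/filtC/EF.
    rewrite -mul_polyC; apply: filtMC; first by apply: (is_subringM Er) => //; apply: Ew.
    by have := filt_kappa 0; rewrite expn0.
  split; first by rewrite -[X in X * _]expr1; apply: RXn.
    by rewrite -[X in X * _]expr1; apply/RXn/filtC/EF.
  exists ('X^1 * (- (w 0%N)%:P * kappa 0%N)%:P).
    apply: RXn; rewrite mulNr; apply: filtN; apply: filtMC; first exact: Ew.
    by have := filt_kappa 0; rewrite expn0.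
  have eX : 'X = (F 0%N)%:P - t%:P * ((w 0%N)%:P * kappa 0%N) :> PL.
    by rewrite {1}kappaX -mul_polyC polyCM mulrA.
  by rewrite eX expr1 !(polyCB, polyCM, polyCN); ring.
have /(_ i.+1) := rD _ _ _ _ (rD _ _ _ _ rX (rN _ _ (r_refl _ rsF)))
   (rM _ _ _ _ rt (r_refl _ (is_subringM (witt_over_subring p_pr Rr) rw rsk))).
rewrite -e1 mul0r addr0 witt_mulp_coord // {1}/s teichmullerM => -[_ _ [Q RQ eQ]].
(* In coordinate [i.+1], where multiplication by [p] has produced a [p]-th power, the coefficient of
   the outer variable in degree [p ^ i.+1] is [kappa i ^ p]. *)
exists ((teich (F 0%N) - F) i.+1), Q`_(p ^ i.+1); split; [|exact: RQ|].
  exact: (WEB (WEt (EF 0%N)) EF).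
have eF : s * teichmuller p_pr (F 0%N)%:P%:P - s * cP (constW F) = s * cP (constW (teich (F 0%N) - F)).
  by rewrite /cP !witt_mapB !witt_map_teichmuller mulrBr.
have := congr1 (fun P : PPL => P`_(p ^ i.+1)) eQ.
rewrite coefCM eF /s teichmullerM coefB exprMn -exprM -expnSr -rmorphXn !coefMC !coefXn.
by rewrite eqxx !mul1r => <-; rewrite subrKC.
Qed.

(** The greedy choice of powers of [p] makes the exponents the base [p] digits of [d]; [k] is
    fuel. *)
Fixpoint nmon_rec (k d : nat) : PL :=
  if (k, d) is (k'.+1, _.+1) then
    kappa (trunc_log p d) * nmon_rec k' (d - p ^ trunc_log p d)
  else 1.

(* A monomial in [kappa] of weight [d] in which each [kappa i] has exponent
   less than [p] *)
Definition nmon d := nmon_rec d d.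

Lemma nmon_recE k k' d : (d <= k)%N -> (d <= k')%N -> nmon_rec k d = nmon_rec k' d.
Proof.
elim: k k' d => [|k IHk] [|k'] [|d] //= lek lek'; congr (_ * _).
have := expn_gt0 p (trunc_log p d.+1); rewrite p0 /= => h.
by apply: IHk; lia.
Qed.

Lemma nmon0 : nmon 0 = 1. Proof. by []. Qed.

Lemma nmonE d : (0 < d)%N ->
  nmon d = kappa (trunc_log p d) * nmon (d - p ^ trunc_log p d).
Proof.
case: d => [//|d] _; rewrite {1}/nmon /=; congr (_ * _).
have := expn_gt0 p (trunc_log p d.+1); rewrite p0 /= => h.
by apply: nmon_recE; lia.
Qed.

Lemma nmonD i r : (r + p ^ i < p ^ i.+1)%N -> nmon (r + p ^ i) = kappa i * nmon r.
Proof.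
move=> lti; have pi0 : (0 < p ^ i)%N by rewrite expn_gt0 p0.
have e : trunc_log p (r + p ^ i) = i.
  by apply: trunc_log_eq; rewrite ?prime_gt1 // leq_addl.
by rewrite nmonE ?e ?addnK // addn_gt0 pi0 orbT.
Qed.

Lemma nmon_iter i m r : (r + m * p ^ i < p ^ i.+1)%N ->
  nmon (r + m * p ^ i) = kappa i ^+ m * nmon r.
Proof.
elim: m => [|m IHm] h; first by rewrite mul0n addn0 mul1r.
have e : (r + m.+1 * p ^ i = r + m * p ^ i + p ^ i)%N by ring.
rewrite e nmonD -?e // IHm ?exprS ?mulrA //.
by apply: leq_ltn_trans h; rewrite e leq_addr.
Qed.

Lemma filt_nmon d : filt d (nmon d).
Proof.
elim/ltn_ind: d => -[|d] IHd; first by rewrite nmon0 -polyC1; apply/filtC/(is_subring1 Er).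
have /andP[le1 _] := trunc_log_bounds (prime_gt1 p_pr) (ltn0Sn d).
have := expn_gt0 p (trunc_log p d.+1); rewrite p0 /= => h.
rewrite nmonE //; apply: (@filtM_kappa (d.+1 - p ^ trunc_log p d.+1)); first by rewrite subnK.
by apply: IHd; lia.
Qed.

Inductive nspan (S : set L) (d : nat) : PL -> Prop :=
| nspan0 : nspan S d 0
| nspan_cons i c P : (i <= d)%N -> S c -> nspan S d P -> nspan S d (c%:P * nmon i + P).

Section Span.
Variables (S : set L) (Sr : is_subring S).

Lemma nspan_nmon d i c : (i <= d)%N -> S c -> nspan S d (c%:P * nmon i).
Proof. by move=> led Sc; rewrite -[_ * _]addr0; apply: nspan_cons => //; apply: nspan0. Qed.

Lemma nspanD d P Q : nspan S d P -> nspan S d Q -> nspan S d (P + Q).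
Proof.
move=> hP hQ; elim: hP => [|i c P' led Sc _ IH]; first by rewrite add0r.
by rewrite -addrA; apply: nspan_cons.
Qed.

Lemma nspan_le d d' P : (d <= d')%N -> nspan S d P -> nspan S d' P.
Proof.
move=> led; elim=> [|i c P' lei Sc _ IH]; first exact: nspan0.
by apply: nspan_cons => //; apply: leq_trans led.
Qed.

Lemma nspanMC d c P : S c -> nspan S d P -> nspan S d (c%:P * P).
Proof.
move=> Sc; elim=> [|i b P' lei Sb _ IH]; first by rewrite mulr0; apply: nspan0.
by rewrite mulrDr mulrA -polyCM; apply: nspan_cons => //; apply: (is_subringM Sr).
Qed.

Lemma nspan_coef d P : nspan S d P ->
  exists c : nat -> L, (forall i, S (c i)) /\ P = \sum_(i < d.+1) (c i)%:P * nmon i.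
Proof.
elim=> [|i b P' lei Sb _ [c [Sc ->]]].
  exists (fun=> 0); split=> [_|]; first exact: is_subring0.
  by rewrite big1 // => i _; rewrite mul0r.
exists (fun j => (if j == i then b else 0) + c j); split=> [j|].
  by apply: (is_subringD Sr) => //; case: eqP => // _; apply: is_subring0.
have ltid : (i < d.+1)%N by [].
under [RHS]eq_bigr do rewrite polyCD mulrDl.
rewrite big_split /=; congr (_ + _).
rewrite (bigD1 (Ordinal ltid)) //= eqxx big1 ?addr0 // => j ji.
case: eqP => [e|_]; last by rewrite mul0r.
by move: ji; rewrite -(inj_eq val_inj) /= e eqxx.
Qed.

End Span.

Definition nspan_t d P := exists Q R, [/\ nspan E d Q, filt d R & P = Q + t%:P * R].

Lemma nspan_t_span d P : nspan E d P -> nspan_t d P.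
Proof. by move=> h; exists P, 0; split=> //; [exact: filt0 | rewrite mulr0 addr0]. Qed.

Lemma nspan_tt d R : filt d R -> nspan_t d (t%:P * R).
Proof. by move=> h; exists 0, R; split=> //; [exact: nspan0 | rewrite add0r]. Qed.

Lemma nspan_tD d P Q : nspan_t d P -> nspan_t d Q -> nspan_t d (P + Q).
Proof.
move=> [P1 [P2 [h1 h2 ->]]] [Q1 [Q2 [h3 h4 ->]]].
exists (P1 + Q1), (P2 + Q2); split; [exact: nspanD | exact: filtD | by ring].
Qed.

Lemma nspan_t_le d d' P : (d <= d')%N -> nspan_t d P -> nspan_t d' P.
Proof.
move=> le [Q [R [hQ hR ->]]]; exists Q, R; split=> //; first exact: nspan_le hQ.
exact: filt_le hR.
Qed.

Lemma nspan_tMC d c P : E c -> nspan_t d P -> nspan_t d (c%:P * P).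
Proof.
move=> Ec [Q [R [hQ hR ->]]]; exists (c%:P * Q), (c%:P * R); split.
- exact: nspanMC.
- exact: filtMC.
by ring.
Qed.

Lemma nspan_t_lift i d d' P : (d + p ^ i <= d')%N ->
  (forall k, (k <= d)%N -> nspan_t (k + p ^ i) (kappa i * nmon k)) ->
  nspan_t d P -> nspan_t d' (kappa i * P).
Proof.
move=> led h [Q [R [hQ hR ->]]]; rewrite mulrDr mulrCA; apply: nspan_tD; last first.
  by apply: nspan_tt; apply: filtM_kappa led hR.
elim: hQ => [|k c Q' lek Ec _ IH]; first by rewrite mulr0; apply/nspan_t_span/nspan0.
rewrite mulrDr mulrCA; apply: nspan_tD => //; apply: nspan_tMC => //.
apply: nspan_t_le (h k lek); lia.
Qed.

(** If [d + p ^ i] is below [p ^ i.+1], the product is again some [nmon]. Otherwise either a larger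
    [kappa j] can be set aside and induction applies, or [kappa i] already has exponent [p - 1] and
    [kappaXp] rewrites its [p]-th power. *)
Lemma kappa_nmon i d : nspan_t (d + p ^ i) (kappa i * nmon d).
Proof.
have E1 := is_subring1 Er.
elim/ltn_ind: d i => d IHd i.
have [lti|lei] := ltnP (d + p ^ i) (p ^ i.+1).
  rewrite -nmonD // -[nmon _]mul1r -polyC1.
  exact/nspan_t_span/nspan_nmon.
have p1 := prime_gt1 p_pr.
have pi0 : (0 < p ^ i)%N by rewrite expn_gt0 p0.
have d0 : (0 < d)%N.
  rewrite lt0n; apply/eqP => d0; move: lei; rewrite d0 add0n leqNgt.
  by rewrite ltn_exp2l // ltnSn.
have /andP[lej ltj] := trunc_log_bounds p1 d0.
set j := trunc_log p d in lej ltj *.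
have [ltij|leji] := ltnP i j.
  have ltpij : (p ^ i < p ^ j)%N by rewrite ltn_exp2l.
  rewrite nmonE // -/j mulrCA.
  apply: (@nspan_t_lift j (d - p ^ j + p ^ i)) => [|k lek|]; first by lia.
    by apply: IHd; lia.
  by apply: IHd; lia.
have lei' : (p ^ i.+1 - p ^ i <= d)%N by lia.
have ltd : (d < p ^ i.+1)%N by apply: leq_trans ltj _; rewrite leq_exp2l.
have ep : (p ^ i.+1 = p.-1 * p ^ i + p ^ i)%N by rewrite expnS -{1}(prednK p0) mulSn addnC.
set r := (d - p.-1 * p ^ i)%N.
have er : d = (r + p.-1 * p ^ i)%N by rewrite subnK //; lia.
have [c [R [Ec hR eR]]] := kappaXp i.
have -> : kappa i * nmon d = c%:P * nmon r + t%:P * (R * nmon r).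
  rewrite er nmon_iter -?er // mulrA -exprS (prednK p0) eR; ring.
apply: nspan_tD.
  by apply/nspan_t_span/nspan_nmon => //; lia.
apply: nspan_tt; apply: (@filt_le (p ^ i.+1 + r)); first by lia.
by apply: filtM => //; apply: filt_nmon.
Qed.

Lemma filt_nspan_t d P : filt d P -> nspan_t d P.
Proof.
elim=> {d P} [d c Ec|d P Q _ IHP _ IHQ|d d' i P led _ IH].
- by rewrite -[c%:P]mulr1 -nmon0; apply/nspan_t_span/nspan_nmon.
- exact: nspan_tD.
- by apply: nspan_t_lift led _ IH => k _; apply: kappa_nmon.
Qed.

Lemma filt_nspan_tX m d P : filt d P ->
  exists Q R, [/\ nspan E d Q, filt d R & P = Q + (t ^+ m)%:P * R].
Proof.
move=> hP; elim: m => [|m [Q [R [hQ hR e]]]].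
  by exists 0, P; split=> //; [exact: nspan0 | rewrite mul1r add0r].
have [Q' [R' [hQ' hR' e']]] := filt_nspan_t hR.
exists (Q + (t ^+ m)%:P * Q'), R'; split=> //.
  by apply: nspanD => //; apply: nspanMC => //; apply: (is_subringX Er).
by rewrite e e' exprSr polyCM; ring.
Qed.

Lemma nmon_top d : (size (nmon d) <= d.+1)%N /\ exists2 c, Eloc c & (nmon d)`_d * c = 1.
Proof.
elim/ltn_ind: d => -[|d] IHd.
  rewrite nmon0 size_poly1; split=> //; exists 1; last by rewrite coef1 mul1r.
  exact: (is_subring1 Eloc_subring).
have /andP[le1 _] := trunc_log_bounds (prime_gt1 p_pr) (ltn0Sn d).
set j := trunc_log p d.+1 in le1 *.
have pj0 : (0 < p ^ j)%N by rewrite expn_gt0 p0.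
have [|sz [c Ec ec]] := IHd (d.+1 - p ^ j)%N; first by lia.
have [szk ck] := kappa_top j; have [b Eb eb] := zeta_inv j.
rewrite nmonE // -/j; have := coefM_top szk sz; rewrite subnKC // => -[-> ->].
split=> //; exists (b * c); first exact: (is_subringM Eloc_subring).
by rewrite ck mulrACA eb ec mulr1.
Qed.

Lemma poly_loc_bound P : poly_over Eloc P -> exists m, poly_over E ((t ^+ m)%:P * P).
Proof.
move=> hP; have [m hm] := Eloc_bound (size P) hP; exists m => i; rewrite coefCM.
have [lti|lei] := ltnP i (size P); first exact: hm.
by rewrite nth_default // mulr0; apply: (is_subring0 Er).
Qed.

Lemma poly_overXt m k P : poly_over E ((t ^+ m)%:P * P) -> poly_over E ((t ^+ (k + m))%:P * P).
Proof.
move=> h; rewrite exprD polyCM -mulrA; apply: (is_subringM (poly_over_subring Er)) => //.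
by apply: poly_overC; [apply: (is_subring0 Er) | apply: (is_subringX Er)].
Qed.

Lemma kappa_bound n : exists m, forall i, (i < n)%N -> poly_over E ((t ^+ m)%:P * kappa i).
Proof.
elim: n => [|n [m hm]]; first by exists 0%N.
have [k hk] := poly_loc_bound (@kappa_loc n).
exists (m + k)%N => i; rewrite ltnS leq_eqVlt => /orP[/eqP->|/hm hi].
  exact: poly_overXt.
by rewrite addnC; apply: poly_overXt.
Qed.

Lemma filt_bound n : exists m, forall d P, (d <= n)%N -> filt d P ->
  poly_over E ((t ^+ (m * d))%:P * P) /\ (size P <= d.+1)%N.
Proof.
have [m hm] := kappa_bound n.+1; exists m => d P led h.
have Pr := poly_over_subring Er.
elim: h led => {d P} [d c Ec|d P Q _ IHP _ IHQ|d d' i P le1 _ IH] led.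
- split; last by apply: leq_trans (size_polyC_leq1 _) _.
  rewrite -polyCM; apply: poly_overC; first exact: (is_subring0 Er).
  by apply: (is_subringM Er) => //; apply: (is_subringX Er).
- have [[hP sP] [hQ sQ]] := conj (IHP led) (IHQ led).
  rewrite mulrDr; split; first exact: (is_subringD Pr).
  by apply: leq_trans (size_polyD _ _) _; rewrite geq_max sP.
have pi0 : (0 < p ^ i)%N by rewrite expn_gt0 p0.
have lti : (i < n.+1)%N.
  by have := ltn_expl i (prime_gt1 p_pr); lia.
have [|hP sP] := IH; first by lia.
split; last first.
  have [sk _] := kappa_top i; have [+ _] := coefM_top sk sP.
  by move=> h; apply: leq_trans h _; lia.
have -> : (m * d' = (m * d' - (m + m * d)) + (m + m * d))%N.
  by rewrite subnK // -mulnS leq_mul2l; apply/orP; right; lia.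
apply: poly_overXt; rewrite exprD polyCM mulrACA.
by apply: (is_subringM Pr) => //; apply: hm.
Qed.

(** Successive division by the [nmon i], whose top coefficients are invertible in [E[1/t]]; [m]
    collects the denominators. *)
Lemma poly_nspan d : exists m, forall P, poly_over E P -> (size P <= d.+1)%N ->
  nspan E d ((t ^+ m)%:P * P).
Proof.
elim: d => [|d [m hm]].
  exists 0%N => P hP /size1_polyC ->; rewrite expr0 -polyCM mul1r -[_%:P]mulr1 -nmon0.
  exact: nspan_nmon.
have [sz [c [a Ea] ec]] := nmon_top d.+1.
have Pr := poly_over_subring Er.
have EC x : E x -> poly_over E x%:P by move=> Ex; apply: poly_overC => //; apply: (is_subring0 Er).
have [b hb] : exists b, poly_over E ((t ^+ b)%:P * nmon d.+1).
  by have [b hb] := filt_bound d.+1; have [] := hb _ _ (leqnn _) (filt_nmon d.+1); eexists.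
exists (m + (b + a))%N => P hP sP.
have Et' k : E (t ^+ k) by apply: (is_subringX Er).
set e := P`_d.+1 * (t ^+ a * c).
have Ee : E e by apply: (is_subringM Er).
pose P' := (t ^+ (b + a))%:P * P - e%:P * ((t ^+ b)%:P * nmon d.+1).
have hP' : poly_over E P'.
  apply: (is_subringB Pr); apply: (is_subringM Pr) => //; exact: EC.
have sP' : (size P' <= d.+1)%N.
  apply/leq_sizeP => j; rewrite leq_eqVlt => /orP[/eqP <-|ltj]; rewrite coefB !coefCM.
    have -> : e * (t ^+ b * (nmon d.+1)`_d.+1) =
        t ^+ b * t ^+ a * P`_d.+1 * ((nmon d.+1)`_d.+1 * c) by rewrite /e; ring.
    by rewrite ec mulr1 exprD subrr.
  rewrite [P`_j]nth_default; last exact: leq_trans ltj.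
  by rewrite [(nmon _)`_j]nth_default ?mulr0 ?subrr //; exact: leq_trans ltj.
have -> : (t ^+ (m + (b + a)))%:P * P = (t ^+ m)%:P * P' + (t ^+ m * (e * t ^+ b))%:P * nmon d.+1.
  by rewrite /P' exprD !polyCM; ring.
apply: nspanD; first exact: nspan_le (hm _ hP' sP').
by apply: nspan_nmon => //; exact: (is_subringM Er (Et' m) (is_subringM Er Ee (Et' b))).
Qed.

(** Finitely many reductions modulo [t] suffice: once the remainder carries enough powers of [t] to
    clear its own denominators and those of [poly_nspan], it lies in the span itself. *)
Lemma filt_nspan d P : filt d P -> nspan E d P.
Proof.
move=> hP; have [m1 h1] := filt_bound d; have [m2 h2] := poly_nspan d.
have [Q [R [hQ hR ->]]] := filt_nspan_tX (m2 + m1 * d) hP.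
apply: nspanD => //; have [hR' sR] := h1 _ _ (leqnn d) hR.
rewrite exprD polyCM -mulrA; apply: h2 => //.
by rewrite mul_polyC; apply: leq_trans (size_scale_leq _ _) sR.
Qed.

(** The [nmon i] have distinct degrees and so are independent over [L], whatever subring the
    coefficients come from. *)
Lemma nmon_const d c (a : nat -> L) :
  c%:P = \sum_(i < d.+1) (a i)%:P * nmon i -> c = a 0%N.
Proof.
elim: d => [|d IHd] e.
  move: e; rewrite big_ord1 nmon0 mulr1 => /(congr1 (fun P : PL => P`_0)).
  by rewrite !coefC.
have [_ [b _ eb]] := nmon_top d.+1.
have a0 : a d.+1 = 0.
  have := congr1 (fun P : PL => P`_d.+1) e.
  rewrite coefC coef_sum big_ord_recr /= big1 => [|i _].
    rewrite add0r coefCM => /esym/(congr1 (fun x => x * b)).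
    by rewrite mul0r -mulrA eb mulr1.
  rewrite coefCM [(nmon _)`_ _]nth_default ?mulr0 //.
  by have [sz _] := nmon_top i; apply: leq_trans sz _.
by apply: IHd; rewrite e big_ord_recr /= a0 mul0r addr0.
Qed.

Lemma wfrob_constW (x : W) : constW (wfrob x) = wfrob (constW x).
Proof. exact: (witt_map_wfrob (@polyC L)). Qed.

(** * Divisibility of [X] by powers of [t], and specialization at [X = 0] *)

Section KappaSpan.
Variables (V : set L) (Vr : is_subring V) (EV : forall x, E x -> V x).
Hypothesis Vkappa0 : forall i, V (kappa0 i).

Definition kspan : set PL := [set P | exists d, nspan V d P].

Lemma filt_kspan d P : filt d P -> kspan P.
Proof.
move=> /filt_nspan hP; exists d; elim: hP => [|i c Q lei Ec _ IH]; first exact: nspan0.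
by apply: nspan_cons => //; apply: EV.
Qed.

Lemma kspanC c : V c -> kspan c%:P.
Proof. by move=> Vc; exists 0%N; rewrite -[c%:P]mulr1 -nmon0; apply: nspan_nmon. Qed.

Lemma kspanD P Q : kspan P -> kspan Q -> kspan (P + Q).
Proof.
move=> [a hP] [b hQ]; exists (maxn a b).
by apply: nspanD; [apply: nspan_le hP; rewrite leq_maxl | apply: nspan_le hQ; rewrite leq_maxr].
Qed.

Lemma kspanMC c P : V c -> kspan P -> kspan (c%:P * P).
Proof. by move=> Vc [a hP]; exists a; apply: nspanMC. Qed.

Lemma kspanM P Q : kspan P -> kspan Q -> kspan (P * Q).
Proof.
have k0 : kspan 0 by exists 0%N; apply: nspan0.
move=> [a hP] [b hQ]; elim: hP => [|i c P' lei Vc _ IH]; first by rewrite mul0r.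
rewrite mulrDl; apply: kspanD => //; rewrite -mulrA; apply: kspanMC => //.
elim: hQ => [|j c' Q' lej Vc' _ IH']; first by rewrite mulr0.
rewrite mulrDr mulrCA; apply: kspanD => //; apply: kspanMC => //.
by apply: (@filt_kspan (i + j)); apply: filtM; apply: filt_nmon.
Qed.

Lemma kspan_subring : is_subring kspan.
Proof.
have V1 := is_subring1 Vr.
split=> [|P P' Q Q' [-> hP] [-> hQ]|P P' [-> hP]|P P' Q Q' [-> hP] [-> hQ]]; split=> //.
- by rewrite -polyC1; apply: kspanC.
- exact: kspanD.
- rewrite -mulN1r -(rmorphN1 (@polyC L)); apply: kspanMC => //.
  exact: (is_subringN Vr).
- exact: kspanM.
Qed.

Lemma kspanX : kspan 'X.
Proof.
rewrite kappaX; apply: (is_subringB kspan_subring); first exact/kspanC/EV/EF.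
rewrite -mul_polyC; apply: kspanMC; last exact: filt_kspan (filt_kappa 0).
by apply: EV; apply: (is_subringM Er) => //; apply: Ew.
Qed.

Lemma poly_kspan P : poly_over V P -> kspan P.
Proof.
move=> hP; rewrite -[P]coefK poly_def.
apply: (is_subring_sum kspan_subring) => i _; rewrite -mul_polyC.
by apply: kspanMC => //; apply: (is_subringX kspan_subring); apply: kspanX.
Qed.

(* As [xi * (kappa - kappa0) = [X]], the Witt vector [kappa - kappa0] and with
   it [X] are divisible, up to Frobenius, by all powers of [t] *)
Lemma kspan_tower n : exists m : WP, exists s : PL,
  [/\ witt_over kspan m, kspan s, (t ^+ (n * p ^ n))%:P * s = 'X ^+ (p ^ n) &
      constW (iter n (@wfrob p p_pr L) xi) * m = teichP s].
Proof.
have Kr := kspan_subring; have WKr := witt_over_subring p_pr Kr.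
have WKC (x : W) : (forall i, V (x i)) -> witt_over kspan (constW x).
  by move=> Vx i; apply/kspanC/Vx.
elim: n => [|n [m [s [Km Ks es em]]]].
  exists (kappa - constW kappa0), 'X; split; first 1 last.
  - exact: kspanX.
  - by rewrite mul0n expr0 mul1r expn0 expr1.
  - by rewrite mulrBr -witt_mapM xi_kappa0 xi_kappa witt_mapN opprK subrK.
  apply: (is_subringB WKr) => [i|]; first exact: filt_kspan (filt_kappa i).
  exact: WKC.
pose xn := iter n (@wfrob p p_pr L) xi; pose wn := iter n (@wfrob p p_pr L) w.
pose tn := t ^+ (p ^ n).
have exn : xn = p%:R - teich tn * wn.
  rewrite /xn /wn /tn; elim: (n) => [|k IHk]; first by rewrite expn0 expr1.
  rewrite /= IHk wfrobB // wfrobM // wfrob_teich // -exprM -expnSr.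
  by rewrite -[p%:R]/(1 *+ p) wfrobMn // wfrob1.
have Ewn : WE wn.
  by rewrite /wn; elim: (n) => [|k IHk] // i; apply: (is_subringX Er); apply: IHk.
have eqn : teichP s = m *+ p - teichP tn%:P * (constW wn * m).
  rewrite -em -/xn exn witt_mapB witt_mapM witt_map_nat witt_map_teichmuller.
  by rewrite mulrBl mulr_natl mulrA.
pose z := constW wn * m.
have Kz : witt_over kspan z.
  by apply: (is_subringM WKr) => //; apply: WKC => i; apply/EV/Ewn.
(* In [[s] + [tn] * z = p * m] the first coordinate vanishes, which makes [s] divisible by [tn] with
   this quotient. *)
pose sig := - z 0%N.
have Ksig : kspan sig by apply: (is_subringN Kr); apply: Kz.
have es' : s = tn%:P * sig.
  have := congr1 (fun x : WP => x 0%N) eqn.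
  by rewrite wcoord0B (witt_mulp_coord0 chP) sub0r wcoord0M mulrN.
(* Now [p * m = [tn] * u] with [u] in the image of Verschiebung. Dividing by [p] turns [m] into its
   Frobenius, which is why the next level involves the Frobenius of [xi]. *)
pose u := teichP sig + z.
have Ku : witt_over kspan u.
  by apply: (is_subringD WKr) => // -[|i] //; apply: (is_subring0 Kr).
have u0 : u 0%N = 0 by rewrite /u wcoord0D /= /sig addNr.
have eu := wcoord_eq0 u0.
have tn0 : tn%:P ^+ p != 0 :> PL by rewrite expf_neq0 // polyC_eq0 expf_neq0.
have em' : m *+ p = teichP tn%:P * u.
  by rewrite /u mulrDr -teichM -es' eqn subrK.
have eFm : wfrob m = teichP (tn%:P ^+ p) * wshift u.
  apply: (witt_mulpI chP); rewrite -wfrobMn ?chP // em' eu wfrobM ?chP //.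
  by rewrite wfrob_teich // wfrobV -witt_mulp ?chP // mulrnAr.
exists (wshift u), (sig ^+ p); split.
- by move=> i; apply: Ku.
- exact: (is_subringX Kr).
- rewrite expnSr [RHS]exprM -es es' !exprMn -!rmorphXn -!exprM mulrA -rmorphM -exprD.
  by congr (_%:P * _); congr (_ ^+ _); rewrite mulSn; ring.
rewrite /= -/xn; apply: (teich_mulI tn0).
have := congr1 (@wfrob p p_pr PL) em; rewrite wfrobM ?chP // -wfrob_constW -/xn.
by rewrite wfrob_teich // eFm mulrCA es' exprMn teichM.
Qed.

(** A large power [kappa i ^ q] has coefficients in [E] with respect to the [nmon], and differs from
    the constant [kappa0 i ^ q] by [t ^ (n * q)] times an element of the [V]-span; the coefficients
    of [nmon 0] are compared and [q]-th roots taken. *)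
Lemma kappa0_approx i n : (forall x, V (x ^+ p) -> V x) ->
  exists e v, [/\ E e, V v & kappa0 i = e + t ^+ n * v].
Proof.
move=> Vroot; have Kr := kspan_subring; have PEr := poly_over_subring Er.
have Vroots k x : V (x ^+ (p ^ k)) -> V x.
  elim: k x => [|k IHk] x; first by rewrite expn0 expr1.
  by rewrite expnSr exprM => /Vroot /IHk.
pose Q : PL := \poly_(j < size (kappa i)) (kappa i)`_j.+1.
have eQ : kappa i = (kappa0 i)%:P + 'X * Q.
  apply/polyP => j; rewrite coefD coefC coefXM kappa0E horner_coef0.
  case: j => [|j] /=; first by rewrite addr0.
  rewrite add0r coef_poly; case: ltnP => // lej.
  by rewrite nth_default //; apply: leq_trans lej _.
have Qloc : poly_over Eloc Q.
  move=> j; rewrite coef_poly; case: ltnP => _; first exact: kappa_loc.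
  exact: (is_subring0 Eloc_subring).
have [b Eb] := poly_loc_bound Qloc.
(* The [b] additional levels pay for the denominators of [Q]. *)
have [_ [s [_ Ks es _]]] := kspan_tower (n + b); set q := (p ^ (n + b))%N in es.
have EV' P : poly_over E P -> poly_over V P by move=> h j; apply/EV/h.
pose Y := s * ((t ^+ b)%:P * Q) ^+ q.
have [d1 hY] : kspan Y by apply: (is_subringM Kr) => //; apply/(is_subringX Kr)/poly_kspan/EV'.
have hk : nspan E (q * p ^ i) (kappa i ^+ q).
  apply: filt_nspan; elim: (q) => [|k IHk]; first by rewrite expr0 -polyC1; apply/filtC/(is_subring1 Er).
  by rewrite exprS mulSn; apply: filtM => //; apply: filt_kappa.
have [a [Ea ea]] := nspan_coef Er (nspan_le (leq_maxr d1 _) hk).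
have [v [Vv ev]] := nspan_coef Vr (nspan_le (leq_maxl _ (q * p ^ i)) hY).
have ek : kappa i ^+ q = (kappa0 i ^+ q)%:P + (t ^+ (n * q))%:P * Y.
  rewrite eQ char_expnD ?chP // exprMn -es /Y exprMn !polyC_exp -!exprM mulnDl exprD.
  by ring.
have e0 : kappa0 i ^+ q = a 0%N - t ^+ (n * q) * v 0%N.
  apply: (@nmon_const (maxn d1 (q * p ^ i)) _ (fun j => a j - t ^+ (n * q) * v j)).
  under eq_bigr do rewrite polyCB mulrBl polyCM -mulrA.
  by rewrite big_split /= sumrN -mulr_sumr -ev -ea ek addrK.
have [x ex] := perfect_root (n + b) (a 0%N); have [y ey] := perfect_root (n + b) (v 0%N).
exists x, (- y); split.
- by apply: (@perfect_subring_root (n + b)); rewrite ex.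
- by apply: (is_subringN Vr); apply: (Vroots (n + b)%N); rewrite ey.
by rewrite mulrN; apply: (char_expI p_pr chL (n := n + b)); rewrite char_expnB // exprMn -exprM ex ey e0.
Qed.

End KappaSpan.

(* The perfect ring generated by [E] and the coordinates of [- F / xi] *)
Definition Dinf : set L := [set x | forall S : set L, perfect_subring p S ->
  (forall y, E y -> S y) -> (forall i, S (kappa0 i)) -> S x].

Lemma Dinf_perfect_subring : perfect_subring p Dinf.
Proof.
split=> [|x Dx S Sp ES kS]; last by apply: (proj2 Sp); apply: Dx.
split=> [|x x' y y' [-> Dx] [-> Dy]|x x' [-> Dx]|x x' y y' [-> Dx] [-> Dy]];
  split=> // S Sp ES kS.
- exact: (is_subring1 (proj1 Sp)).
- by apply: (is_subringD (proj1 Sp)); [apply: Dx | apply: Dy].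
- by apply: (is_subringN (proj1 Sp)); apply: Dx.
- by apply: (is_subringM (proj1 Sp)); [apply: Dx | apply: Dy].
Qed.

Lemma subset_Dinf x : E x -> Dinf x.
Proof. by move=> Ex S _ ES _; apply: ES. Qed.

Lemma Dinf_kappa0 i : Dinf (kappa0 i).
Proof. by move=> S _ _; apply. Qed.

Lemma Dinf_approx d n : Dinf d -> exists e v, [/\ E e, Dinf v & d = e + t ^+ n * v].
Proof.
(* Approximating the generators is enough, since the elements approximable to every order form a
   perfect subring. *)
have [Dr Droot] := Dinf_perfect_subring => Dd.
pose S : set L := fun x => Dinf x /\
  forall k, exists e v, [/\ E e, Dinf v & x = e + t ^+ k * v].
have DE := subset_Dinf.
suff Sp : perfect_subring p S.
  have [_ h] : S d; last exact: h.
  apply: Dd => [//|x Ex|i].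
    split; first exact: DE.
    by move=> k; exists x, 0; split=> //; [exact: (is_subring0 Dr) | rewrite mulr0 addr0].
  split; first exact: Dinf_kappa0.
  by move=> k; apply: (kappa0_approx Dr DE Dinf_kappa0 i k Droot).
split; last first.
  move=> x [Dx hx]; split; first exact: Droot.
  (* Taking a [p]-th root divides the order of approximation by [p]. *)
  move=> k; have [e [v [Ee Dv ex]]] := hx (k * p)%N.
  have [[y ey] [z ez]] := conj (perfL e) (perfL v); exists y, z; split.
  - by apply: Eroot; rewrite ey.
  - by apply: Droot; rewrite ez.
  by apply: (char_expI1 p_pr chL); rewrite char_exprD // exprMn -exprM ey ez.
split=> [|x x' y y' [-> [Dx hx]] [-> [Dy hy]]|x x' [-> [Dx hx]]|x x' y y' [-> [Dx hx]] [-> [Dy hy]]];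
  split=> //.
- split; first exact: (is_subring1 Dr).
  move=> k; exists 1, 0; split; [exact: (is_subring1 Er) | exact: (is_subring0 Dr) |].
  by rewrite mulr0 addr0.
- split; first exact: (is_subringD Dr).
  move=> k; have [[e [v [Ee Dv ->]]] [f [u [Ef Du ->]]]] := conj (hx k) (hy k).
  exists (e + f), (v + u); split; [exact: (is_subringD Er) | exact: (is_subringD Dr) | by ring].
- split; first exact: (is_subringN Dr).
  move=> k; have [e [v [Ee Dv ->]]] := hx k.
  exists (- e), (- v); split; [exact: (is_subringN Er) | exact: (is_subringN Dr) | by ring].
split; first exact: (is_subringM Dr).
move=> k; have [e [v [Ee Dv ex]]] := hx k; have [f [u [Ef Du ey]]] := hy k.
exists (e * f), (e * u + v * f + t ^+ k * v * u); split; first exact: (is_subringM Er).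
  have [De Df] := conj (DE _ Ee) (DE _ Ef).
  have Dt : Dinf (t ^+ k) by apply: DE; apply: (is_subringX Er).
  have DM := is_subringM Dr.
  exact: (is_subringD Dr (is_subringD Dr (DM _ _ De Du) (DM _ _ Dv Df)) (DM _ _ (DM _ _ Dt Dv) Du)).
by rewrite ex ey; ring.
Qed.

Hypothesis Ecomplete : forall u : nat -> L, (forall n, E (u n)) ->
  exists2 x, E x & forall n, exists2 y, E y & x - \sum_(i < n) t ^+ i * u i = t ^+ n * y.

Lemma Dinf_loc d : Dinf d -> Eloc d.
Proof.
apply; [|exact: subset_Eloc|].
  have -> : Eloc = gbounded 0 by apply/funext => x; apply/propext; rewrite gbounded0.
  exact: (gbounded_perfect_subring WE0).
by move=> i; rewrite kappa0E horner_coef0; apply: kappa_loc.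
Qed.

Lemma xi_dvd_Dinf :
  (forall x, E x -> (forall n, exists2 d, Dinf d & x = t ^+ n * d) -> x = 0) -> xi_dvd F.
Proof.
have Dr := proj1 Dinf_perfect_subring.
move=> h; suff DE d : Dinf d -> E d.
  exists (- kappa0); last by rewrite mulrN xi_kappa0 opprK.
  by apply: (is_subringN WEr) => i; apply: DE; apply: Dinf_kappa0.
move=> Dd; have hex x : exists ev : L * L, Dinf x -> [/\ E ev.1, Dinf ev.2 & x = ev.1 + t * ev.2].
  have [Dx|nDx] := pselect (Dinf x); last by exists (0, 0).
  by have [e [v [Ee Dv ex]]] := Dinf_approx 1 Dx; exists (e, v).
have [f hf] := choice hex.
pose dn n := iter n (fun d => (f d).2) d.
have Ddn n : Dinf (dn n) by elim: n => [//|n IHn]; have [] := hf _ IHn.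
have ed n : d = \sum_(i < n) t ^+ i * (f (dn i)).1 + t ^+ n * dn n.
  elim: n => [|n IHn]; first by rewrite big_ord0 add0r mul1r.
  have [_ _ e] := hf _ (Ddn n).
  by rewrite big_ord_recr /= {1}IHn {1}e exprSr mulrDr addrA mulrA.
have [n|x Ex hx] := Ecomplete (u := fun i => (f (dn i)).1); first by have [] := hf _ (Ddn n).
(* The limit [x] differs from [d] by an element divisible in [Dinf] by all powers of [t]. Since the
   hypothesis concerns elements of [E], the difference is first moved there by [t ^ B]. *)
have [B EB] := Dinf_loc Dd.
suff e : t ^+ B * (d - x) = 0.
  by move/eqP: e; rewrite mulf_eq0 expf_eq0 (negPf t0) andbF subr_eq0 => /eqP ->.
apply: h.
  by rewrite mulrBr; apply: (is_subringB Er) => //; apply: (is_subringM Er) => //; apply: (is_subringX Er).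
move=> n; have [y Ey ey] := hx n; exists (t ^+ B * (dn n - y)).
  apply: (is_subringM Dr); first by apply: subset_Dinf; apply: (is_subringX Er).
  by apply: (is_subringB Dr) => //; apply: subset_Dinf.
by rewrite mulrCA [_ * (_ - y)]mulrBr -ey {1}(ed n); congr (_ * _); ring.
Qed.

Lemma xi_dvd_annihilator (G : W) : WE G -> xi_dvd (F * G) -> ~ xi_dvd F ->
  exists x, [/\ E x, x != 0 & xi_dvd (teich x * G)].
Proof.
move=> EG dFG ndF.
have [x [Ex hx x0]] : exists x, [/\ E x, forall n, exists2 d, Dinf d & x = t ^+ n * d & x != 0].
  apply: contrapT => hne; apply: ndF; apply: xi_dvd_Dinf => x Ex hx.
  by apply/eqP; apply: contrapT => x0; apply: hne; exists x; split=> //; apply/negP.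
exists x; split=> //; apply: gbounded_dvd => // n; have [d Dd ->] := hx n.
(* By minimality of [Dinf] it remains to bound the coordinates of [- F / xi] by [G], which is
   possible because [xi] divides [F * G]. *)
exists d => //; apply: Dd; first exact: gbounded_perfect_subring.
  exact: gbounded_subset.
have ENF : WE (- F) by apply: (is_subringN WEr).
move=> i; apply: (gbounded_quotient EG i xi_kappa0).
  by move=> j; apply: (gbounded_subset EG); apply: ENF.
exists 0%N; first by rewrite mul1r.
by rewrite mul1r mulNr -mulrN1; apply: xi_dvdMr => //; apply: (is_subringN WEr); apply: (is_subring1 WEr).
Qed.

End Envelope.

Hypothesis Eunit : forall e, E e -> exists2 e', E e' & (1 + t * e) * e' = 1.
Hypothesis Ecomplete : forall u : nat -> L, (forall n, E (u n)) ->
  exists2 x, E x & forall n, exists2 y, E y & x - \sum_(i < n) t ^+ i * u i = t ^+ n * y.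
Hypothesis tsep : forall x, E x -> (forall n, exists2 y, E y & x = t ^+ n * y) -> x = 0.

(** The first coordinate of [[x] = xi * z] gives [x = t * b]; as [[t]] cancels modulo [xi], the same
    applies to [b], and so on through all powers of [t]. *)
Lemma xi_dvd_teich a : E a -> xi_dvd (teich a) -> a = 0.
Proof.
suff h n x : E x -> xi_dvd (teich x) -> exists2 y, E y & x = t ^+ n * y.
  by move=> Ea da; apply: tsep => // n; apply: h.
elim: n x => [|n IHn] x Ex; first by exists x; rewrite ?mul1r.
case=> z Ez ez; pose b := - (w 0%N * z 0%N).
have Eb : E b by apply: (is_subringN Er); apply: (is_subringM Er); [apply: Ew | apply: Ez].
have ex : x = t * b.
  have /(congr1 (fun u : W => u 0%N)) := ez.
  rewrite xiE wcoord0B wcoord0M wcoord0M witt_mulp_coord0 // sub0r /= => ->.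
  by rewrite mulrN.
have [|y Ey ey] := IHn b Eb; last by exists y; rewrite // exprS -mulrA -ey.
apply: (@teich_cancel t 1 _ z Et (is_subring1 Er) _ (WEt Eb) Ez); first by rewrite mulr1.
by rewrite -teichM -ex.
Qed.

Lemma xi_prime x y : WE x -> WE y -> xi_dvd (x * y) -> xi_dvd x \/ xi_dvd y.
Proof.
move=> Ex Ey dxy; apply: contrapT => /not_orP[nx ny].
have [a [Ea a0 day]] := xi_dvd_annihilator Ex Eunit Ecomplete Ey dxy nx.
rewrite mulrC in day.
have [b [Eb b0 dab]] := xi_dvd_annihilator Ey Eunit Ecomplete (WEt Ea) day ny.
move: dab; rewrite -teichM => /xi_dvd_teich - /(_ (is_subringM Er Eb Ea)) /eqP.
by rewrite mulf_eq0 (negPf a0) (negPf b0).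
Qed.

Lemma xi_dvd1 : ~ xi_dvd 1.
Proof. by rewrite -(teich1 p_pr L) => /xi_dvd_teich - /(_ (is_subring1 Er)) /eqP; rewrite oner_eq0. Qed.

End Untilting.

(** * Residue fields of prime ideals *)

Lemma fraction_eq (Q : idomainType) (y : {fraction Q}) :
  exists a b : Q, b != 0 /\ y = FracField.tofrac a / FracField.tofrac b.
Proof.
elim/quotW: y => r; exists (frac r).1, (frac r).2; have r0 := denom_ratioP r.
split=> //.
have b0 : (FracField.tofrac (frac r).2 : {fraction Q}) != 0 by rewrite tofrac_eq0.
apply: (mulIf b0); rewrite divfK //.
rewrite -[LHS]/(FracField.mul _ _) !piE.
rewrite /FracField.mulf !numden_Ratio ?oner_eq0 // mulr1.
apply/eqmodP; rewrite /= FracField.equivfE !numden_Ratio ?oner_eq0 //.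
by rewrite mulr1 mulrC.
Qed.

Lemma fraction_field (Q : comNzRingType) : GRing.integral_domain_axiom Q ->
  exists (L : fieldType) (f : {rmorphism Q -> L}),
    (forall x, f x = 0 -> x = 0) /\ forall y, exists a b, f b != 0 /\ y = f a / f b.
Proof.
move=> Qid.
(* The fraction field takes a domain with a unit predicate and an inverse; both are chosen
   classically, the inverse being the identity off the units. *)
pose unit : pred Q := fun x => `[< exists y, y * x = 1 >].
pose inv (x : Q) : Q := if pselect (exists y, y * x = 1) is left h then projT1 (cid h) else x.
have mulVx : {in unit, left_inverse 1 inv *%R}.
  move=> x /asboolP ux; rewrite /inv; case: pselect => // h.
  by case: (cid h).
have unitP x y : y * x = 1 -> unit x by move=> e; apply/asboolP; exists y.
have inv_out : {in [predC unit], inv =1 id}.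
  by move=> x /asboolP ux; rewrite /inv; case: pselect.
pose Q1 : comUnitRingType := HB.pack Q (GRing.ComNzRing_hasMulInverse.Build Q mulVx unitP inv_out).
pose Q2 : idomainType := HB.pack (GRing.ComUnitRing.sort Q1) (GRing.ComUnitRing_isIntegral.Build Q1 Qid).
exists {fraction Q2}, (@FracField.tofrac Q2 : {rmorphism Q2 -> {fraction Q2}}); split.
  by move=> x /eqP; rewrite tofrac_eq0 => /eqP.
move=> y; have [a [b [b0 ->]]] := fraction_eq y.
by exists a, b; split=> //; rewrite tofrac_eq0.
Qed.

Lemma prime_residue_field (D : comPzRingType) (q : set D) : prime_ideal q ->
  exists (L : fieldType) (psi : {rmorphism D -> L}),
    (forall x, psi x = 0 <-> q x) /\ forall y, exists a b, psi b != 0 /\ y = psi a / psi b.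
Proof.
case=> -[q0 qD qM] [q1 qp].
have D0 : (1 : D) != 0 by apply/eqP => e; apply: q1; rewrite e.
pose D1 : comNzRingType := HB.pack (GRing.ComPzRing.sort D) (GRing.PzSemiRing_isNonZero.Build D D0).
pose I0 : {pred D1} := fun x => `[< q x >].
have clI : idealr_closed I0.
  split; [exact/asboolP | exact/asboolP |].
  by move=> a u v /asboolP qu /asboolP qv; apply/asboolP; apply: qD => //; apply: qM.
have pI : prime_idealr_closed I0.
  by move=> u v /asboolP /qp[] h; apply/orP; [left|right]; apply/asboolP.
pose I : prime_idealr D1 := HB.pack I0 (isIdealr.Build D1 I0 clI) (isPrimeIdealrClosed.Build D1 I0 pI).
pose pi : {rmorphism D1 -> {ideal_quot I}} := \pi_{ideal_quot I}%qT.
have pi0 x : pi x = 0 <-> q x.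
  have e0 : (x \in I) = (pi x == pi 0) by rewrite -[in LHS](subr0 x) Quotient.idealrBE.
  by split=> [/eqP|qx]; [|apply/eqP]; rewrite -(rmorph0 pi) -e0; [move/asboolP | apply/asboolP].
have [|L [f [f0 fr]]] := @fraction_field {ideal_quot I}.
  move=> x y; rewrite -[x]reprK -[y]reprK -!/(pi _) -rmorphM => /pi0/qp[] /pi0 ->.
    by rewrite eqxx.
  by rewrite eqxx orbT.
exists L, (f \o pi : {rmorphism D1 -> L}); split=> [x|y].
  rewrite -pi0 /=; split=> [/f0 //|->]; exact: rmorph0.
have [a [b [b0 ->]]] := fr y.
by exists (repr a), (repr b); rewrite /= /pi /= !reprK.
Qed.

(** * Prime ideals of Witt vectors modulo xi *)

Section PrimeModulo.
Variables (p : nat) (p_pr : prime p) (D : comPzRingType).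
Hypotheses (chD : p%:R = 0 :> D) (perfD : forall x : D, exists y, y ^+ p = x).
Variables (t : D) (w w' : wittring p_pr D).
Hypothesis ww' : w * w' = 1.
Hypothesis Dunit : forall d, is_unit (1 + t * d).
Hypothesis Dcomplete : forall u : nat -> D,
  exists x, forall n, divides (t ^+ n) (x - \sum_(i < n) t ^+ i * u i).
Variable q : set D.
Hypotheses (q_prime : prime_ideal q) (q_closed : adic_closed t q).

(** The inverse image in [W(D)] of the ideal [(xi)] of [W(D / q)]. *)
Definition witt_modulo (xi : wittring p_pr D) : set (wittring p_pr D) :=
  fun x => exists z, forall i, q ((x - xi * z) i).

Lemma witt_modulo_prime (xi : wittring p_pr D) : xi = p%:R - teichmuller p_pr t * w ->
  prime_ideal (witt_modulo xi).
Proof.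
move=> xiE; have [L [psi [psi0 psi_frac]]] := prime_residue_field q_prime.
pose E : set L := fun x => exists a, x = psi a.
pose Psi (x : wittring p_pr D) : wittring p_pr L := witt_map psi x.
have chL : p%:R = 0 :> L by rewrite -(rmorph_nat psi) chD rmorph0.
have perfL (x : L) : exists y, y ^+ p = x.
  have [a [b [_ ->]]] := psi_frac x; have [[c ec] [d ed]] := conj (perfD a) (perfD b).
  by exists (psi c / psi d); rewrite exprMn exprVn -!rmorphXn ec ed.
have Er : is_subring E.
  split=> [|x x' y y' [-> [a ->]] [-> [b ->]]|x x' [-> [a ->]]|x x' y y' [-> [a ->]] [-> [b ->]]];
    split=> //.
  - by exists 1; rewrite rmorph1.
  - by exists (a + b); rewrite rmorphD.
  - by exists (- a); rewrite rmorphN.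
  - by exists (a * b); rewrite rmorphM.
have Ep : perfect_subring p E.
  split=> // x [a ea]; have [b eb] := perfD a; exists b.
  by apply: (char_expI1 p_pr chL); rewrite ea -eb rmorphXn.
have EPsi x : witt_over E (Psi x) by move=> i; exists (x i).
have PsiP (x : wittring p_pr L) : witt_over E x -> exists y, x = Psi y.
  by move=> /choice[y ey]; exists y; apply/funext.
have moduloP x : witt_modulo xi x <-> xi_dvd E (Psi xi) (Psi x).
  split=> [[z qz]|[_ /PsiP[z ->] ez]].
    exists (Psi z) => //; apply/eqP; rewrite -subr_eq0 -witt_mapM -witt_mapB; apply/eqP.
    by apply/funext => i; apply/psi0.
  exists z => i; apply/psi0; rewrite -[psi _]/(Psi (x - xi * z) i) /Psi witt_mapB witt_mapM.
  by rewrite -/(Psi _) ez subrr.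
have xi1E : Psi xi = p%:R - teichmuller p_pr (psi t) * Psi w.
  by rewrite xiE /Psi witt_mapB witt_mapM witt_map_nat witt_map_teichmuller.
split.
  split=> [|x y /moduloP[z Ez ez] /moduloP[z' Ez' ez']|a x /moduloP[z Ez ez]]; apply/moduloP.
  - by exists 0; [exact: (is_subring0 (witt_over_subring p_pr Er)) | rewrite mulr0; exact: (rmorph0 (witt_map psi))].
  - exists (z + z'); first exact: (is_subringD (witt_over_subring p_pr Er)).
    by rewrite mulrDr -ez -ez' -witt_mapD.
  exists (Psi a * z); first exact: (is_subringM (witt_over_subring p_pr Er)).
  by rewrite mulrCA -ez -witt_mapM.
(* If [t] lies in [q], divisibility by [xi = p] means that the first coordinate vanishes in the
   field. *)
have [t0|t0] := eqVneq (psi t) 0.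
  rewrite t0 teich0 mul0r subr0 in xi1E.
  split=> [/moduloP[z _]|x y /moduloP[z _]]; rewrite xi1E /Psi ?witt_map1 ?witt_mapM mulr_natl.
    by move/(congr1 (fun x : wittring p_pr L => x 0%N)) => /eqP; rewrite witt_mulp_coord0 // oner_eq0.
  move/(congr1 (fun x : wittring p_pr L => x 0%N)) => /eqP.
  rewrite witt_mulp_coord0 // wcoord0M mulf_eq0.
  have h (x1 : wittring p_pr D) : Psi x1 0%N = 0 -> witt_modulo xi x1.
    move=> /(perfect_mulp chL perfL)[u eu]; apply/moduloP; rewrite xi1E; exists u; last by rewrite eu mulr_natl.
    by apply: (witt_over_mulp chL Ep); rewrite -eu.
  by case/orP => /eqP /h; [left | right].
have Eunit e : E e -> exists2 e', E e' & (1 + psi t * e) * e' = 1.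
  move=> [a ->]; have [b eb] := Dunit a; exists (psi b); first by exists b.
  by rewrite -rmorphM -(rmorph1 psi) -rmorphD -rmorphM eb.
have Ecomplete (u : nat -> L) : (forall n, E (u n)) ->
    exists2 x, E x & forall n, exists2 y, E y & x - \sum_(i < n) psi t ^+ i * u i = psi t ^+ n * y.
  move=> /choice[v ev]; have [x hx] := Dcomplete v; exists (psi x); first by exists x.
  move=> n; have [y ey] := hx n; exists (psi y); first by exists y.
  rewrite -rmorphXn -rmorphM -ey rmorphB rmorph_sum; congr (_ - _).
  by apply: eq_bigr => i _; rewrite ev rmorphM rmorphXn.
(* Divisibility of the image of [a] by [t ^ n] says that [a] is within [t ^ n] of an element of
   [q]. *)
have tsep x : E x -> (forall n, exists2 y, E y & x = psi t ^+ n * y) -> x = 0.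
  move=> [a ->] ha; apply/psi0; apply: q_closed => n; have [_ [b ->] eb] := ha n.
  exists (a - t ^+ n * b); last by exists b; rewrite opprB addrC subrK.
  by apply/psi0; rewrite rmorphB rmorphM rmorphXn eb subrr.
have Et : E (psi t) by exists t.
have Ew : witt_over E (Psi w) := EPsi w.
have Pww' : Psi w * Psi w' = 1 by rewrite -witt_mapM ww' witt_map1.
split=> [/moduloP|x y /moduloP dxy].
  by rewrite /Psi witt_map1; apply: (xi_dvd1 chL perfL Ep Et t0 xi1E Ew tsep).
have := xi_prime chL perfL Ep Et t0 xi1E Ew (EPsi w') Pww' Eunit Ecomplete tsep (EPsi x) (EPsi y).
by rewrite -witt_mapM => /(_ dxy)[] /moduloP; [left | right].
Qed.

End PrimeModulo.

Lemma prime_ideal_image (A B : comPzRingType) (f : {rmorphism A -> B}) (J : set A) (I : set B) :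
  (forall y, exists x, f x = y) -> (forall x, J x <-> I (f x)) ->
  prime_ideal J -> prime_ideal I.
Proof.
move=> fsurj JI [[J0 JD JM] [J1 Jp]]; split; [split|split].
- by rewrite -(rmorph0 f); apply/JI.
- move=> x y; have [[a <-] [b <-]] := conj (fsurj x) (fsurj y).
  by move=> /JI Ja /JI Jb; rewrite -rmorphD; apply/JI; apply: JD.
- move=> x y; have [[a <-] [b <-]] := conj (fsurj x) (fsurj y).
  by move=> /JI Jb; rewrite -rmorphM; apply/JI; apply: JM.
- by rewrite -(rmorph1 f) => /JI.
move=> x y; have [[a <-] [b <-]] := conj (fsurj x) (fsurj y).
by rewrite -rmorphM => /JI/Jp[] /JI; [left | right].
Qed.

(** * Tilts and the theta map *)

Section Divisibility.
Variable A : comPzRingType.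
Implicit Types a b c x y : A.

Lemma dividesD a x y : divides a x -> divides a y -> divides a (x + y).
Proof. by move=> [c ->] [d ->]; exists (c + d); rewrite mulrDr. Qed.

Lemma dividesN a x : divides a x -> divides a (- x).
Proof. by move=> [c ->]; exists (- c); rewrite mulrN. Qed.

Lemma dividesB a x y : divides a x -> divides a y -> divides a (x - y).
Proof. by move=> ax ay; apply: dividesD => //; apply: dividesN. Qed.

Lemma dividesMl a b x : divides a x -> divides a (b * x).
Proof. by move=> [c ->]; exists (b * c); rewrite mulrCA. Qed.

Lemma divides_trans a b x : divides a b -> divides b x -> divides a x.
Proof. by move=> [c ->] [d ->]; exists (c * d); rewrite mulrA. Qed.

Lemma dividesX a b n : divides a b -> divides (a ^+ n) (b ^+ n).
Proof. by move=> [c ->]; exists (c ^+ n); rewrite exprMn. Qed.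

Lemma divides_expW a m n x : (m <= n)%N -> divides (a ^+ n) x -> divides (a ^+ m) x.
Proof. by move=> /subnKC <-; rewrite exprD; apply: divides_trans; exists (a ^+ (n - m)). Qed.

(** The [a]-adic limit of [u] exists. Its distance to [u N] is divisible by [b ^ N], because the
    tail, with [b ^ N] factored out, is a series that converges [a]-adically as well. *)
Lemma adic_complete_divides a b : adic_complete a -> divides a b -> adic_complete b.
Proof.
move=> [alim asep] ab; split=> [u hu|x hx]; last first.
  by apply: asep => n; apply: divides_trans (hx n); apply: dividesX.
have /choice[d hd] : forall n, exists d, u n.+1 - u n = b ^+ n * d by [].
have part N m : u (N + m)%N - u N = b ^+ N * \sum_(i < m) b ^+ i * d (N + i)%N.
  elim: m => [|m IHm]; first by rewrite addn0 subrr big_ord0 mulr0.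
  rewrite big_ord_recr /= mulrDr -IHm mulrA -exprD -hd addnS.
  by ring.
have [x hx] : exists x, adic_lim a u x.
  by apply: alim => n; apply: divides_trans (hu n); apply: dividesX.
exists x => N.
have [y hy] : exists y, adic_lim a (fun m => \sum_(i < m) b ^+ i * d (N + i)%N) y.
  apply: alim => n; rewrite big_ord_recr /= addrAC subrr add0r mulrC; apply: dividesMl.
  exact: dividesX.
exists y; apply/eqP; rewrite -subr_eq0; apply/eqP/asep => m.
have -> : x - u N - b ^+ N * y = (x - u (N + m)%N) - b ^+ N * (y - \sum_(i < m) b ^+ i * d (N + i)%N).
  by rewrite mulrBr -part; ring.
apply: dividesB; last exact: dividesMl.
by apply: divides_expW (hx _); rewrite leq_addl.
Qed.

End Divisibility.

Section CoordinateMorphisms.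
Variables (p : nat) (p_pr : prime p) (R : comPzRingType).

Lemma modp_pi_zmod_morphism : zmod_morphism (@modp_pi p R).
Proof. by move=> x y; apply/eqP; rewrite eq_sym subr_eq -modp_piD subrK. Qed.
HB.instance Definition _ :=
  GRing.isZmodMorphism.Build R (Defs.modp p R) (@modp_pi p R) modp_pi_zmod_morphism.

Lemma modp_pi_monoid_morphism : monoid_morphism (@modp_pi p R).
Proof. by split=> // x y; apply: modp_piM. Qed.
HB.instance Definition _ :=
  GRing.isMonoidMorphism.Build R (Defs.modp p R) (@modp_pi p R) modp_pi_monoid_morphism.

Definition tilt_coord n (x : tilt R p_pr) : Defs.modp p R := x n.

Lemma tilt_coord_zmod_morphism n : zmod_morphism (tilt_coord n).
Proof. by []. Qed.
HB.instance Definition _ n :=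
  GRing.isZmodMorphism.Build (tilt R p_pr) (Defs.modp p R) (tilt_coord n) (tilt_coord_zmod_morphism n).

Lemma tilt_coord_monoid_morphism n : monoid_morphism (tilt_coord n).
Proof. by []. Qed.
HB.instance Definition _ n :=
  GRing.isMonoidMorphism.Build (tilt R p_pr) (Defs.modp p R) (tilt_coord n) (tilt_coord_monoid_morphism n).

End CoordinateMorphisms.

Section Sharp.
Variables (p : nat) (p_pr : prime p) (R : comPzRingType).
Hypothesis pcomplete : adic_complete (p%:R : R).
Local Notation D := (tilt R p_pr).
Local Notation congr n := (@congr_mod R setT (p ^ n)).

Let Tr : is_subring [set: R] := is_subring_setT R.

Lemma divides_congr n (x y : R) : divides (p%:R ^+ n) (x - y) <-> congr n x y.
Proof.
split=> [[c ec]|[_ _ [c _ ec]]]; last by exists c; rewrite ec -natrX mulr_natl.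
by split=> //; exists c => //; rewrite ec -natrX mulr_natl.
Qed.

Lemma modp_pi_congr (x y : R) : modp_pi p x = modp_pi p y <-> congr 1 x y.
Proof. by rewrite -divides_congr expr1; apply: modp_piP. Qed.

Lemma congrW m n (x y : R) : (m <= n)%N -> congr n x y -> congr m x y.
Proof. by rewrite -!divides_congr; apply: divides_expW. Qed.

Lemma congr_eq (x y : R) : (forall n, congr n x y) -> x = y.
Proof.
move=> h; apply/eqP; rewrite -subr_eq0; apply/eqP/(proj2 pcomplete) => n.
exact/divides_congr.
Qed.

Lemma congr_lim (u : nat -> R) : (forall n, congr n (u n.+1) (u n)) ->
  exists x, forall n, congr n x (u n).
Proof.
move=> h; have [n|x hx] := proj1 pcomplete u; first exact/divides_congr.
by exists x => n; apply/divides_congr.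
Qed.

Lemma congr_exp n (x y : R) : modp_pi p x = modp_pi p y -> congr n.+1 (x ^+ (p ^ n)) (y ^+ (p ^ n)).
Proof. by move=> /modp_pi_congr h; apply: congr_mod_exp => //; rewrite -[X in congr_mod _ X]expn1. Qed.

Lemma pcompatible_exp (u : nat -> R) n k : pcompatible p u -> u (n + k)%N ^+ (p ^ k) = u n.
Proof.
move=> hu; elim: k => [|k IHk]; first by rewrite addn0 expn0 expr1.
by rewrite addnS expnS exprM hu.
Qed.

Lemma pcompatible_eq (u v : nat -> R) : pcompatible p u -> pcompatible p v ->
  (forall n, modp_pi p (u n) = modp_pi p (v n)) -> u = v.
Proof.
move=> hu hv uv; apply/funext => n; apply: congr_eq => k.
rewrite -(pcompatible_exp n k hu) -(pcompatible_exp n k hv).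
exact: congrW (leqnSn k) (congr_exp k (uv _)).
Qed.

(** For arbitrary lifts [y] of the coordinates, [y (n + k) ^ (p ^ k)] converges with [k], since each
    [p]-th power improves a congruence by one power of [p]. *)
Lemma tilt_liftP (x : D) : pcompatible p (tilt_lift x) /\ forall n, modp_pi p (tilt_lift x n) = x n.
Proof.
suff h : exists u : nat -> R, pcompatible p u /\ forall n, modp_pi p (u n) = x n.
  by rewrite /tilt_lift; case: xgetP => [? ->|] //; have [u hu] := h => /(_ u).
have xp n : x n.+1 ^+ p = x n by have /asboolP := tilt_seqP x; apply.
have /choice[y hy] : forall n, exists y, x n = modp_pi p y by move=> n; apply: modp_pi_surj.
have /choice[u hu] : forall n, exists z, forall k, congr k z (y (n + k)%N ^+ (p ^ k)).
  move=> n; apply: congr_lim => k; rewrite addnS expnS exprM.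
  by apply: congrW (leqnSn k) (congr_exp k _); rewrite modp_piX -!hy.
exists u; split=> n.
  apply: congr_eq => k.
  apply: (congr_mod_trans Tr (y := y (n + k.+1)%N ^+ (p ^ k.+1))); last first.
    by apply: (congr_mod_sym Tr); apply: congrW (leqnSn k) (hu _ _).
  by rewrite addnS -addSn expnSr exprM; apply: (ring_relX (congr_mod_ring_rel Tr _)).
have /modp_pi_congr -> := hu n 1%N.
by rewrite expn1 modp_piX -hy addn1.
Qed.

Lemma sharp_mod (x : D) : modp_pi p (sharp x) = x 0%N.
Proof. exact: (proj2 (tilt_liftP x)). Qed.

Lemma tilt_lift_unique (x : D) (u : nat -> R) : pcompatible p u ->
  (forall n, modp_pi p (u n) = x n) -> tilt_lift x = u.
Proof.
have [hx xE] := tilt_liftP x => hu uE; apply: pcompatible_eq => // n.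
by rewrite xE uE.
Qed.

Lemma tilt_valM (x y : D) n : (x * y) n = x n * y n.
Proof. by []. Qed.

Lemma tilt_valD (x y : D) n : (x + y) n = x n + y n.
Proof. by []. Qed.

Lemma tilt_valB (x y : D) n : (x - y) n = x n - y n.
Proof. by []. Qed.

Lemma sharp_tilt_of (u : nat -> R) (hu : pcompatible p u) : sharp (tilt_of p_pr hu) = u 0%N.
Proof. by rewrite /sharp (tilt_lift_unique (u := u)). Qed.

Lemma sharp_root n (x : D) : sharp (tilt_root n x) = tilt_lift x n.
Proof.
have [hx xE] := tilt_liftP x.
rewrite /sharp (tilt_lift_unique (u := fun k => tilt_lift x (n + k))) ?addn0 // => k.
by rewrite addnS hx.
Qed.

Lemma sharp_rootX k n (x : D) : (k <= n)%N ->
  sharp (tilt_root n x) ^+ (p ^ (n - k)) = sharp (tilt_root k x).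
Proof.
by move=> /subnKC {1}<-; rewrite !sharp_root pcompatible_exp //; case: (tilt_liftP x).
Qed.

Lemma tilt_eq (x y : D) : (forall n, x n = y n) -> x = y.
Proof. by move=> h; apply/val_inj/funext. Qed.

Lemma tilt_charp : p%:R = 0 :> D.
Proof.
apply: tilt_eq => n; rewrite -[LHS]/(tilt_coord n p%:R) rmorph_nat.
by rewrite modp_charp.
Qed.

Lemma tilt_perfect (x : D) : exists y, y ^+ p = x.
Proof. by exists (tilt_root 1 x); rewrite -[X in _ ^+ X]expn1 tilt_rootK. Qed.

Lemma tilt_expr_coord n k (x : D) : x (n + k)%N ^+ (p ^ n) = x k.
Proof.
elim: n => [|n IHn]; first by rewrite expn0.
by rewrite expnS exprM addSn; have /asboolP -> := tilt_seqP x.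
Qed.

Lemma tilt_exprK n (x : D) : tilt_root n (x ^+ (p ^ n)) = x.
Proof.
apply: tilt_eq => k; rewrite -[LHS]/(tilt_coord (n + k) (x ^+ (p ^ n))) rmorphXn.
exact: tilt_expr_coord.
Qed.

Lemma tilt_coordP n (x : D) : x n ^+ (p ^ n) = x 0%N.
Proof. by rewrite -[RHS](tilt_expr_coord n) addn0. Qed.

(** Each [x n] is nilpotent, its [p ^ n]-th power being [x 0]; so the inverse is a finite geometric
    series in each coordinate. *)
Lemma tilt_unit (x : D) : x 0%N = 0 -> is_unit (1 + x).
Proof.
move=> x0; pose y n : Defs.modp p R := \sum_(i < p ^ n) (- x n) ^+ i.
have xy n : (1 + x n) * y n = 1.
  have := subrX1 (- x n) (p ^ n); rewrite -/(y n).
  rewrite exprNn tilt_coordP x0 mulr0 sub0r -opprD mulNr => /oppr_inj.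
  by rewrite [1 + x n]addrC.
have yP : y \in @Frobenius_compatible p R.
  apply/asboolP => n; have e : (1 + x n) * y n.+1 ^+ p = 1.
    have <- : (1 + x n.+1) ^+ p = 1 + x n by have /asboolP := tilt_seqP (1 + x); apply.
    by rewrite -exprMn xy expr1n.
  by rewrite -[LHS]mul1r -(xy n) mulrAC e mul1r.
exists (Tilt _ yP); apply: tilt_eq => n; exact: xy.
Qed.

(** Coordinate [n] of [t ^ i] vanishes once [i] reaches [p ^ n], so that the series is finite in
    each coordinate. *)
Lemma tilt_complete (t : D) (u : nat -> D) : t 0%N = 0 ->
  exists x, forall n, divides (t ^+ n) (x - \sum_(i < n) t ^+ i * u i).
Proof.
move=> t0; pose T (v : nat -> D) n := \sum_(i < n) t ^+ i * v i.
have tX n i : (p ^ n <= i)%N -> (t ^+ i) n = 0.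
  move=> /subnKC <-; rewrite exprD tilt_valM -[(t ^+ _) n]/(tilt_coord n _) rmorphXn.
  by rewrite [_ ^+ _]tilt_coordP t0 mul0r.
have stab v n k : (T v (p ^ n + k)%N) n = T v (p ^ n)%N n.
  elim: k => [|k IHk]; first by rewrite addn0.
  rewrite addnS /T big_ord_recr -/(T _ _) tilt_valD tilt_valM /=.
  by rewrite tX ?leq_addr // mul0r addr0.
have lim v : exists x : D, forall n k, x n = T v (p ^ n + k)%N n.
  have xP : (fun n => T v (p ^ n)%N n) \in @Frobenius_compatible p R.
    apply/asboolP => n; have /asboolP -> := tilt_seqP (T v (p ^ n.+1)%N).
    have le : (p ^ n <= p ^ n.+1)%N by rewrite leq_exp2l ?prime_gt1.
    by rewrite -(subnKC le) stab.
  by exists (Tilt _ xP) => n k; rewrite stab.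
have [x hx] := lim u; exists x => N; have [y hy] := lim (fun i => u (N + i)%N).
exists y; apply: tilt_eq => n.
rewrite tilt_valB -/(T u N) (hx n N) addnC tilt_valM (hy n 0%N) addn0.
have -> : T u (N + p ^ n)%N = T u N + t ^+ N * T (fun i => u (N + i)%N) (p ^ n)%N.
  rewrite /T big_split_ord /= mulr_sumr; congr (_ + _).
  by apply: eq_bigr => i _; rewrite exprD mulrA.
by rewrite tilt_valD tilt_valM addrAC subrr add0r.
Qed.

End Sharp.

(** * The theta map and its kernel *)

Section Theta.
Variables (p : nat) (p_pr : prime p) (R : comPzRingType).
Hypothesis pcomplete : adic_complete (p%:R : R).
Local Notation D := (tilt R p_pr).
Local Notation W := (wittring p_pr D).
Local Notation congr n := (@congr_mod R setT (p ^ n)).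

Let Tr : is_subring [set: R] := is_subring_setT R.
Let congr_rel n : ring_rel (congr n) := congr_mod_ring_rel Tr (p ^ n).

Definition sharp_roots n (w : witt D) : wittring p_pr R := fun k => sharp (tilt_root n (w k)).

(** Rewriting each digit as a power of a [p ^ n]-th root turns the partial sum of the defining
    series into a ghost component; the remaining terms are divisible by [p ^ n.+1]. *)
Lemma thetaP (w : witt D) n : congr n.+1 (theta w) (ghost p (sharp_roots n w) n).
Proof.
pose u n : R := \sum_(k < n) sharp (teichmuller_digit w k) * p%:R ^+ k.
have uS m : congr m (u m.+1) (u m).
  apply/divides_congr; rewrite /u big_ord_recr /= addrAC subrr add0r mulrC.
  by exists (sharp (teichmuller_digit w m)).
have -> : ghost p (sharp_roots n w) n = u n.+1.
  apply: eq_bigr => i _; rewrite sharp_rootX -1?ltnS // mulrC.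
  by rewrite natrX.
apply/divides_congr; rewrite /theta; case: xgetP => [x ->|]; first exact.
have [x hx] := congr_lim pcomplete uS => /(_ x)[] m.
exact/divides_congr.
Qed.

Lemma sharp_roots_mod n (w : W) k : modp_pi p (sharp_roots n w k) = tilt_coord n (w k).
Proof. by rewrite sharp_mod //= /tilt_coord addn0. Qed.

(* Reduced modulo [p ^ n.+1], [theta] is the [n]-th ghost component, applied to
   lifts to [R] of the image of [w] in [W(R / p)] under [x |-> x n]; this is why
   [theta] is a ring morphism *)
Lemma theta_unique (w : W) (x : R) :
  (forall n, exists a : wittring p_pr R, (forall k, modp_pi p (a k) = tilt_coord n (w k)) /\
    congr n.+1 x (ghost p a n)) -> theta w = x.
Proof.
move=> h; apply: (congr_eq pcomplete) => n; apply: congrW (leqnSn n) _.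
have [a [ha xa]] := h n; apply: (congr_mod_trans Tr (thetaP w n)).
apply: (congr_mod_sym Tr); apply: (congr_mod_trans Tr xa); apply: ghost_congr => // i _.
by have := sharp_roots_mod n w i; rewrite -ha => /esym/modp_pi_congr; rewrite expn1.
Qed.

Lemma witt_map_sharp_roots n (x : W) :
  witt_map (@modp_pi p R) (sharp_roots n x) = witt_map (tilt_coord n) x.
Proof. by apply/funext => i; apply: sharp_roots_mod. Qed.

Lemma thetaD (x y : W) : theta (x + y) = theta x + theta y.
Proof.
apply: theta_unique => n; exists (sharp_roots n x + sharp_roots n y); split.
  move=> k; rewrite -[RHS]/(witt_map (tilt_coord n) (x + y) k) witt_mapD.
  rewrite -[LHS]/(witt_map (@modp_pi p R) (sharp_roots n x + sharp_roots n y) k) witt_mapD.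
  by rewrite !witt_map_sharp_roots.
by rewrite ghostD; have [_ rD _ _] := congr_rel n.+1; apply: rD; apply: thetaP.
Qed.

Lemma thetaM (x y : W) : theta (x * y) = theta x * theta y.
Proof.
apply: theta_unique => n; exists (sharp_roots n x * sharp_roots n y); split.
  move=> k; rewrite -[RHS]/(witt_map (tilt_coord n) (x * y) k) witt_mapM.
  rewrite -[LHS]/(witt_map (@modp_pi p R) (sharp_roots n x * sharp_roots n y) k) witt_mapM.
  by rewrite !witt_map_sharp_roots.
by rewrite ghostM; have [_ _ _ rM] := congr_rel n.+1; apply: rM; apply: thetaP.
Qed.

Lemma theta1 : theta (1 : W) = 1.
Proof.
apply: theta_unique => n; exists 1; split; last by rewrite ghost_one; apply: congr_mod_refl.
move=> k; rewrite -[LHS]/(witt_map (@modp_pi p R) 1 k) witt_map1.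
by rewrite -[RHS]/(witt_map (tilt_coord n) 1 k) witt_map1.
Qed.

Lemma theta_teich (x : D) : theta (teichmuller p_pr x) = sharp x.
Proof.
apply: theta_unique => n; exists (teichmuller p_pr (sharp (tilt_root n x))); split.
  move=> k; rewrite -[LHS]/(witt_map (@modp_pi p R) _ k) witt_map_teichmuller.
  rewrite -[RHS]/(witt_map (tilt_coord n) _ k) witt_map_teichmuller.
  by congr (teichmuller _ _ k); rewrite /= sharp_mod //= /tilt_coord addn0.
rewrite ghost_teichmuller; have := sharp_rootX pcomplete x (leq0n n).
by rewrite subn0 => ->; rewrite sharp_root //; apply: congr_mod_refl.
Qed.

Lemma thetaB (x y : W) : theta (x - y) = theta x - theta y.
Proof. by apply/eqP; rewrite eq_sym subr_eq -thetaD subrK. Qed.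

Lemma theta_coord0 (w : W) : modp_pi p (theta w) = w 0%N 0%N.
Proof.
rewrite -[RHS](sharp_roots_mod 0 w 0); apply/modp_pi_congr.
by have := thetaP w 0; rewrite ghost0.
Qed.

Hypothesis Frobenius_surj : forall x : Defs.modp p R, exists y, y ^+ p = x.

Lemma tilt_coord0_surj (x : Defs.modp p R) : exists y : D, y 0%N = x.
Proof.
have [f hf] := choice Frobenius_surj.
have xP : (fun n => iter n f x) \in @Frobenius_compatible p R.
  by apply/asboolP => n; rewrite /= hf.
by exists (Tilt _ xP).
Qed.

Lemma theta_surj (r : R) : exists w : W, theta w = r.
Proof.
have /choice[f hf] : forall r, exists ds : D * R, r = sharp ds.1 + p%:R * ds.2.
  move=> s; have [d hd] := tilt_coord0_surj (modp_pi p s).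
  have /modp_piP[c hc] : modp_pi p s = modp_pi p (sharp d) by rewrite sharp_mod.
  by exists (d, c); rewrite -hc addrC subrK.
pose rn n := iter n (fun s => (f s).2) r.
have hr n : r = \sum_(k < n) sharp (f (rn k)).1 * p%:R ^+ k + p%:R ^+ n * rn n.
  elim: n => [|n IHn]; first by rewrite big_ord0 add0r mul1r.
  rewrite big_ord_recr /= {1}IHn {1}(hf (rn n)) exprSr mulrDr addrA mulrA.
  by rewrite [_ ^+ n * sharp _]mulrC.
(* The power turns Teichmueller digits into Witt coordinates. *)
pose w : W := fun k => (f (rn k)).1 ^+ (p ^ k).
exists w; apply: (congr_eq pcomplete) => n; apply: congrW (leqnSn n) _.
apply: (congr_mod_trans Tr (thetaP w n)); apply: (congr_mod_sym Tr); apply/divides_congr.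
exists (rn n.+1); rewrite {1}(hr n.+1) addrAC; apply/eqP; rewrite -subr_eq0 addrK subr_eq0; apply/eqP.
apply: eq_bigr => i _; rewrite sharp_rootX -1?ltnS // natrX mulrC; congr (_ * sharp _).
by rewrite tilt_exprK.
Qed.

Lemma tilt_unit_coord0 (x : D) (z : Defs.modp p R) : x 0%N * z = 1 -> is_unit x.
Proof.
have [y <-] := tilt_coord0_surj z => xy1.
have [|u hu] := tilt_unit (x := x * y - 1).
  by rewrite tilt_valB tilt_valM xy1 subrr.
by exists (y * u); rewrite mulrA -hu addrC subrK.
Qed.

(** A Witt vector is a unit if its first coordinate is, and an element of the tilt is a unit if its
    image in [R / p] is; that image is [theta w] modulo [p]. *)
Lemma witt_unit_theta (w : W) r : theta w * r = 1 -> exists w' : W, w * w' = 1.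
Proof.
move=> wr; have [a ha] : is_unit (w 0%N).
  apply: (tilt_unit_coord0 (z := modp_pi p r)).
  by rewrite -theta_coord0 -rmorphM wr rmorph1.
exact: (witt_div (tilt_charp p_pr R) 1 ha).
Qed.

Lemma theta_nat n : theta (n%:R : W) = n%:R.
Proof.
elim: n => [|n IHn]; last by rewrite -!natr1 thetaD IHn theta1.
by rewrite !mulr0n -(subrr (1 : W)) thetaB !subrr.
Qed.

Variables (v v' : R) (t : D) (om : W).
Hypotheses (vv' : v * v' = 1) (sharp_t : sharp t = v * p%:R) (theta_om : theta om = v').
Let xi : W := p%:R - teichmuller p_pr t * om.

Lemma theta_xi : theta xi = 0.
Proof.
rewrite thetaB thetaM theta_teich theta_nat theta_om sharp_t mulrAC vv' mul1r.
exact: subrr.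
Qed.

Lemma tilt_coord0_t : t 0%N = 0.
Proof.
by rewrite -sharp_mod // sharp_t rmorphM rmorph_nat modp_charp mulr0.
Qed.

(* Modulo [t] the generator [xi] becomes [p], whose first coordinate is [1]. *)
Lemma theta_ker (xi0 : W) : (forall w : W, theta w = 0 <-> exists w', w = xi0 * w') ->
  forall w : W, theta w = 0 <-> exists z, w = xi * z.
Proof.
move=> ker; have [eta etaE] : exists eta, xi = xi0 * eta by apply/ker; apply: theta_xi.
have xi00 : tilt_coord 0 (xi0 0%N) = 0.
  rewrite /tilt_coord -theta_coord0 (_ : theta xi0 = 0) ?rmorph0 //.
  by apply/ker; exists 1; rewrite mulr1.
have eta_unit : is_unit (eta 0%N).
  (* In [W(R / p)] the image of [xi0] lies in the image of Verschiebung. Coordinate [1] of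
     [xi = xi0 * eta] then writes [1] as a multiple of the [p]-th power of the first coordinate of
     [eta]. *)
  pose f := witt_map (tilt_coord 0 : {rmorphism D -> Defs.modp p R}) : W -> wittring p_pr (Defs.modp p R).
  have fxi : f xi = 1 *+ p.
    by rewrite /f witt_mapB witt_mapM witt_map_nat witt_map_teichmuller /= /tilt_coord tilt_coord0_t teich0 mul0r subr0.
  have fxi0 : f xi0 = verschiebung (wshift (f xi0)) by apply: wcoord_eq0.
  move: fxi; rewrite etaE /f witt_mapM -/f fxi0 mulrC (witt_mulV (modp_charp p R)).
  move/(congr1 (fun x : wittring p_pr (Defs.modp p R) => x 1%N)).
  rewrite (witt_mulp_coord (modp_charp p R)) /= expr1n wcoord0M => e.
  apply: (tilt_unit_coord0 (z := (f eta 0%N) ^+ p.-1 * wshift (f xi0) 0%N)).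
  rewrite mulrA -exprS prednK ?prime_gt0 //; exact: e.
have [a ea] := eta_unit.
have [eta' eta'E] := witt_div (tilt_charp p_pr R) 1 ea.
move=> w; rewrite ker; split=> [[z ->]|[z ->]]; last by exists (eta * z); rewrite etaE mulrA.
by exists (eta' * z); rewrite etaE mulrA -(mulrA xi0) eta'E mulr1.
Qed.

End Theta.

Theorem proposition4p7 (p : nat) (p_pr : prime p) (R : comPzRingType)
    (R_perfectoid : perfectoid R p_pr) (R_char0 : char_zero R)
    (v : R) (v_unit : is_unit v)
    (vp_roots : nat -> R) (vp_roots0 : vp_roots 0%N = v * p%:R)
    (vp_rootsP : pcompatible p vp_roots)
    (q : set (tilt R p_pr)) (q_prime : prime_ideal q)
    (q_closed : adic_closed (tilt_of p_pr vp_rootsP) q) :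
  prime_ideal (untilt q).
Proof.
have [pi [pi_complete pi_p Frobenius_surj [xi0 ker0]]] := R_perfectoid.
have pcomplete : adic_complete (p%:R : R).
  apply: adic_complete_divides pi_complete (divides_trans _ pi_p).
  by rewrite -(prednK (prime_gt0 p_pr)) exprS; exists (pi ^+ p.-1).
set t := tilt_of p_pr vp_rootsP in q_closed.
have sharp_t : sharp t = v * p%:R by rewrite sharp_tilt_of.
have [v' vv'] := v_unit.
have [w theta_w] := theta_surj p_pr pcomplete Frobenius_surj v'.
have [w' ww'] : exists w', w * w' = 1.
  by apply: (witt_unit_theta pcomplete Frobenius_surj (r := v)); rewrite theta_w mulrC.
pose xi : wittring p_pr (tilt R p_pr) := p%:R - teichmuller p_pr t * w.
have ker u : theta u = 0 <-> exists z, u = xi * z.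
  apply: (theta_ker pcomplete Frobenius_surj vv' sharp_t theta_w (xi0 := xi0)) => {}u.
  by rewrite ker0; split=> -[z ->]; exists z; rewrite wittring_mulE.
have t0 := tilt_coord0_t pcomplete sharp_t.
have Dunit d : is_unit (1 + t * d) by apply: tilt_unit; rewrite tilt_valM t0 mul0r.
have := witt_modulo_prime (tilt_charp p_pr R) (@tilt_perfect _ p_pr R) ww' Dunit
  (fun u => tilt_complete u t0) q_prime q_closed (erefl xi).
pose th := @theta p R p_pr : wittring p_pr (tilt R p_pr) -> R.
have thB : zmod_morphism th by move=> x y; apply: thetaB.
have thM : monoid_morphism th by split; [apply: theta1 | move=> x y; apply: thetaM].
pose theta_morph : {rmorphism wittring p_pr (tilt R p_pr) -> R} :=
  HB.pack th (GRing.isZmodMorphism.Build _ _ th thB) (GRing.isMonoidMorphism.Build _ _ th thM).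
(* As [(xi)] is the kernel, the inverse image of [untilt q] is [W(q) + (xi)], which is
   [witt_modulo]. *)
apply: (prime_ideal_image (f := theta_morph)); first exact: theta_surj.
have [[q0 qD qM] [q1 qp]] := q_prime.
(* The ideal [W(q)] is defined by digits and [witt_modulo] by coordinates; digits are roots of
   coordinates, and [q] is radical. *)
have qX x n : q (x ^+ n) -> q x.
  by elim: n => [|n IHn]; [move/q1 | rewrite exprS => /qp[]].
move=> x; split=> [[z qz]|[y qy xy]].
  pose y := x - xi * z; exists y => [n|].
    by apply: (qX _ (p ^ n)%N); rewrite tilt_rootK; apply: qz.
  have e0 : theta (xi * z) = 0 by apply/ker; exists z.
  by have := thetaB pcomplete x (xi * z); rewrite e0 subr0.
pose y1 : wittring p_pr (tilt R p_pr) := y.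
have [z ez] : exists z, x - y1 = xi * z.
  by apply/ker; have := thetaB pcomplete x y1; rewrite [theta y1]xy subrr.
exists z => i; rewrite -ez opprB addrCA subrr addr0 -[y1 i]/(y i).
rewrite -(tilt_rootK i (y i)) -(prednK (n := (p ^ i)%N)) ?expn_gt0 ?prime_gt0 // exprSr.
by apply: qM; apply: qy.
Qed.
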